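(* Let $\{\epsilon_i\}_{i\in\mathbb{Z}}$ be i.i.d. random variables with mean zero and finite variance $\sigma^2$, such that $\epsilon_1$ has zero median and a differentiable density $f$ on $\mathbb{R}$ with $f(0)>0$ and $\sup_{x\in\mathbb{R}}|f'(x)|<\infty$. Let $(\rho_n)$ be a deterministic sequence with $0<\rho_n<1$ and $n(\rho_n-1)\to 0$ as $n\to\infty$. For each $n$, let $y_0=\sum_{j=0}^{\infty}\rho_n^j\epsilon_{-j}$ and $y_i=\rho_n y_{i-1}+\epsilon_i$ for $1\le i\le n$, and let $\hat\rho_{\rm LAD}$ be the least absolute deviation estimator of $\rho_n$ based on $y_0,\dots,y_n$. Then, as $n\to\infty$, $$\sqrt{\frac{n}{1-\rho_n^2}}\,(\hat{\rho}_{\rm LAD}-\rho_n)\rightarrow_d\frac{\mathcal{C}}{2\sigma f(0)}$$ and $$\sqrt{\sum_{i=1}^ny_{i-1}^2}\,(\hat{\rho}_{\rm LAD}-\rho_n)\rightarrow_d\mathscr{N}\left(0,\frac{1}{4f^2(0)}\right).$$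
   Context: The variables $y_i=y_{n,i}$ form a triangular array; the index $n$ is omitted. The least absolute deviation (LAD) estimator $\hat\rho_{\rm LAD}$ (depending on $n$) is a random variable that is a solution of $\hat{\rho}_{\rm LAD}=\arg\min_{\rho\in\mathbb{R}}\left\{\frac{1}{n}\sum_{i=1}^n|y_i-\rho y_{i-1}|\right\}$ (the minimizer need not be unique; any solution is taken). $\rightarrow_d$ denotes weak convergence (convergence in distribution), $\mathcal{C}$ is a standard Cauchy random variable, and $\mathscr{N}(\mu,s^2)$ is a normal random variable with mean $\mu$ and variance $s^2$. *)

(* Defs.v *)
From HB Require Import structures.
From mathcomp Require Import all_boot all_order all_algebra.
From mathcomp Require Import all_classical all_reals all_analysis.
From mathcomp Require Import measurable_realfun.

Set Implicit Arguments.
Unset Strict Implicit.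
Unset Printing Implicit Defensive.

Import Order.TTheory GRing.Theory Num.Theory.
Import numFieldNormedType.Exports.

Local Open Scope classical_set_scope.
Local Open Scope ring_scope.

Section random_variables.
Context (R : realType) (d : measure_display) (T : measurableType d)
  (P : probability T R).

Definition mutually_independent (I : choiceType) (X : I -> {RV P >-> R}) :=
  forall (s : seq I) (A : I -> set R), uniq s ->
    (forall i, measurable (A i)) ->
    (P (\bigcap_(i in [set` s]) (X i @^-1` A i)) =
     \prod_(i <- s) P (X i @^-1` A i))%E.

Definition identically_distributed (I : Type) (X : I -> {RV P >-> R}) :=
  forall (i j : I) (A : set R), measurable A ->
    distribution P (X i) A = distribution P (X j) A.

Definition has_density (X : {RV P >-> R}) (f : R -> R) :=
  (forall x, 0 <= f x) /\
  forall A : set R, measurable A ->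
    distribution P X A = (\int[lebesgue_measure]_(x in A) (f x)%:E)%E.

Definition is_median (m : R) (X : {RV P >-> R}) :=
  ((2^-1)%:E <= P [set w | (X w <= m)%R])%E /\
  ((2^-1)%:E <= P [set w | (m <= X w)%R])%E.

(* Weak convergence of the laws of the X n to the law of Z; Z may live on
   another probability space (T', Q). Plain functions are used together with
   explicit measurability, so that formulas can be passed directly. *)
Definition cvg_in_distribution (X : nat -> T -> R)
    (d' : measure_display) (T' : measurableType d') (Q : probability T' R)
    (Z : T' -> R) :=
  [/\ forall n, measurable_fun setT (X n),
      measurable_fun setT Z &
      forall g : R -> R, continuous g -> (exists M : R, forall x, `|g x| <= M) ->
        (\int[P]_w (g (X n w))%:E)%E @[n --> \oo] -->
        (\int[Q]_z (g (Z z))%:E)%E].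

End random_variables.

Section lad.
Context (R : realType).

Definition lad_loss (n : nat) (y : nat -> R) (r : R) : R :=
  n%:R^-1 * \sum_(1 <= i < n.+1) `|y i - r * y i.-1|.

Definition lad_solution (n : nat) (y : nat -> R) (r : R) :=
  forall r', lad_loss n y r <= lad_loss n y r'.

End lad.

Section cauchy_distribution.
Context (R : realType).
Local Notation mu := (@lebesgue_measure R).

Definition cauchy_pdf (x : R) : R := (pi * (1 + x ^+ 2))^-1.

Definition cauchy_prob : set _ -> \bar R :=
  fun V => (\int[mu]_(x in V) (cauchy_pdf x)%:E)%E.

Lemma cauchy_pdf_ge0 x : 0 <= cauchy_pdf x.
Proof.
by rewrite invr_ge0 mulr_ge0 ?pi_ge0// addr_ge0// exprn_even_ge0.
Qed.

Let cauchy_pdfE : cauchy_pdf = (fun x => pi^-1 * (oneDsqr x)^-1).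
Proof. by apply/funext => x; rewrite /cauchy_pdf invfM. Qed.

Lemma continuous_cauchy_pdf : continuous cauchy_pdf.
Proof.
rewrite cauchy_pdfE => x.
by apply: cvgM; [exact: cvg_cst|exact: continuous_oneDsqrV].
Qed.

Lemma measurable_cauchy_pdf : measurable_fun [set: R] cauchy_pdf.
Proof. by apply: continuous_measurable_fun; exact: continuous_cauchy_pdf. Qed.

Lemma integral_cauchy_pdf : (\int[mu]_x (cauchy_pdf x)%:E = 1)%E.
Proof.
rewrite ge0_symfun_integralT//; first last.
- by move=> x; rewrite /cauchy_pdf /= sqrrN.
- exact: continuous_cauchy_pdf.
- exact: cauchy_pdf_ge0.
have -> : [set x : R | 0 <= x] = `[0, +oo[%classic.
  by apply/seteqP; split => x /=; rewrite in_itv/= andbT.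
under eq_integral do rewrite cauchy_pdfE EFinM.
have pi0 : (pi : R) != 0 by rewrite gt_eqF// pi_gt0.
rewrite ge0_integralZl//.
- rewrite integral0y_oneDsqr -!EFinM; congr EFin.
  by rewrite mulKf// divff// pnatr_eq0.
- apply/measurable_EFinP/measurable_funTS.
  by apply: continuous_measurable_fun; exact: continuous_oneDsqrV.
- by rewrite lee_fin invr_ge0 pi_ge0.
Qed.

Lemma integrable_cauchy_pdf : mu.-integrable [set: R] (EFin \o cauchy_pdf).
Proof.
have mf : measurable_fun [set: R] (EFin \o cauchy_pdf).
  by apply/measurable_EFinP; exact: measurable_cauchy_pdf.
apply/integrableP; split => //.
under eq_integral do rewrite /= ger0_norm ?cauchy_pdf_ge0//.
by rewrite integral_cauchy_pdf ltry.
Qed.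

Let cauchy0 : cauchy_prob set0 = 0%E.
Proof. by rewrite /cauchy_prob integral_set0. Qed.

Let cauchy_ge0 A : (0 <= cauchy_prob A)%E.
Proof. by apply: integral_ge0 => x _; rewrite lee_fin cauchy_pdf_ge0. Qed.

Let cauchy_sigma_additive : semi_sigma_additive cauchy_prob.
Proof.
move=> /= A mA tA mUA.
rewrite /cauchy_prob/= integral_bigcup//=; last first.
  by apply: (integrableS _ _ (subsetT _)) => //; exact: integrable_cauchy_pdf.
apply: is_cvg_ereal_nneg_natsum_cond => n _ _.
by apply: integral_ge0 => /= x ?; rewrite lee_fin cauchy_pdf_ge0.
Qed.

HB.instance Definition _ := isMeasure.Build _ _ _
  cauchy_prob cauchy0 cauchy_ge0 cauchy_sigma_additive.

Let cauchy_setT : cauchy_prob [set: _] = 1%E.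
Proof. by rewrite /cauchy_prob integral_cauchy_pdf. Qed.

HB.instance Definition _ :=
  @Measure_isProbability.Build _ _ R cauchy_prob cauchy_setT.

End cauchy_distribution.
Arguments cauchy_prob {R} _.

(* Main.v *)
(* Write kappa = 1 - rho^2, V = y_0, A = sqrt(kappa) V, B = n^(-1/2) sum_i sg(eps_i),
   a = sqrt(kappa / n) and t^ = (rho_LAD - rho) / a.  Convexity of the loss says that t^ is
   where the decreasing function S(t) = a sum_i y_(i-1) sg(eps_i - t a y_(i-1)) changes sign.
   Since n (1 - rho) -> 0, every y_i stays close to V on the scale kappa^(-1/2), and a
   martingale computation together with E sg(eps - s) = - 2 f(0) s + O(s^2) gives
   S(t) = A (B - 2 f(0) t A) + o_P(1) for each t.  Hence t^ = B / (2 f(0) A) + o_P(1) and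
   sqrt(sum y_(i-1)^2) (rho_LAD - rho) = sg(A) B / (2 f(0)) + o_P(1).  The variables A and B
   are independent, being functions of the past and of the future noise, and Lindeberg's
   theorem gives A -> N(0, sigma^2) and B -> N(0, 1); for A the weights sqrt(kappa) rho^j are
   uniformly small because kappa -> 0.  The ratio of two independent Gaussian variables is
   Cauchy, and the sign of A does not affect the law of B.

   The central limit theorem is proved uniformly over bounded Lipschitz test functions by
   Trotter's replacement argument; smoothing is done by averaging twice over short intervals,
   which keeps the second derivative Lipschitz. *)

From HB Require Import structures.
Require Import Defs.
From mathcomp Require Import all_boot all_order all_algebra.
From mathcomp Require Import all_classical all_reals all_analysis.
From mathcomp Require Import measurable_realfun zify ring lra.

Set Implicit Arguments.
Unset Strict Implicit.
Unset Printing Implicit Defensive.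

Import Order.TTheory GRing.Theory Num.Theory.
Import numFieldNormedType.Exports.
Local Open Scope classical_set_scope.
Local Open Scope ring_scope.

(** Conditional expectations are avoided. The sample space equipped with the sigma-algebra of a
    block of noise serves as the range of a random element, the identity, which is independent of
    the next noise variable; conditioning then becomes Fubini for a product law. Only second moments
    are available. Hence Taylor remainders are kept in the form u^2 min(1, |u|), and the score is
    split so that centred parts are bounded in L2, the part that multiplies the path by a jump of
    the sign only in L1, and V leaves a sum before that sum is squared. Instead A is frozen and the
    limit theorem for B is applied at all values |A| > eta at once, which is why it must be uniform
    over test functions with given bounds; the event |A| <= eta is paid for by a small-ball bound.
    The start y_0 is given as an almost sure limit, and the sigma-algebra of the past need not
    contain the null sets; a version measurable for the past noise replaces it before independence
    is used. *)

Definition bounded_lipschitz (R : realType) (M K : R) (g : R -> R) :=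
  (forall x, `|g x| <= M) /\ (forall x y, `|g x - g y| <= K * `|x - y|).

(** * Bounded Lipschitz test functions *)

Section lipschitz.
Context (R : realType).
Implicit Types (g : R -> R) (M K : R).

Lemma lipschitz_continuous g K :
  (forall x y, `|g x - g y| <= K * `|x - y|) -> continuous g.
Proof.
move=> gK x; apply/cvgrPdist_le => e e0; near=> y.
rewrite (le_trans (gK _ _))//.
have K0 : 0 < `|K| + 1 by rewrite ltr_wpDl.
rewrite (@le_trans _ _ ((`|K| + 1) * `|x - y|))//.
  by rewrite ler_wpM2r// (le_trans (ler_norm _))// lerDl.
rewrite mulrC -ler_pdivlMr//; near: y.
by apply: cvgr_dist_le => //; rewrite divr_gt0.
Unshelve. all: by end_near. Qed.

Lemma bounded_lipschitz_continuous M K g : bounded_lipschitz M K g -> continuous g.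
Proof. by case=> _ /lipschitz_continuous. Qed.

Lemma bounded_lipschitz_measurable M K g :
  bounded_lipschitz M K g -> measurable_fun setT g.
Proof.
by move=> /bounded_lipschitz_continuous; exact: continuous_measurable_fun.
Qed.

Lemma bounded_lipschitz_ge0 M K g : bounded_lipschitz M K g -> 0 <= M /\ 0 <= K.
Proof.
move=> [gM gK]; split; first exact: le_trans (normr_ge0 _) (gM 0).
by have := le_trans (normr_ge0 _) (gK 0 1); rewrite sub0r normrN normr1 mulr1.
Qed.

Lemma bounded_lipschitz_affine M K g a b : bounded_lipschitz M K g ->
  bounded_lipschitz M (K * `|b|) (fun x => g (a + b * x)).
Proof.
move=> [gM gK]; split => // x y; rewrite (le_trans (gK _ _))//.
have -> : a + b * x - (a + b * y) = b * (x - y) by ring.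
by rewrite normrM mulrA.
Qed.

End lipschitz.

(** * Expectations and square integrable variables *)

Section expectation.
Context d (T : measurableType d) (R : realType) (P : probability T R).
Implicit Types (X Y : T -> R).

Lemma bounded_integrable X M : measurable_fun setT X ->
  (forall w, `|X w| <= M) -> P.-integrable setT (EFin \o X).
Proof.
move=> mX XM; apply: measurable_bounded_integrable => //.
  by rewrite (le_lt_trans (probability_le1 P measurableT))// ltry.
exists M; split; first by rewrite num_real.
by move=> x Mx w _ /=; rewrite (le_trans (XM w))// ltW.
Qed.

Lemma integral_prob_cst c : (\int[P]_w c = c :> R)%R.
Proof. by rewrite Rintegral_cst//= probability_setT mulr1. Qed.

Lemma integral_prob_cstE (c : R) : (\int[P]_w c%:E = c%:E)%E.
Proof. by rewrite integral_cst//= probability_setT mule1. Qed.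

Lemma EFin_Rintegral X : P.-integrable setT (EFin \o X) ->
  (\int[P]_w X w)%:E = (\int[P]_w (X w)%:E)%E.
Proof. by move=> iX; rewrite /Rintegral fineK//; exact: integrable_fin_num. Qed.

Lemma le_integrable_norm X Y : measurable_fun setT X ->
  P.-integrable setT (EFin \o Y) -> (forall w, `|X w| <= Y w) ->
  P.-integrable setT (EFin \o X).
Proof.
move=> mX iY XY; apply: (le_integrable measurableT _ _ iY).
  exact/measurable_EFinP.
by move=> w _ /=; rewrite lee_fin (le_trans (XY w))// ler_norm.
Qed.

Lemma integrable_scale c X : P.-integrable setT (EFin \o X) ->
  P.-integrable setT (EFin \o (fun w => c * X w)).
Proof.
move=> iX; have := integrableZl measurableT c iX.
by apply: eq_integrable => // w _ /=; rewrite EFinM.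
Qed.

Lemma norm_Rintegral_le X Y : measurable_fun setT X ->
  P.-integrable setT (EFin \o Y) -> (forall w, `|X w| <= Y w) ->
  `|\int[P]_w X w| <= \int[P]_w Y w.
Proof.
move=> mX iY XY; have iX := le_integrable_norm mX iY XY.
rewrite (le_trans (le_normr_Rintegral _ iX))//.
by apply: le_Rintegral => //; exact: integrable_norm.
Qed.

Lemma norm_Rintegral_bounded X M : measurable_fun setT X ->
  (forall w, `|X w| <= M) -> `|\int[P]_w X w| <= M.
Proof.
move=> mX XM; rewrite -[leRHS]integral_prob_cst.
by apply: norm_Rintegral_le => //; exact: finite_measure_integrable_cst.
Qed.

Lemma dist_Rintegral_le X Y Z : P.-integrable setT (EFin \o X) ->
  P.-integrable setT (EFin \o Y) -> P.-integrable setT (EFin \o Z) ->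
  (forall w, `|X w - Y w| <= Z w) ->
  `|\int[P]_w X w - \int[P]_w Y w| <= \int[P]_w Z w.
Proof.
move=> iX iY iZ XYZ; rewrite -RintegralB//; apply: norm_Rintegral_le => //.
by apply: measurable_funB; apply/measurable_EFinP; exact: (measurable_int P).
Qed.

Definition square_integrable X :=
  measurable_fun setT X /\ P.-integrable setT (EFin \o (fun w => X w ^+ 2)).

Lemma bounded_square_integrable X M : measurable_fun setT X ->
  (forall w, `|X w| <= M) -> square_integrable X.
Proof.
move=> mX XM; split => //; apply: (@bounded_integrable _ (M ^+ 2)).
  exact: measurable_funX.
move=> w; rewrite normrX lerXn2r ?nnegrE//.
exact: le_trans (normr_ge0 _) (XM w).
Qed.

Lemma square_integrableM X Y : square_integrable X -> square_integrable Y ->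
  P.-integrable setT (EFin \o (fun w => X w * Y w)).
Proof.
move=> [mX iX] [mY iY].
apply: (@le_integrable_norm _ (fun w => X w ^+ 2 + Y w ^+ 2)).
- exact: measurable_funM.
- exact: (integrableD measurableT iX iY).
- move=> w; rewrite normrM -(real_normK (num_real (X w))) -(real_normK (num_real (Y w))).
  have := sqr_ge0 (`|X w| - `|Y w|); have := normr_ge0 (X w); have := normr_ge0 (Y w).
  by nra.
Qed.

Lemma square_integrable1 X : square_integrable X -> P.-integrable setT (EFin \o X).
Proof.
move=> sX; have s1 : square_integrable (cst 1).
  by apply: (@bounded_square_integrable _ 1) => // w; rewrite normr1.
have := square_integrableM sX s1.
by under [X in _ _ X]eq_fun do rewrite /= mulr1.
Qed.

Lemma square_integrableD X Y : square_integrable X -> square_integrable Y ->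
  square_integrable (fun w => X w + Y w).
Proof.
move=> sX sY; have [mX iX] := sX; have [mY iY] := sY; split.
  exact: measurable_funD.
have iXY := square_integrableM sX sY.
have := integrableD measurableT (integrableD measurableT iX (integrableD measurableT iXY iXY)) iY.
apply: eq_integrable => // w _ /=; rewrite -!EFinD; congr EFin.
by ring.
Qed.

Lemma square_integrable_bdM X Y M : measurable_fun setT X ->
  (forall w, `|X w| <= M) -> square_integrable Y ->
  square_integrable (fun w => X w * Y w).
Proof.
move=> mX XM [mY iY]; split; first exact: measurable_funM.
apply: (@le_integrable_norm _ (fun w => M ^+ 2 * Y w ^+ 2)).
- by apply/measurable_funX/measurable_funM.
- have := integrableZl measurableT (M ^+ 2) iY.
  by apply: eq_integrable => // w _ /=; rewrite EFinM.
- move=> w; rewrite normrX normrM exprMn (real_normK (num_real (Y w))).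
  rewrite ler_wpM2r ?sqr_ge0// lerXn2r ?nnegrE//.
  exact: le_trans (normr_ge0 _) (XM w).
Qed.

Lemma square_integrableZ c X : square_integrable X ->
  square_integrable (fun w => c * X w).
Proof.
by move=> sX; apply: (@square_integrable_bdM _ _ `|c|).
Qed.

Lemma square_integrableB X Y : square_integrable X -> square_integrable Y ->
  square_integrable (fun w => X w - Y w).
Proof.
move=> sX /(square_integrableZ (-1)) /(square_integrableD sX).
by under [X in _ X -> _]eq_fun do rewrite mulN1r.
Qed.

Lemma square_integrable_sum (I : eqType) (s : seq I) (X : I -> T -> R) :
  (forall i, i \in s -> square_integrable (X i)) ->
  square_integrable (fun w => \sum_(i <- s) X i w).
Proof.
elim: s => [_|i s IH iX].
  under eq_fun do rewrite big_nil.
  by apply: (@bounded_square_integrable _ 0) => // w; rewrite normr0.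
under eq_fun do rewrite big_cons.
apply: square_integrableD; first by apply: iX; rewrite mem_head.
by apply: IH => j js; apply: iX; rewrite inE js orbT.
Qed.

End expectation.

(** * Independence *)

Section independence.
Context d (T : measurableType d) (R : realType) (P : probability T R).
Implicit Types (A C : set T) (G : set (set T)).

(** [A |-> P (A & C)] and [A |-> P A * P C] are finite measures that agree on the pi-system [G],
    hence on the sigma-algebra it generates. The second is built as a scaled measure, for which
    [P C] is turned into a nonnegative real. *)
Lemma independent_generated G C : measurable C -> G `<=` measurable ->
  setI_closed G -> G setT ->
  (forall A, G A -> P (A `&` C) = (P A * P C)%E) ->
  forall A, <<s G >> A -> P (A `&` C) = (P A * P C)%E.
Proof.
move=> mC mG GI GT GC A sA.
have PCfin : P C \is a fin_num by exact: fin_num_measure.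
have PC0 : 0 <= fine (P C) by rewrite fine_ge0.
pose m1 : {measure set T -> \bar R} := mrestr P mC.
pose m2 : {measure set T -> \bar R} := mscale (NngNum PC0) P.
have : m1 A = m2 A.
  apply: (@g_sigma_algebra_measure_unique _ _ _ G mG (fun=> setT)) => //.
  - exact: bigcup_const.
  - by move=> B GB; rewrite /m1 /m2/= /mrestr /mscale/= GC// fineK// muleC.
  - move=> _; rewrite /m1/= /mrestr (le_lt_trans (probability_le1 P _)) ?ltry//.
    exact: measurableI.
by rewrite /m1 /m2/= /mrestr /mscale/= fineK// muleC.
Qed.

(** One side is extended at a time: for a fixed generated [A] the second set varies, and for a fixed
    generator in [G2] the first set varies. *)
Lemma independent_generated2 G1 G2 :
  G1 `<=` measurable -> G2 `<=` measurable ->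
  setI_closed G1 -> setI_closed G2 -> G1 setT -> G2 setT ->
  (forall A C, G1 A -> G2 C -> P (A `&` C) = (P A * P C)%E) ->
  forall A C, <<s G1 >> A -> <<s G2 >> C -> P (A `&` C) = (P A * P C)%E.
Proof.
move=> mG1 mG2 GI1 GI2 GT1 GT2 G12 A C sA sC.
have mA : measurable A by apply: (smallest_sub (@sigma_algebra_measurable _ T) mG1).
rewrite setIC muleC; apply: (independent_generated mA mG2) => // B GB.
rewrite setIC muleC; apply: (independent_generated (mG2 _ GB) mG1) => //.
by move=> D GD; exact: G12.
Qed.

Section decouple.
Context d1 d2 (S1 : measurableType d1) (S2 : measurableType d2).
Variables (U : T -> S1) (V : T -> S2).
Hypothesis mU : measurable_fun setT U.
Hypothesis mV : measurable_fun setT V.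
Hypothesis UV : forall (A : set S1) (B : set S2), measurable A -> measurable B ->
  P (U @^-1` A `&` V @^-1` B) = (P (U @^-1` A) * P (V @^-1` B))%E.

HB.instance Definition _ := isMeasurableFun.Build _ _ T S1 U mU.
HB.instance Definition _ := isMeasurableFun.Build _ _ T S2 V mV.

Let PU : probability S1 R := distribution P U.
Let PV : probability S2 R := distribution P V.
Let UVpair (w : T) : S1 * S2 := (U w, V w).
Let mUV : measurable_fun setT UVpair.
Proof. exact: measurable_fun_pair. Qed.
HB.instance Definition _ := isMeasurableFun.Build _ _ T (S1 * S2)%type UVpair mUV.

(** Independence on rectangles determines the law of the pair, so integrals of functions of [U] and
    [V] reduce to Fubini, with [V] replaced by an independent copy. *)
Let product_law X : measurable X -> (PU \x PV)%E X = distribution P UVpair X.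
Proof.
move=> mX; apply: (@product_measure_unique _ _ _ _ _ PU PV (distribution P UVpair)).
  by move=> A B mA mB; exact: UV.
by [].
Qed.

Lemma measurable_integral_decouple (H : S1 * S2 -> \bar R) :
  measurable_fun setT H -> (forall x, 0 <= H x)%E ->
  measurable_fun setT (fun w => \int[P]_w' H (U w, V w'))%E.
Proof.
move=> mH H0.
rewrite (_ : (fun w => _) = fubini_F PV H \o U); last first.
  apply/funext => w; rewrite /fubini_F/= ge0_integral_distribution//.
  exact: measurableT_comp.
by apply: measurableT_comp => //; exact: measurable_fun_fubini_tonelli_F.
Qed.

Lemma ge0_integral_decouple (H : S1 * S2 -> \bar R) :
  measurable_fun setT H -> (forall x, 0 <= H x)%E ->
  (\int[P]_w H (U w, V w) = \int[P]_w \int[P]_w' H (U w, V w'))%E.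
Proof.
move=> mH H0.
transitivity (\int[distribution P UVpair]_x H x)%E.
  by rewrite ge0_integral_distribution.
transitivity (\int[(PU \x PV)%E]_x H x)%E.
  by apply: eq_measure_integral => A mA _; first [exact: product_law|exact/esym/product_law].
rewrite fubini_tonelli1// ge0_integral_distribution//; last 2 first.
- exact: measurable_fun_fubini_tonelli_F.
- by move=> x; exact: integral_ge0.
apply: eq_integral => w _ /=; rewrite /fubini_F ge0_integral_distribution//.
exact: measurableT_comp.
Qed.

(** The nonnegative case is applied to the positive and the negative part. Integrability of
    [H (U, V)] makes both iterated integrals finite, so their difference can be moved inside. *)
Lemma integral_decouple (H : S1 * S2 -> \bar R) :
  measurable_fun setT H -> P.-integrable setT (fun w => H (U w, V w)) ->
  (\int[P]_w H (U w, V w) = \int[P]_w \int[P]_w' H (U w, V w'))%E.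
Proof.
move=> mH iH; rewrite integralE.
pose Hp := H^\+%E; pose Hn := H^\-%E.
have mHp : measurable_fun setT Hp by exact: measurable_funepos.
have mHn : measurable_fun setT Hn by exact: measurable_funeneg.
have Hp0 x : (0 <= Hp x)%E by exact: funepos_ge0.
have Hn0 x : (0 <= Hn x)%E by exact: funeneg_ge0.
have pE := ge0_integral_decouple mHp Hp0.
have nE := ge0_integral_decouple mHn Hn0.
have fin_int (K : S1 * S2 -> \bar R) : measurable_fun setT K ->
    (forall x, 0 <= K x)%E -> (\int[P]_w K (U w, V w) < +oo)%E ->
    P.-integrable setT (fun w => \int[P]_w' K (U w, V w'))%E.
  move=> mK K0 Koo; apply/integrableP; split.
    exact: measurable_integral_decouple.
  under eq_integral do rewrite gee0_abs ?integral_ge0//.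
  by rewrite -ge0_integral_decouple.
have posE w : (fun w => H (U w, V w))^\+%E w = Hp (U w, V w) by rewrite /Hp !funeposE.
have negE w : (fun w => H (U w, V w))^\-%E w = Hn (U w, V w) by rewrite /Hn !funenegE.
have := integral_funepos_lt_pinfty measurableT iH.
under eq_integral do rewrite posE.
move=> /(fin_int _ mHp Hp0) iFp.
have := integral_funeneg_lt_pinfty measurableT iH.
under eq_integral do rewrite negE.
move=> /(fin_int _ mHn Hn0) iFn.
rewrite pE nE -integralB//.
apply: eq_integral => w _ /=; rewrite [RHS]integralE; congr (_ - _)%E.
  by apply: eq_integral => w' _; rewrite /Hp !funeposE.
by apply: eq_integral => w' _; rewrite /Hn !funenegE.
Qed.

Lemma Rintegral_decouple (H : S1 * S2 -> R) M :
  measurable_fun setT H -> (forall x, `|H x| <= M) ->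
  \int[P]_w H (U w, V w) = \int[P]_w \int[P]_w' H (U w, V w').
Proof.
move=> mH HM; congr fine.
have := @integral_decouple (EFin \o H); rewrite /= => ->.
- apply: eq_integral => w _; rewrite EFin_Rintegral//.
  apply: (@bounded_integrable _ _ _ _ _ M) => //.
  by apply: (measurableT_comp mH); exact: measurable_fun_pair.
- exact/measurable_EFinP.
- apply: (@bounded_integrable _ _ _ _ _ M) => //.
  by apply: (measurableT_comp mH); exact: measurable_fun_pair.
Qed.

End decouple.

Section cylinders.
Variable eps : int -> {RV P >-> R}.
Hypothesis eps_indep : mutually_independent eps.
Implicit Types J K : set int.

(** The pi-system of finite-dimensional cylinders. The list is duplicate-free and [B] is measurable
    at every index because this is the form in which [mutually_independent] applies. *)
Definition cylinders J : set (set T) := [set C | exists (s : seq int) (B : int -> set R),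
  [/\ uniq s, [set` s] `<=` J, forall i, measurable (B i) &
      C = \bigcap_(i in [set` s]) (eps i @^-1` B i)]].

Lemma cylinders_measurable J : cylinders J `<=` measurable.
Proof.
move=> _ [s [B [_ _ mB ->]]]; rewrite bigcap_seq; apply: bigsetI_measurable => i _.
exact: measurable_funPTI.
Qed.

Lemma cylinders_setT J : cylinders J setT.
Proof.
exists [::], (fun=> setT); split => //.
by apply/seteqP; split => // w _ i.
Qed.

Lemma cylinders_setI_closed J : setI_closed (cylinders J).
Proof.
move=> _ _ [s1 [B1 [u1 J1 m1 ->]]] [s2 [B2 [u2 J2 m2 ->]]].
(* A coordinate constrained by only one of the two cylinders receives the whole line from the
   other. *)
pose B i := (if i \in s1 then B1 i else setT) `&` (if i \in s2 then B2 i else setT).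
exists (undup (s1 ++ s2)), B; split.
- exact: undup_uniq.
- by move=> i /=; rewrite mem_undup mem_cat => /orP[/J1|/J2].
- by move=> i; apply: measurableI; case: ifPn.
- apply/seteqP; split => w /=.
    move=> [W1 W2] i /=; rewrite mem_undup mem_cat => _; split => /=.
      by case: ifPn => // is1; exact: W1.
    by case: ifPn => // is2; exact: W2.
  move=> W; split => i /= iss; have := W i; rewrite /= mem_undup mem_cat iss ?orbT => /(_ isT)[];
  by rewrite /= iss.
Qed.

(** For disjoint [J] and [K] the concatenated list is still duplicate-free, so mutual independence
    applies to it and the product splits. *)
Lemma cylinders_independent J K A C : (forall i, J i -> K i -> False) ->
  cylinders J A -> cylinders K C -> P (A `&` C) = (P A * P C)%E.
Proof.
move=> JK [s1 [B1 [u1 J1 m1 ->]]] [s2 [B2 [u2 J2 m2 ->]]].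
have s12 i : i \in s1 -> i \in s2 -> False by move=> /J1 + /J2; exact: JK.
pose B i := if i \in s1 then B1 i else B2 i.
transitivity (P (\bigcap_(i in [set` s1 ++ s2]) (eps i @^-1` B i))).
  congr (P _); apply/seteqP; split => w /=.
    move=> [W1 W2] i /=; rewrite mem_cat /B; case: ifPn => [is1 _|_ /= is2].
      exact: W1.
    exact: W2.
  move=> W; split => i /= iss; have := W i; rewrite /= mem_cat iss ?orbT /B => /(_ isT).
    by rewrite iss.
  by case: ifPn => // is1; have := s12 _ is1 iss.
rewrite eps_indep//; last 2 first.
- rewrite cat_uniq u1 u2 andbT; apply/hasPn => i is2 /=.
  by apply/negP => is1; exact: (s12 i).
- by move=> i; rewrite /B; case: ifPn.
rewrite big_cat/=; congr (_ * _)%E; rewrite eps_indep//.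
  by apply: eq_big_seq => i is1; rewrite /B is1.
apply: eq_big_seq => i is2; rewrite /B ifF//; apply/negP => is1.
exact: (s12 i).
Qed.

(* the sample space equipped with the sigma-algebra generated by the eps i, i in J *)
Definition info J := g_sigma_algebraType (cylinders J).

Lemma info_independent d1 d2 (S1 : measurableType d1) (S2 : measurableType d2)
    J K (U : T -> S1) (V : T -> S2) (A : set S1) (B : set S2) :
  (forall i, J i -> K i -> False) ->
  measurable_fun setT (U : info J -> S1) -> measurable_fun setT (V : info K -> S2) ->
  measurable A -> measurable B ->
  P (U @^-1` A `&` V @^-1` B) = (P (U @^-1` A) * P (V @^-1` B))%E.
Proof.
move=> JK mU mV mA mB.
have := mU measurableT A mA; have := mV measurableT B mB.
rewrite !setTI => sB sA.
apply: (@independent_generated2 (cylinders J) (cylinders K)) => //.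
- exact: cylinders_measurable.
- exact: cylinders_measurable.
- exact: cylinders_setI_closed.
- exact: cylinders_setI_closed.
- exact: cylinders_setT.
- exact: cylinders_setT.
- by move=> ? ?; exact: cylinders_independent.
Qed.

Lemma info_measurable d1 (S1 : measurableType d1) J (U : T -> S1) :
  measurable_fun setT (U : info J -> S1) -> measurable_fun setT U.
Proof.
move=> mU _ A mA; have := mU measurableT A mA; rewrite !setTI.
apply: smallest_sub; first exact: sigma_algebra_measurable.
exact: cylinders_measurable.
Qed.

(** Makes a whole block of noise a single random element with values in [info eps J]; pairing it
    with a noise variable outside the block replaces conditioning on the block. *)
Lemma info_id J : measurable_fun setT (id : T -> info J).
Proof. exact: (@info_measurable _ (info J) J (id : T -> info J)). Qed.

Lemma info_subset d1 (S1 : measurableType d1) J K (U : T -> S1) : J `<=` K ->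
  measurable_fun setT (U : info J -> S1) -> measurable_fun setT (U : info K -> S1).
Proof.
move=> JK mU _ A mA; have := mU measurableT A mA; rewrite !setTI.
apply: sub_sigma_algebra2 => C [s [B [us sJ mB ->]]].
by exists s, B; split => //; exact: subset_trans JK.
Qed.

Lemma info_eps J i : J i -> measurable_fun setT (eps i : info J -> R).
Proof.
move=> Ji _ A mA; rewrite setTI; apply: sub_sigma_algebra.
exists [:: i], (fun=> A); split => //.
  by move=> j /=; rewrite inE => /eqP ->.
apply/seteqP; split => w /=.
  by move=> Aw j /=; rewrite inE => /eqP ->.
by move=> /(_ i); apply; rewrite /= inE.
Qed.

End cylinders.

End independence.

(** * Lebesgue integrals and densities *)

Section lebesgue.
Context (R : realType).
Local Notation mu := (@lebesgue_measure R).
Implicit Types (h g : R -> R).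

Lemma derive1_affine (b c : R) : (fun x : R => b + c * x)^`()%classic = cst c.
Proof.
apply/funext => x; rewrite derive1E.
rewrite deriveD// derive_cst add0r deriveZ//= derive_id.
exact: mulr1.
Qed.

Lemma integral_affine g b c : continuous g -> (forall x, 0 <= g x) -> 0 < c ->
  (\int[mu]_x (g x)%:E = \int[mu]_x (g (b + c * x) * c)%:E)%E.
Proof.
move=> cg g0 c0.
rewrite (@increasing_ge0_integration_by_substitutionT _ (fun x => b + c * x) g)//.
- by apply: eq_integral => x _; rewrite derive1_affine.
- by move=> x y xy; rewrite ltrD2l ltr_pM2l.
- by rewrite derive1_affine => x; exact: cvg_cst.
- by rewrite derive1_affine; exact: is_cvg_cst.
- by rewrite derive1_affine; exact: is_cvg_cst.
- apply/cvgrNyPleNy => //; near=> A; near=> x.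
  rewrite -lerBrDl mulrC -ler_pdivlMr//; near: x; exact: nbhs_ninfty_le.
- apply/cvgryPgey => //; near=> A; near=> x.
  rewrite -lerBlDl mulrC -ler_pdivrMr//; near: x; exact: nbhs_pinfty_ge.
Unshelve. all: by end_near. Qed.

(** The Radon-Nikodym derivative of [Q] has the same integral as [q] over every measurable set, so
    the two agree almost everywhere and may be exchanged in the change of variables. *)
Lemma integral_density (Q : probability (measurableTypeR R) R)
    (q : measurableTypeR R -> R) (h : measurableTypeR R -> \bar R) :
  measurable_fun setT q -> (forall x, 0 <= q x) ->
  (forall A, measurable A -> Q A = \int[mu]_(x in A) (q x)%:E)%E ->
  measurable_fun setT h -> (forall x, 0 <= h x)%E ->
  (\int[Q]_x h x = \int[mu]_x (h x * (q x)%:E))%E.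
Proof.
move=> mq q0 Qq mh h0.
have Qmu : Q `<< mu.
  apply/null_content_dominatesP => A mA A0; rewrite Qq//; apply: null_set_integral => //.
  by apply: measurable_funTS; exact/measurable_EFinP.
rewrite -(@Radon_Nikodym_SigmaFinite.change_of_variables _ _ _ Q mu Qmu h) => //.
have iRN := Radon_Nikodym_SigmaFinite.f_integrable Qmu.
have mRN := measurable_int _ iRN.
have RNq : ae_eq mu setT (Radon_Nikodym_SigmaFinite.f Q mu) (EFin \o q).
  apply: integral_ae_eq => //; first exact/measurable_EFinP.
  move=> A _ mA.
  exact: (etrans (esym (Radon_Nikodym_SigmaFinite.f_integral Qmu mA)) (Qq _ mA)).
apply: ae_eq_integral => //.
- exact: emeasurable_funM.
- by apply: emeasurable_funM => //; exact/measurable_EFinP.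
- by apply: filterS RNq => x + _ => /(_ I) /= ->.
Qed.

End lebesgue.

(** * Gaussian integrals *)

Section gaussian.
Context (R : realType).
Local Notation mu := (@lebesgue_measure R).
Local Notation N01 := (normal_prob (0 : R) 1).
Implicit Types (h g : R -> R) (m s : R).

Lemma ge0_integral_normal_prob m s (h : measurableTypeR R -> \bar R) :
  measurable_fun setT h -> (forall x, 0 <= h x)%E ->
  (\int[normal_prob m s]_x h x = \int[mu]_x (h x * (normal_pdf m s x)%:E))%E.
Proof.
move=> mh h0; apply: (@integral_density _ (normal_prob m s)) => //.
  exact: measurable_normal_pdf.
by move=> x; exact: normal_pdf_ge0.
Qed.

Lemma integral_normal_prob m s (h : measurableTypeR R -> R) : measurable_fun setT h ->
  (forall x, 0 <= h x) ->
  (\int[normal_prob m s]_x (h x)%:E = \int[mu]_x (h x * normal_pdf m s x)%:E)%E.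
Proof.
move=> mh h0; rewrite ge0_integral_normal_prob; first exact: eq_integral.
  exact/measurable_EFinP.
by move=> x; rewrite lee_fin.
Qed.

Lemma normal_peakE s : 0 < s -> normal_peak s = s^-1 * normal_peak 1 :> R.
Proof.
move=> s0; rewrite /normal_peak expr1n mul1r -mulrnAr sqrtrM ?sqr_ge0//.
by rewrite sqrtr_sqr gtr0_norm// invfM.
Qed.

Lemma normal_pdf_gt0E m s x : 0 < s ->
  normal_pdf m s x = s^-1 * normal_peak 1 * expR (- (x - m) ^+ 2 / (s ^+ 2 *+ 2)).
Proof. by move=> s0; rewrite normal_pdfE ?gt_eqF//= -normal_peakE. Qed.

Lemma integral_normal_affine m s h : continuous h -> (forall x, 0 <= h x) -> 0 < s ->
  (\int[normal_prob m s]_x (h x)%:E = \int[N01]_x (h (m + s * x))%:E)%E.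
Proof.
move=> ch h0 s0.
have cmh (b c : R) : measurable_fun [set: measurableTypeR R] (fun x => h (b + c * x)).
  apply: continuous_measurable_fun => x; apply: continuous_comp; last exact: ch.
  apply: cvgD; first exact: cvg_cst.
  by apply: cvgM; [exact: cvg_cst|exact: cvg_id].
rewrite integral_normal_prob; [|exact: continuous_measurable_fun|exact: h0].
rewrite integral_normal_prob; [|exact: cmh|by move=> x; exact: h0].
rewrite (@integral_affine _ _ m s)//; last 2 first.
- by move=> x; apply: cvgM; [exact: ch|apply: continuous_normal_pdf; rewrite gt_eqF].
- by move=> x; rewrite mulr_ge0// normal_pdf_ge0.
apply: eq_integral => x _; congr EFin; rewrite !normal_pdf_gt0E//.
have -> : - (m + s * x - m) ^+ 2 / (s ^+ 2 *+ 2) = - (x - 0) ^+ 2 / (1 ^+ 2 *+ 2).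
  by field; rewrite gt_eqF.
by field; rewrite gt_eqF.
Qed.

(** Two factorisations of the joint density of [Z] and [a Z + b U] for independent standard normal
    [Z] and [U]: through the law of the sum given [Z = z], and through the law of [Z] given the sum
    [u], which has mean [a u / c^2] and deviation [b / c]. *)
Lemma normal_pdf_product a b c u z : 0 < b -> 0 < c -> c ^+ 2 = a ^+ 2 + b ^+ 2 ->
  normal_pdf (a * z) b u * normal_pdf 0 1 z =
  normal_pdf 0 c u * normal_pdf (a * u / c ^+ 2) (b / c) z :> R.
Proof.
move=> b0 c0 cE; rewrite !normal_pdf_gt0E// ?divr_gt0//.
rewrite mulrACA [RHS]mulrACA -!expRD; congr (_ * expR _).
  by field; rewrite !gt_eqF.
have cn : c != 0 by rewrite gt_eqF.
have bn : b != 0 by rewrite gt_eqF.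
rewrite (_ : (b / c) ^+ 2 = b ^+ 2 / c ^+ 2); last by field.
have c2 : c ^+ 2 != 0 by rewrite expf_eq0.
have : a ^+ 2 + b ^+ 2 != 0 by rewrite -cE.
rewrite cE => c2'.
by field; rewrite c2' bn.
Qed.

Lemma measurable_normal_pdf_prod a b : 0 < b ->
  measurable_fun setT (fun x : measurableTypeR R * measurableTypeR R =>
    normal_pdf (a * x.1) b x.2 : R).
Proof.
move=> b0; under eq_fun do rewrite normal_pdf_gt0E//.
apply: measurable_funM => //; apply: measurableT_comp => //.
apply: measurable_funM => //; apply: measurableT_comp => //.
apply: measurable_funX => //; apply: measurable_funB => //.
exact: measurable_funM.
Qed.

(** Once the order of integration is exchanged, [normal_pdf_product] leaves the density of
    [N(0, c^2)] times a conditional density in [z] that integrates to 1. *)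
Lemma gaussian_stability_ge0 a b c h : continuous h -> (forall x, 0 <= h x) ->
  0 < b -> 0 < c -> c ^+ 2 = a ^+ 2 + b ^+ 2 ->
  (\int[N01]_z \int[N01]_u (h (a * z + b * u))%:E = \int[N01]_z (h (c * z))%:E)%E.
Proof.
move=> ch h0 b0 c0 cE.
have mh : measurable_fun [set: measurableTypeR R] h by exact: continuous_measurable_fun.
transitivity (\int[normal_prob 0 c]_z (h z)%:E)%E; last first.
  rewrite (@integral_normal_affine 0 c h ch h0 c0).
  by apply: eq_integral => z _; rewrite add0r.
rewrite (@integral_normal_prob 0 c h mh h0).
transitivity (\int[N01]_z (\int[mu]_u (h u * normal_pdf (a * z) b u)%:E))%E.
  apply: eq_integral => z _.
  by rewrite -(@integral_normal_affine (a * z) b h ch h0 b0) (@integral_normal_prob _ _ h mh h0).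
have mF : measurable_fun setT (fun x : measurableTypeR R * measurableTypeR R =>
    h x.2 * normal_pdf (a * x.1) b x.2).
  apply: measurable_funM; last exact: measurable_normal_pdf_prod.
  exact: (measurableT_comp mh).
have mFE : measurable_fun setT (fun x : measurableTypeR R * measurableTypeR R =>
    (h x.2 * normal_pdf (a * x.1) b x.2)%:E) by exact/measurable_EFinP.
have F0 (x : measurableTypeR R * measurableTypeR R) :
    (0 <= (h x.2 * normal_pdf (a * x.1) b x.2)%:E)%E.
  by rewrite lee_fin mulr_ge0// normal_pdf_ge0.
have pdfE (z u : R) : h u * normal_pdf (a * z) b u * normal_pdf 0 1 z =
    h u * normal_pdf 0 c u * normal_pdf (a * u / c ^+ 2) (b / c) z.
  by rewrite -mulrA (normal_pdf_product u z b0 c0 cE) mulrA.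
rewrite ge0_integral_normal_prob; last 2 first.
- exact: (@measurable_fun_fubini_tonelli_F _ _ _ _ _ mu _ mFE F0).
- by move=> z; apply: integral_ge0 => u _; exact: (F0 (z, u)).
transitivity (\int[mu]_z \int[mu]_u
    (h u * normal_pdf 0 c u * normal_pdf (a * u / c ^+ 2) (b / c) z)%:E)%E.
  apply: eq_integral => z _.
  rewrite -ge0_integralZr; [|exact: measurableT|..]; last 3 first.
  - exact: (measurableT_comp mFE (measurable_fun_pair (measurable_cst z) (@measurable_id _ _ setT))).
  - by move=> u _; exact: (F0 (z, u)).
  - by rewrite lee_fin normal_pdf_ge0.
  apply: eq_integral => u _; rewrite -EFinM; congr EFin.
  exact: pdfE.
have mK : measurable_fun setT (fun x : measurableTypeR R * measurableTypeR R =>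
    (h x.2 * normal_pdf 0 c x.2 * normal_pdf (a * x.2 / c ^+ 2) (b / c) x.1)%:E).
  rewrite (_ : (fun x => _) = (fun x => (h x.2 * normal_pdf (a * x.1) b x.2 * normal_pdf 0 1 x.1)%:E)).
    apply/measurable_EFinP; apply: measurable_funM => //.
    by apply: (measurableT_comp (measurable_normal_pdf 0 1)); exact: measurable_fst.
  by apply/funext => x; congr EFin; exact/esym/pdfE.
rewrite (@fubini_tonelli _ _ _ _ _ mu mu _ mK); last first.
  by move=> x; rewrite lee_fin !mulr_ge0// normal_pdf_ge0.
apply: eq_integral => u _ /=.
under eq_integral do rewrite EFinM.
rewrite ge0_integralZl//; last 3 first.
- by apply/measurable_EFinP; exact: measurable_normal_pdf.
- by move=> z _; rewrite lee_fin normal_pdf_ge0.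
- by rewrite lee_fin mulr_ge0// normal_pdf_ge0.
by rewrite integral_normal_pdf mule1.
Qed.

(** The exponential tilts the standard normal density into [s] times the density of [N(0, s^2)].
    Letting [s] vary around 1 yields the second moment. *)
Lemma gaussian_exp_moment s : 0 < s ->
  (\int[N01]_x (expR ((1 - s ^- 2) / 2 * x ^+ 2))%:E = s%:E)%E.
Proof.
move=> s0; rewrite integral_normal_prob; last 2 first.
- apply: measurableT_comp => //; apply: measurable_funM => //; exact: measurable_funX.
- by move=> x; exact: expR_ge0.
transitivity (\int[mu]_x (s%:E * (normal_pdf 0 s x)%:E))%E.
  apply: eq_integral => x _; rewrite -EFinM; congr EFin.
  rewrite !normal_pdf_gt0E// invr1 mul1r mulrCA -expRD !mulrA mulfV ?gt_eqF// mul1r.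
  congr (_ * expR _).
  by field; rewrite gt_eqF.
rewrite ge0_integralZl//.
- by rewrite integral_normal_pdf mule1.
- by apply/measurable_EFinP; exact: measurable_normal_pdf.
- by move=> x _; rewrite lee_fin normal_pdf_ge0.
- by rewrite lee_fin ltW.
Qed.

Lemma measurable_sqr : measurable_fun [set: measurableTypeR R] (fun x => x ^+ 2 : R).
Proof. exact: measurable_funX. Qed.

(* expR y >= 1 + y, applied at y = +/- c x^2, squeezes the second moment *)
Lemma gaussian_second_moment : (\int[N01]_x (x ^+ 2)%:E = 1)%E.
Proof.
have m2 : measurable_fun [set: measurableTypeR R] (fun x => (x ^+ 2)%:E : \bar R).
  by apply/measurable_EFinP; exact: measurable_sqr.
have sq0 (x : R) : (0 <= (x ^+ 2)%:E :> \bar R)%E by rewrite lee_fin sqr_ge0.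
have mZ (c : R) : measurable_fun [set: measurableTypeR R] (fun x => (c%:E * (x ^+ 2)%:E : \bar R)%E).
  by apply/measurable_EFinP; apply: measurable_funM => //; exact: measurable_sqr.
have mE (c : R) : measurable_fun [set: measurableTypeR R] (fun x => (expR (c * x ^+ 2))%:E : \bar R).
  by apply/measurable_EFinP; apply: measurableT_comp => //; apply: measurable_funM.
have one : (\int[N01]_x 1 = 1 :> \bar R)%E.
  by rewrite integral_cst//= mul1e; exact: probability_setT.
set v := (\int[N01]_x _)%E.
have v0 : (0 <= v)%E by apply: integral_ge0 => x _; exact: sq0.
have up s : 1 < s -> (1 + ((1 - s ^- 2) / 2)%:E * v <= s%:E)%E.
  move=> s1; have s0 : 0 < s by rewrite (lt_trans _ s1).
  have c0 : 0 <= (1 - s ^- 2) / 2.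
    by rewrite divr_ge0// subr_ge0 invf_le1 ?exprn_gt0// exprn_ege1// ltW.
  rewrite -(gaussian_exp_moment s0) -[X in (X + _)%E]one.
  rewrite -ge0_integralZl//.
  rewrite -ge0_integralD//; last by move=> x _; rewrite mule_ge0 ?sq0.
  apply: ge0_le_integral => //.
  - by move=> x _; rewrite adde_ge0// mule_ge0 ?sq0.
  - exact: emeasurable_funD.
  - by move=> x _; rewrite -EFinM -EFinD lee_fin expR_ge1Dx.
have low s : 0 < s -> s < 1 -> (1 <= s%:E + ((s ^- 2 - 1) / 2)%:E * v)%E.
  move=> s0 s1.
  have c0 : 0 <= (s ^- 2 - 1) / 2.
    by rewrite divr_ge0// subr_ge0 invf_ge1 ?exprn_gt0// exprn_ile1// ltW.
  rewrite -(gaussian_exp_moment s0) -[X in (X <= _)%E]one.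
  rewrite -ge0_integralZl//.
  rewrite -ge0_integralD//; last by move=> x _; rewrite mule_ge0 ?sq0.
  apply: ge0_le_integral => //.
  - exact: emeasurable_funD.
  - move=> x _; rewrite -EFinM -EFinD lee_fin -lerBlDr.
    by rewrite (le_trans _ (expR_ge1Dx _))//; lra.
have vfin : v \is a fin_num.
  rewrite ge0_fin_numE// ltey; apply/eqP => voo; have := up 2 (ltr1n R 2).
  by rewrite voo gt0_muley ?lte_fin//; lra.
move: up low; rewrite -(fineK vfin); move: (fine v) => {m2 mZ mE v0 vfin v} v up low.
(* Clearing denominators and dividing by [s - 1], respectively [1 - s], turns both inequalities into
   comparisons of [v] with [2 s^2 / (s + 1)], which tends to 1 with [s]. *)
have {}up s : 1 < s -> v <= 2 * s ^+ 2 / (s + 1).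
  move=> s1; have := up s s1; rewrite -EFinM -EFinD lee_fin => H.
  have s0 : 0 < s by rewrite (lt_trans _ s1).
  have E : (s - 1) * (2 * s ^+ 2 - v * (s + 1)) = (s - (1 + (1 - s ^- 2) / 2 * v)) * (2 * s ^+ 2).
    by field; rewrite gt_eqF.
  rewrite ler_pdivlMr; last by rewrite ltr_wpDl// ltW.
  rewrite -subr_ge0 -(@pmulr_rge0 _ (s - 1)) ?subr_gt0// E.
  by rewrite mulr_ge0 ?subr_ge0// mulr_ge0// sqr_ge0.
have {}low s : 0 < s -> s < 1 -> 2 * s ^+ 2 / (s + 1) <= v.
  move=> s0 s1; have := low s s0 s1; rewrite -EFinM -EFinD lee_fin => H.
  have E : (1 - s) * (v * (s + 1) - 2 * s ^+ 2) = (s + (s ^- 2 - 1) / 2 * v - 1) * (2 * s ^+ 2).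
    by field; rewrite gt_eqF.
  rewrite ler_pdivrMr; last by rewrite ltr_wpDl// ltW.
  rewrite -subr_ge0 -(@pmulr_rge0 _ (1 - s)) ?subr_gt0// E.
  by rewrite mulr_ge0 ?subr_ge0// mulr_ge0// sqr_ge0.
congr EFin; apply/eqP; rewrite eq_le; apply/andP; split; apply/ler_addgt0Pr => e e0.
  pose t := Num.min (e / 3) 1; have t0 : 0 < t by rewrite /t lt_min ltr01 divr_gt0.
  have te : t <= e / 3 by rewrite /t ge_min lexx.
  have t1 : t <= 1 by rewrite /t ge_min lexx orbT.
  rewrite (le_trans (up (1 + t) _)) ?ltrDl// ler_pdivrMr; last by lra.
  by nra.
pose t := Num.min (e / 3) (1 / 2); have t0 : 0 < t by rewrite /t lt_min !divr_gt0.
have te : t <= e / 3 by rewrite /t ge_min lexx.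
have t1 : t <= 1 / 2 by rewrite /t ge_min lexx orbT.
have := low (1 - t); rewrite subr_gt0 => /(_ _ _) H.
have {}H : 2 * (1 - t) ^+ 2 / (1 - t + 1) <= v by apply: H; lra.
rewrite -lerBlDr (le_trans _ H)// ler_pdivlMr; last by lra.
by nra.
Qed.

Lemma integral_normal_oppr h : measurable_fun [set: measurableTypeR R] h ->
  (forall x, 0 <= h x) ->
  (\int[N01]_x (h (- x))%:E = \int[N01]_x (h x)%:E)%E.
Proof.
move=> mh h0.
have mopp : measurable_fun [set: measurableTypeR R] (-%R : measurableTypeR R -> measurableTypeR R).
  by [].
rewrite integral_normal_prob; [|exact: (measurableT_comp mh)|by move=> x; exact: h0].
rewrite integral_normal_prob//.
pose G (x : measurableTypeR R) := (h x * normal_pdf 0 1 x)%:E : \bar R.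
have mG : measurable_fun setT G.
  by apply/measurable_EFinP; apply: measurable_funM => //; exact: measurable_normal_pdf.
have G0 x : (0 <= G x)%E by rewrite lee_fin mulr_ge0// normal_pdf_ge0.
transitivity (\int[pushforward mu (-%R : measurableTypeR R -> measurableTypeR R)]_x G x)%E.
  rewrite ge0_integral_pushforward; [|exact: mopp|exact: measurableT|exact: mG|by move=> x _; exact: G0].
  apply: eq_integral => x _; rewrite /G/=; congr (_ * _)%:E.
  by rewrite !normal_pdf_gt0E// !subr0 sqrrN.
by apply: eq_measure_integral => A mA _; first [exact: lebesgue_measureN|exact/esym/lebesgue_measureN].
Qed.

Lemma gaussian_square_integrable : square_integrable N01 (id : measurableTypeR R -> R).
Proof.
split => //; apply/integrableP; split.
  by apply/measurable_EFinP; exact: measurable_sqr.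
under eq_integral do rewrite gee0_abs ?lee_fin ?sqr_ge0//.
by rewrite gaussian_second_moment ltry.
Qed.

Lemma gaussian_mean : \int[N01]_x x = 0 :> R.
Proof.
have iid := square_integrable1 gaussian_square_integrable.
rewrite /Rintegral integralE.
have -> : (\int[N01]_x (EFin \o (id : measurableTypeR R -> R))^\- x = \int[N01]_x (EFin \o (id : measurableTypeR R -> R))^\+ x)%E.
  transitivity (\int[N01]_x (Num.max (- x) 0)%:E)%E.
    by apply: eq_integral => x _; rewrite funenegE/= EFin_max.
  rewrite (@integral_normal_oppr (fun x => Num.max x 0)).
  - by apply: eq_integral => x _; rewrite funeposE/= EFin_max.
  - exact: measurable_maxr.
  - by move=> x; rewrite le_max lexx orbT.
rewrite subee//.
have := integrable_pos_fin_num measurableT iid.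
by [].
Qed.

Lemma cvg_expR_Nsqr (b : R) : 0 < b -> expR (- (b * x ^+ 2)) @[x --> +oo] --> (0 : R).
Proof.
move=> b0; pose r := Num.sqrt b; have r0 : 0 < r by rewrite sqrtr_gt0.
have rb : r ^+ 2 = b by rewrite sqr_sqrtr// ltW.
rewrite (_ : (fun x => _) = (@gauss_fun R) \o (fun x => x * r)); last first.
  by apply/funext => x; rewrite /gauss_fun/= exprMn rb mulrC.
apply: cvg_comp; last exact: cvg_gauss_fun.
by apply/gt0_cvgMly.
Qed.

Lemma continuous_expR_Nsqr (b : R) : continuous (fun x : R => expR (- (b * x ^+ 2))).
Proof.
move=> x; apply: (cvg_comp (fun x : R => - (b * x ^+ 2)) expR); last exact: continuous_expR.
by apply: cvgN; apply: cvgM; [exact: cvg_cst|exact: sqr_continuous].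
Qed.

Lemma continuous_norm_gauss (b : R) :
  continuous (fun x : R => `|x| * expR (- (b * x ^+ 2))).
Proof.
move=> x; apply: cvgM; first exact: norm_continuous.
exact: continuous_expR_Nsqr.
Qed.

Lemma integral_norm_gauss (b : R) : 0 < b ->
  (\int[mu]_x (`|x| * expR (- (b / 2 * x ^+ 2)))%:E = (2 / b)%:E)%E.
Proof.
move=> b0; have b20 : 0 < b / 2 by rewrite divr_gt0.
have de (x : R) : is_derive x 1 (fun x : R => - b^-1 * expR (- (b / 2 * x ^+ 2)))
    (x * expR (- (b / 2 * x ^+ 2))).
  rewrite (_ : (fun x => _) = (- b^-1) \*: (@expR R \o (- ((b / 2) \*: (id ^+ 2 : R -> R))))).
    apply: is_derive_eq.
    rewrite (_ : (- ((b / 2) \*: (id ^+ 2 : R -> R))) x = - (b / 2 * x ^+ 2))//.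
    rewrite -[_ *: _]/(_ * _) -[_%:A]/(_ * _) mulr1 expr1.
    rewrite -[(b / 2) *: _]/((b / 2) * _).
    by field; rewrite gt_eqF.
  by [].
rewrite ge0_symfun_integralT; last 3 first.
- by move=> x; rewrite mulr_ge0 ?expR_ge0.
- exact: continuous_norm_gauss.
- by move=> x /=; rewrite normrN sqrrN.
rewrite (_ : [set x : R | _] = `[0, +oo[%classic); last first.
  by apply/seteqP; split => x /=; rewrite in_itv/= andbT.
under eq_integral => x.
  rewrite inE/= in_itv/= andbT => x0; rewrite (ger0_norm x0); over.
rewrite (@ge0_continuous_FTC2y _ _ (fun x : R => - b^-1 * expR (- (b / 2 * x ^+ 2))) 0 0).
- rewrite expr0n/= mulr0 oppr0 expR0 mulr1 -EFinB -EFinM; congr EFin.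
  by rewrite sub0r opprK.
- by move=> x x0; rewrite mulr_ge0 ?expR_ge0.
- apply: continuous_subspaceT => x; apply: cvgM; first exact: cvg_id.
  exact: continuous_expR_Nsqr.
- rewrite -(mulr0 (- b^-1)); apply: cvgM; first exact: cvg_cst.
  exact: cvg_expR_Nsqr.
- by move=> x _; have := de x => -[].
- by apply: cvg_at_right_filter; apply: cvgM; [exact: cvg_cst|exact: continuous_expR_Nsqr].
- by move=> x _; rewrite derive1E; have := de x => -[].
Qed.

(** For fixed [x != 0] the variable [z / |x|] has density [u |-> |x| phi(x u)]. Multiplying by
    [phi(x)] and integrating over [x] first leaves [k^2 * 2 / (1 + u^2)] with [k^2 = 1 / (2 pi)],
    the Cauchy density. *)
Lemma gaussian_ratio h : continuous h -> (forall x, 0 <= h x) ->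
  (\int[N01]_x \int[N01]_z (h (z / `|x|))%:E = \int[cauchy_prob]_u (h u)%:E)%E.
Proof.
move=> ch h0.
have mh : measurable_fun [set: measurableTypeR R] h by exact: continuous_measurable_fun.
pose k : R := normal_peak 1.
pose K (x : measurableTypeR R * measurableTypeR R) : R :=
  h x.2 * (`|x.1| * k * expR (- (x.1 ^+ 2 * x.2 ^+ 2 / 2))).
have mK : measurable_fun setT K.
  apply: measurable_funM; first exact: (measurableT_comp mh).
  apply: measurable_funM; first apply: measurable_funM => //.
    exact: measurableT_comp.
  apply: measurableT_comp => //; apply: measurableT_comp => //.
  apply: measurable_funM => //.
  by apply: measurable_funM; exact: measurable_funX.
have k0 : 0 <= k by exact: normal_peak_ge0.
have K0 x : 0 <= K x by rewrite !mulr_ge0 ?expR_ge0.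
have mKE : measurable_fun setT (EFin \o K) by exact/measurable_EFinP.
have mF := @measurable_fun_fubini_tonelli_F _ _ _ _ _ mu _ mKE (fun x => K0 x : (0 <= (K x)%:E)%E).
have inner (x : R) : x != 0 ->
    (\int[N01]_z (h (z / `|x|))%:E = \int[mu]_u (K (x, u))%:E)%E.
  move=> x0; have x0' : 0 < `|x|^-1 by rewrite invr_gt0 normr_gt0.
  have := @integral_normal_affine 0 `|x|^-1 h ch h0 x0'.
  rewrite integral_normal_prob// => H.
  transitivity (\int[N01]_z (h (0 + `|x|^-1 * z))%:E)%E.
    by apply: eq_integral => z _; rewrite add0r mulrC.
  rewrite -H; apply: eq_integral => u _; congr EFin.
  rewrite /K/= normal_pdf_gt0E// invrK; congr (_ * (_ * expR _)).
  have -> : `|x|^-1 ^+ 2 = (x ^+ 2)^-1 by rewrite exprVn real_normK// num_real.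
  by field.
have mG : measurable_fun [set: measurableTypeR R] (fun x => \int[N01]_z (h (z / `|x|))%:E)%E.
  (* At [x = 0] division returns 0, so the inner integral is [h 0], whereas the kernel [K] vanishes
     there; the two functions differ only on a null set. *)
  rewrite (_ : (fun x => _) = (fun x => fubini_F mu (EFin \o K) x + (h 0 * \1_[set (0:R)] x)%:E)%E).
    apply: emeasurable_funD => //; apply/measurable_EFinP; apply: measurable_funM => //.
  apply/funext => x; rewrite indicE in_set1; have [->|x0] := eqVneq x 0.
    rewrite /fubini_F/= mulr1.
    rewrite [X in (X + _)%E]integral0_eq ?add0e.
      under eq_integral do rewrite normr0 invr0 mulr0.
      exact: (@integral_prob_cstE _ _ _ N01).
    by move=> u _; rewrite /K/= normr0 !mul0r mulr0.
  by rewrite mulr0 adde0 inner.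
transitivity (\int[N01]_x fubini_F mu (EFin \o K) x)%E.
  apply: ae_eq_integral => //.
  exists [set (0:R)]; split => //.
    exact: integral_set1.
  move=> x /= Hx; apply/eqP; apply/negPn/negP => x0; apply: Hx => _.
  by rewrite inner.
rewrite ge0_integral_normal_prob//; last first.
  by move=> x; apply: integral_ge0 => u _; rewrite lee_fin.
transitivity (\int[mu]_x \int[mu]_u (K (x, u) * normal_pdf 0 1 x)%:E)%E.
  apply: eq_integral => x _.
  rewrite -ge0_integralZr//=.
  - exact: (measurableT_comp mKE (measurable_fun_pair (measurable_cst x) (@measurable_id _ _ setT))).
  - by move=> u _; rewrite lee_fin.
  - by rewrite lee_fin normal_pdf_ge0.
rewrite (@fubini_tonelli _ _ _ _ _ mu mu (fun x => (K x * normal_pdf 0 1 x.1)%:E)); last 2 first.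
- apply/measurable_EFinP; apply: measurable_funM => //.
  by apply: (measurableT_comp (measurable_normal_pdf 0 1)); exact: measurable_fst.
- by move=> x; rewrite lee_fin mulr_ge0// normal_pdf_ge0.
rewrite (@integral_density _ cauchy_prob (@cauchy_pdf R) (EFin \o h))//; last 3 first.
- exact: measurable_cauchy_pdf.
- by move=> x; exact: cauchy_pdf_ge0.
- exact/measurable_EFinP.
apply: eq_integral => u _.
have b0 : 0 < 1 + u ^+ 2 by rewrite ltr_pwDl// sqr_ge0.
transitivity (\int[mu]_x ((h u * k ^+ 2)%:E * (`|x| * expR (- ((1 + u ^+ 2) / 2 * x ^+ 2)))%:E))%E.
  apply: eq_integral => x _; rewrite -EFinM; congr EFin.
  rewrite /K/= normal_pdf_gt0E// invr1 mul1r.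
  have -> : - (x - 0) ^+ 2 / (1 ^+ 2 *+ 2) = - (x ^+ 2 / 2) by field.
  have -> : - ((1 + u ^+ 2) / 2 * x ^+ 2) = - (x ^+ 2 * u ^+ 2 / 2) + - (x ^+ 2 / 2) by field.
  by rewrite expRD /k; ring.
rewrite ge0_integralZl//; last 2 first.
- by apply/measurable_EFinP; apply: continuous_measurable_fun; exact: continuous_norm_gauss.
- by rewrite lee_fin mulr_ge0// sqr_ge0.
rewrite integral_norm_gauss// -!EFinM; congr EFin; rewrite -mulrA; congr (_ * _).
rewrite /k /normal_peak /cauchy_pdf exprVn sqr_sqrtr; last first.
  by rewrite mulrn_wge0// mulr_ge0 ?sqr_ge0 ?pi_ge0.
rewrite expr1n mul1r; move: (pi : R) (pi_gt0 R) => p p0.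
by field; rewrite !gt_eqF.
Qed.

End gaussian.

(** * A central limit theorem *)

Section smoothing.
Context (R : realType).
Local Notation mu := (@lebesgue_measure R).
Implicit Types (f g h : R -> R).

Lemma is_derive_continuous f (f' : R -> R) :
  (forall x : R, is_derive x 1 f (f' x)) -> continuous f.
Proof.
move=> df x; have [dfx _] := df x.
by apply: differentiable_continuous; exact/derivable1_diffP.
Qed.

Lemma mean_value f f' x y : (forall x : R, is_derive x 1 f (f' x)) ->
  exists2 c, `|c - x| <= `|y - x| & f y - f x = f' c * (y - x).
Proof.
move=> df; have cf := is_derive_continuous df.
have [xy|/ltW yx] := leP x y.
  have [c + E] := @MVT_segment R f f' x y xy (fun z _ => df z) (continuous_subspaceT cf).
  rewrite in_itv/= => /andP[xc cy]; exists c => //.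
  by rewrite !ger0_norm ?subr_ge0// lerD2r.
have [c + E] := @MVT_segment R f f' y x yx (fun z _ => df z) (continuous_subspaceT cf).
rewrite in_itv/= => /andP[yc cx]; exists c; last first.
  by rewrite -opprB E -mulrN opprB.
by rewrite !ler0_norm ?subr_le0// lerN2 lerD2r.
Qed.

Lemma derivative_bounded_lipschitz f f' K : (forall x : R, is_derive x 1 f (f' x)) ->
  (forall x, `|f' x| <= K) -> forall x y, `|f x - f y| <= K * `|x - y|.
Proof.
move=> df f'K x y; have [c _ ->] := mean_value y x df.
by rewrite normrM ler_wpM2r.
Qed.

Lemma derivative_bounded_near0 f f' B u : (forall x : R, is_derive x 1 f (f' x)) ->
  f 0 = 0 -> (forall v, `|v| <= `|u| -> `|f' v| <= B) -> `|f u| <= B * `|u|.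
Proof.
move=> df f0 f'B; have [c] := mean_value 0 u df.
rewrite !subr0 f0 subr0 => cu ->.
by rewrite normrM ler_wpM2r// f'B.
Qed.

Lemma is_derive_translate f df (x y : R) : is_derive (x + y) 1 f df ->
  is_derive y 1 (fun v => f (x + v)) df.
Proof.
move=> dfx; have dt : is_derive y 1 (fun v : R => x + v) 1.
  have := is_deriveD (is_derive_cst x y 1) (is_derive_id y 1).
  by rewrite add0r.
by have := is_derive1_comp dfx dt; rewrite mulr1.
Qed.

(** As a function of the increment [v], the remainder vanishes at 0 together with its derivative,
    and its second derivative [f2 (x + v) - f2 x] is at most [(B + L) min(1, |u|)]: the oscillation
    bound serves for large [u], the Lipschitz bound for small [u]. Two mean value steps integrate
    this. The minimum keeps the bound integrable under a second moment alone. *)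
Lemma taylor2 f f1 f2 B L x u : (forall x : R, is_derive x 1 f (f1 x)) ->
  (forall x : R, is_derive x 1 f1 (f2 x)) ->
  (forall x y, `|f2 x - f2 y| <= B) -> (forall x y, `|f2 x - f2 y| <= L * `|x - y|) ->
  `|f (x + u) - f x - f1 x * u - f2 x * u ^+ 2 / 2| <=
    (B + L) * (u ^+ 2 * Num.min 1 `|u|).
Proof.
move=> d1 d2 fB fL.
have B0 : 0 <= B by exact: le_trans (normr_ge0 _) (fB 0 0).
have L0 : 0 <= L.
  by have := le_trans (normr_ge0 _) (fL 0 1); rewrite sub0r normrN normr1 mulr1.
pose m := Num.min 1 `|u|.
have m0 : 0 <= m by rewrite /m le_min ler01 normr_ge0.
have r2 v : `|v| <= `|u| -> `|f2 (x + v) - f2 x| <= (B + L) * m.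
  move=> vu; rewrite /m; have [_|_] := leP 1 `|u|.
    by rewrite mulr1 (le_trans (fB _ _))// lerDl.
  rewrite (le_trans (fL _ _))// addrAC subrr add0r.
  by apply: ler_pM => //; rewrite lerDr.
have dr1 (v : R) : is_derive v 1 (fun v => f1 (x + v) - f1 x - f2 x * v) (f2 (x + v) - f2 x).
  have dt := is_derive_translate (d2 (x + v)).
  have := is_deriveB (is_deriveB dt (is_derive_cst (f1 x) v 1)) (is_deriveZ (f2 x) (is_derive_id v 1)).
  by rewrite subr0 -[_ *: _]/(_ * _) mulr1.
have r1 v : `|v| <= `|u| -> `|f1 (x + v) - f1 x - f2 x * v| <= (B + L) * m * `|u|.
  move=> vu.
  have := @derivative_bounded_near0 _ _ ((B + L) * m) v dr1.
  rewrite addr0 subrr mulr0 subr0 => /(_ erefl) H.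
  rewrite (le_trans (H _))//; last by rewrite ler_wpM2l// mulr_ge0// addr_ge0.
  by move=> z zv; apply: r2; exact: le_trans vu.
have dr (v : R) : is_derive v 1 (fun v => f (x + v) - f x - f1 x * v - f2 x * v ^+ 2 / 2)
    (f1 (x + v) - f1 x - f2 x * v).
  have dt := is_derive_translate (d1 (x + v)).
  have d2v := is_deriveZ (f2 x / 2) (is_deriveM (is_derive_id v 1) (is_derive_id v 1)).
  have := is_deriveB (is_deriveB (is_deriveB dt (is_derive_cst (f x) v 1))
    (is_deriveZ (f1 x) (is_derive_id v 1))) d2v.
  rewrite subr0 -[_ *: (_ + _)]/(_ * _) -![_ *: _]/(_ * _) !mulr1.
  rewrite (_ : f2 x / 2 * (v + v) = f2 x * v); last by field.
  rewrite [X in _ -> is_derive v 1 X _](_ : _ = (fun v => f (x + v)) - cst (f x) - f1 x \*: id - (f2 x / 2) \*: (id * id))//.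
  by apply/funext => z; rewrite !fctE/= expr2 mulrAC.
have := @derivative_bounded_near0 _ _ ((B + L) * m * `|u|) u dr.
rewrite addr0 subrr !mulr0 expr0n/= mulr0 mul0r !subr0 => /(_ erefl r1).
have -> : (B + L) * (u ^+ 2 * Num.min 1 `|u|) = (B + L) * m * `|u| * `|u|.
  by rewrite -/m -(real_normK (num_real u)); ring.
by [].
Qed.

Definition moving_average (s : R) g x := s^-1 * \int[mu]_(t in `]x, x + s]) g t.

Section moving_average.
Variables (s : R) (g : R -> R).
Hypotheses (s0 : 0 < s) (cg : continuous g).

Let F (a y : R) := \int[mu]_(t in `[a, y]) g t.

Let integrable_itv a b : mu.-integrable `[a, b] (EFin \o g).
Proof.
apply: continuous_compact_integrable; first exact: segment_compact.
exact: continuous_subspaceT.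
Qed.

Let moving_averageE (a x : R) : a < x -> moving_average s g x = s^-1 * (F a (x + s) - F a x).
Proof.
move=> ax; rewrite /moving_average; congr (_ * _).
rewrite /F (@Rintegral_itvB _ g (BLeft a) (BRight (x + s)) x)//.
- by rewrite bnd_simp ltW.
- by rewrite bnd_simp lerDl ltW.
Qed.

Let is_deriveF (a y : R) : a < y -> is_derive y 1 (F a) (g y).
Proof.
move=> ay; have y1 : y < y + 1 by rewrite ltrDl.
have [dF F'] := @continuous_FTC1 R g (BLeft a) y (y + 1) y1 (integrable_itv a (y + 1)) ay (@cg y).
by apply: DeriveDef; [exact: dF|rewrite -derive1E; exact: F'].
Qed.

Lemma is_derive_moving_average (x : R) :
  is_derive x 1 (moving_average s g) (s^-1 * (g (x + s) - g x)).
Proof.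
have ax : x - 1 < x by rewrite ltrBlDr ltrDl.
have axs : x - 1 < s + x by rewrite (lt_trans ax)// ltrDr.
have d1 := is_derive_translate (is_deriveF axs).
have d2 := is_deriveF ax.
have := is_deriveZ s^-1 (is_deriveB d1 d2).
rewrite [s + x]addrC; apply: near_eq_is_derive.
near=> y; rewrite (@moving_averageE (x - 1)); last by near: y; exact: lt_nbhsr.
by rewrite [y + s]addrC.
Unshelve. all: by end_near. Qed.

Lemma moving_average_mean_value x : exists2 c, `|c - x| <= s & moving_average s g x = g c.
Proof.
have ax : x - 1 < x by rewrite ltrBlDr ltrDl.
have xs : x <= x + s by rewrite lerDl ltW.
have [||c + E] := @MVT_segment R (F (x - 1)) g x (x + s) xs.
- by move=> z; rewrite in_itv/= => /andP[xz _]; apply: is_deriveF; exact: lt_trans xz.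
- apply: derivable_within_continuous => z; rewrite in_itv/= => /andP[xz _].
  by have [] := is_deriveF (lt_le_trans ax xz).
rewrite in_itv/= => /andP[xc cx]; exists c.
  by rewrite ger0_norm ?subr_ge0// lerBlDl.
by rewrite (moving_averageE ax) E addrAC subrr add0r mulrC mulfK// gt_eqF.
Qed.

End moving_average.

Lemma bounded_lipschitz_moving_average s M K g : 0 < s -> bounded_lipschitz M K g ->
  bounded_lipschitz M K (moving_average s g).
Proof.
move=> s0 [gM gK]; have cg := bounded_lipschitz_continuous (conj gM gK).
split=> [x|].
  by have [c _ ->] := moving_average_mean_value s0 cg x.
apply: derivative_bounded_lipschitz; first exact: is_derive_moving_average.
move=> x /=; rewrite normrM gtr0_norm ?invr_gt0// mulrC ler_pdivrMr//.
by rewrite (le_trans (gK _ _))// addrAC subrr add0r gtr0_norm.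
Qed.

Lemma moving_average_near s M K g x : 0 < s -> bounded_lipschitz M K g ->
  `|moving_average s g x - g x| <= K * s.
Proof.
move=> s0 bg; have [_ K0] := bounded_lipschitz_ge0 bg; have [_ gK] := bg.
have [c cx ->] := moving_average_mean_value s0 (bounded_lipschitz_continuous bg) x.
by rewrite (le_trans (gK _ _))// ler_wpM2l.
Qed.

(** [h1] and [h2] act as the first two derivatives of [h], but only the Taylor bound is recorded,
    since it survives averaging over a random translation with the same [C]. The bounded Lipschitz
    clauses are there for integrability. *)
Definition taylor_bounded C h h1 h2 :=
  [/\ exists M K, bounded_lipschitz M K h, exists M K, bounded_lipschitz M K h1,
      exists M K, bounded_lipschitz M K h2 &
      forall x u, `|h (x + u) - h x - h1 x * u - h2 x * u ^+ 2 / 2| <=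
        C * (u ^+ 2 * Num.min 1 `|u|)].

Lemma bounded_lipschitz_difference s M K g : 0 < s -> bounded_lipschitz M K g ->
  bounded_lipschitz (s^-1 * (M + M)) (s^-1 * (K + K)) (fun x => s^-1 * (g (x + s) - g x)).
Proof.
move=> s0 [gM gK]; have si0 : 0 <= s^-1 by rewrite invr_ge0 ltW.
split=> [x|x y].
  by rewrite normrM (ger0_norm si0) ler_wpM2l// (le_trans (ler_normB _ _))// lerD.
rewrite -mulrBr normrM (ger0_norm si0) -mulrA ler_wpM2l//.
have -> : g (x + s) - g x - (g (y + s) - g y) = (g (x + s) - g (y + s)) - (g x - g y) by ring.
rewrite (le_trans (ler_normB _ _))// mulrDl lerD// (le_trans (gK _ _))//.
by have -> : x + s - (y + s) = x - y by ring.
Qed.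

Lemma is_derive_difference s f f' (x : R) : (forall x : R, is_derive x 1 f (f' x)) ->
  is_derive x 1 (fun x => s^-1 * (f (x + s) - f x)) (s^-1 * (f' (x + s) - f' x)).
Proof.
move=> df; have := df (x + s); rewrite addrC => /is_derive_translate d1.
have := is_deriveZ s^-1 (is_deriveB d1 (df x)).
rewrite -[_ *: _]/(_ * _) [s + x]addrC.
rewrite [X in _ -> is_derive x 1 X _](_ : _ = s^-1 \*: ((fun v => f (s + v)) - f))//.
by apply/funext => z; rewrite [z + s]addrC.
Qed.

(** The derivative of an average is a difference quotient, so the second derivative is the double
    difference quotient of [g]: bounded by [4 M / s^2], hence of oscillation at most [8 M / s^2],
    and Lipschitz with constant [4 K / s^2]. *)
Lemma smoothing_taylor s M K g : 0 < s -> bounded_lipschitz M K g ->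
  exists h1 h2, taylor_bounded ((8 * M + 4 * K) / s ^+ 2)
    (moving_average s (moving_average s g)) h1 h2.
Proof.
move=> s0 bg; have cg := bounded_lipschitz_continuous bg.
have [M0 K0] := bounded_lipschitz_ge0 bg.
have bg1 := bounded_lipschitz_moving_average s0 bg.
have cg1 := bounded_lipschitz_continuous bg1.
have bg2 := bounded_lipschitz_moving_average s0 bg1.
pose D g x := s^-1 * (g (x + s) - g x).
have bD2 := bounded_lipschitz_difference s0 (bounded_lipschitz_difference s0 bg).
exists (D (moving_average s g)), (D (D g)); split.
- by exists M, K.
- by exists (s^-1 * (M + M)), (s^-1 * (K + K)); exact: bounded_lipschitz_difference.
- by do 2 eexists; exact: bD2.
have d1 := is_derive_moving_average s0 cg1.
have d2 x := is_derive_difference s x (is_derive_moving_average s0 cg).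
have [bM bK] := bD2.
move=> x u; pose B := s^-1 * (s^-1 * (M + M) + s^-1 * (M + M)).
have bB y z : `|D (D g) y - D (D g) z| <= B + B.
  by rewrite (le_trans (ler_normB _ _))// lerD// bM.
have := taylor2 x u d1 d2 bB bK.
have -> : B + B + s^-1 * (s^-1 * (K + K) + s^-1 * (K + K)) = (8 * M + 4 * K) / s ^+ 2.
  by rewrite /B; field; rewrite gt_eqF.
by [].
Qed.

Lemma smoothing_near s M K g x : 0 < s -> bounded_lipschitz M K g ->
  `|moving_average s (moving_average s g) x - g x| <= 2 * K * s.
Proof.
move=> s0 bg; have bg1 := bounded_lipschitz_moving_average s0 bg.
have H1 := moving_average_near x s0 bg1; have H2 := moving_average_near x s0 bg.
have -> : moving_average s (moving_average s g) x - g x =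
  (moving_average s (moving_average s g) x - moving_average s g x) + (moving_average s g x - g x) by ring.
by rewrite (le_trans (ler_normD _ _))// (le_trans (lerD H1 H2))//; lra.
Qed.

End smoothing.

(** * Taylor expansion under the expectation *)

Section averaging.
Context d (T : measurableType d) (R : realType) (P : probability T R).
Implicit Types (g h : R -> R) (X : T -> R).

Lemma measurable_bounded_lipschitz_comp M K g X : measurable_fun setT X ->
  bounded_lipschitz M K g -> measurable_fun setT (fun w => g (X w)).
Proof. by move=> mX /bounded_lipschitz_measurable mg; exact: measurableT_comp mg mX. Qed.

Lemma integrable_bounded_lipschitz M K g X : measurable_fun setT X ->
  bounded_lipschitz M K g -> P.-integrable setT (EFin \o (fun w => g (X w))).
Proof.
move=> mX bg; apply: (@bounded_integrable _ _ _ _ _ M).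
  exact: measurable_bounded_lipschitz_comp bg.
by have [gM _] := bg.
Qed.

Lemma bounded_lipschitz_integral M K g X : measurable_fun setT X ->
  bounded_lipschitz M K g -> bounded_lipschitz M K (fun x => \int[P]_w g (x + X w)).
Proof.
move=> mX bg; have [gM gK] := bg.
have mxX x : measurable_fun setT (fun w => x + X w) by exact: measurable_funD.
split=> [x|x y].
  apply: norm_Rintegral_bounded => //; exact: measurable_bounded_lipschitz_comp bg.
rewrite -[leRHS](integral_prob_cst P); apply: dist_Rintegral_le.
- exact: integrable_bounded_lipschitz bg.
- exact: integrable_bounded_lipschitz bg.
- exact: finite_measure_integrable_cst.
- move=> w; rewrite (le_trans (gK _ _))//.
  by have -> : x + X w - (y + X w) = x - y by ring.
Qed.

(** The Taylor bound is integrated at the base points [x + X w]; its right-hand side does not depend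
    on the base point. *)
Lemma taylor_bounded_integral C h h1 h2 X : measurable_fun setT X ->
  taylor_bounded C h h1 h2 ->
  taylor_bounded C (fun x => \int[P]_w h (x + X w)) (fun x => \int[P]_w h1 (x + X w))
    (fun x => \int[P]_w h2 (x + X w)).
Proof.
move=> mX [[M [K bh]] [M1 [K1 bh1]] [M2 [K2 bh2]] hC]; split.
- by exists M, K; exact: bounded_lipschitz_integral.
- by exists M1, K1; exact: bounded_lipschitz_integral.
- by exists M2, K2; exact: bounded_lipschitz_integral.
move=> x u; have mxX y : measurable_fun setT (fun w => y + X w) by exact: measurable_funD.
have I0 y := integrable_bounded_lipschitz (mxX y) bh.
have I1 := integrable_bounded_lipschitz (mxX x) bh1.
have I2 := integrable_bounded_lipschitz (mxX x) bh2.
have I1u : P.-integrable setT (EFin \o (fun w => h1 (x + X w) * u)).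
  by under eq_fun do rewrite mulrC; exact: integrable_scale.
have I2u : P.-integrable setT (EFin \o (fun w => h2 (x + X w) * (u ^+ 2 / 2))).
  by under eq_fun do rewrite mulrC; exact: integrable_scale.
rewrite -mulrA -!RintegralZr// -RintegralB//.
have I01 : P.-integrable setT (EFin \o (fun w => h (x + u + X w) - h (x + X w))).
  exact: (integrableB measurableT (I0 (x + u)) (I0 x)).
rewrite -RintegralB// -RintegralB//; last exact: (integrableB measurableT I01 I1u).
apply: norm_Rintegral_bounded.
  apply/measurable_EFinP; apply: (measurable_int P).
  exact: (integrableB measurableT (integrableB measurableT I01 I1u) I2u).
move=> w; have := hC (x + X w) u.
by rewrite [x + u + _]addrAC [h2 _ * (_ / _)]mulrA.
Qed.

(** A truncated third moment, in place of the tail expectation of Lindeberg's condition. It is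
    finite as soon as [X] is square integrable, and [a^2] times it controls the Taylor remainder for
    the increment [a X]. *)
Definition lindeberg_term X a := \int[P]_w (X w ^+ 2 * Num.min 1 (a * `|X w|)).

Lemma lindeberg_term_integrable X a : square_integrable P X -> 0 <= a ->
  P.-integrable setT (EFin \o (fun w => X w ^+ 2 * Num.min 1 (a * `|X w|))).
Proof.
move=> [mX iX] a0; apply: (le_integrable_norm _ iX) => [|w].
  apply: measurable_funM; first exact: measurable_funX.
  apply: measurable_minr => //; apply: measurable_funM => //.
  exact: measurableT_comp.
have m0 : 0 <= Num.min 1 (a * `|X w|) by rewrite le_min ler01 mulr_ge0.
rewrite ger0_norm; last by rewrite mulr_ge0// sqr_ge0.
by rewrite ler_piMr ?sqr_ge0// ge_min lexx.
Qed.

Lemma le_lindeberg_term X a b : square_integrable P X -> 0 <= a -> a <= b ->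
  lindeberg_term X a <= lindeberg_term X b.
Proof.
move=> sX a0 ab; apply: le_Rintegral => //.
- exact: lindeberg_term_integrable.
- by apply: lindeberg_term_integrable => //; exact: le_trans ab.
move=> w _; apply: ler_wpM2l; first exact: sqr_ge0.
by rewrite le_min ge_min lexx/= ge_min ler_wpM2r ?orbT.
Qed.

(** Dominated convergence along [a = 1 / (n + 1)], with [X^2] as dominating function. *)
Lemma lindeberg_term_small X e : square_integrable P X -> 0 < e ->
  exists2 a, 0 < a & lindeberg_term X a <= e.
Proof.
move=> sX e0; have [mX iX] := sX.
pose f_ n w := (X w ^+ 2 * Num.min 1 (n.+1%:R^-1 * `|X w|))%:E : \bar R.
have m0 n w : 0 <= Num.min 1 (n.+1%:R^-1 * `|X w|) by rewrite le_min ler01 mulr_ge0.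
have mf n : measurable_fun setT (f_ n).
  by apply: (measurable_int P); apply: lindeberg_term_integrable.
have f_cvg : {ae P, forall w, setT w -> f_ ^~ w @ \oo --> (cst 0%E : T -> \bar R) w}.
  apply: aeW => w _; apply: cvg_EFin; first exact: nearW.
  apply: (@squeeze_cvgr _ _ _ _ (cst 0) (fun n => harmonic n * (X w ^+ 2 * `|X w|))).
  - apply: nearW => n; rewrite /f_/=.
    rewrite mulr_ge0 ?sqr_ge0//= /harmonic mulrCA ler_wpM2l ?sqr_ge0//.
    by rewrite ge_min lexx orbT.
  - exact: cvg_cst.
  - rewrite -(mul0r (X w ^+ 2 * `|X w|)); apply: cvgM; last exact: cvg_cst.
    exact: cvg_harmonic.
have f_dom : {ae P, forall w n, setT w -> (`|f_ n w| <= (X w ^+ 2)%:E)%E}.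
  apply: aeW => w n _; rewrite /f_ /= lee_fin ger0_norm; last by rewrite mulr_ge0// sqr_ge0.
  by rewrite ler_piMr ?sqr_ge0// ge_min lexx.
have [_ _] := dominated_convergence measurableT mf (measurable_cst 0%E) f_cvg iX f_dom.
rewrite integral0 => /fine_cvgP[_] /cvgrPdist_le /(_ _ e0) [N _ /(_ N (leqnn N))] /=.
rewrite sub0r normrN => H; exists N.+1%:R^-1; first by rewrite invr_gt0.
exact: le_trans (ler_norm _) H.
Qed.

(** The linear term integrates to 0 and the quadratic term sees only the variance, so centred
    variables with equal variances share the same main part. *)
Lemma integral_taylor C h h1 h2 X s2 x a : taylor_bounded C h h1 h2 ->
  square_integrable P X -> \int[P]_w X w = 0 -> \int[P]_w (X w ^+ 2) = s2 -> 0 <= a ->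
  `|\int[P]_w h (x + a * X w) - (h x + h2 x * (a ^+ 2 * s2) / 2)| <=
    C * (a ^+ 2 * lindeberg_term X a).
Proof.
move=> [[M [K bh]] _ _ hC] sX X0 X2 a0.
have [mX iX2] := sX; have iX := square_integrable1 sX.
have iL := lindeberg_term_integrable sX a0.
have E1 : \int[P]_w (h x + (h1 x * a * X w + h2 x * a ^+ 2 / 2 * X w ^+ 2)) =
    h x + h2 x * (a ^+ 2 * s2) / 2.
  have i1 := integrable_scale (h1 x * a) iX.
  have i2 := integrable_scale (h2 x * a ^+ 2 / 2) iX2.
  rewrite RintegralD//; last 2 first.
  - exact: finite_measure_integrable_cst.
  - exact: (integrableD measurableT i1 i2).
  rewrite (integral_prob_cst P) RintegralD// !RintegralZl// X0 X2.
  by ring.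
rewrite -E1 /lindeberg_term (mulrA C) -RintegralZl//.
apply: dist_Rintegral_le.
- apply: integrable_bounded_lipschitz bh.
  by apply: measurable_funD => //; exact: measurable_funM.
- have i1 := integrable_scale (h1 x * a) iX.
  have i2 := integrable_scale (h2 x * a ^+ 2 / 2) iX2.
  have i0 : P.-integrable setT (EFin \o (cst (h x))) by exact: finite_measure_integrable_cst.
  exact: (integrableD measurableT i0 (integrableD measurableT i1 i2)).
- exact: integrable_scale.
- move=> w; have := hC x (a * X w).
  rewrite normrM (ger0_norm a0) exprMn.
  have -> : h (x + a * X w) - h x - h1 x * (a * X w) - h2 x * (a ^+ 2 * X w ^+ 2) / 2 =
    h (x + a * X w) - (h x + (h1 x * a * X w + h2 x * a ^+ 2 / 2 * X w ^+ 2)) by field.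
  by rewrite !mulrA.
Qed.

End averaging.

(** * Replacement of the summands by Gaussian variables *)

Section trotter.
Context d (T : measurableType d) (R : realType) (P : probability T R).
Local Notation N01 := (normal_prob (0 : R) 1).
Implicit Types (g h : R -> R).

(** Adding [M] makes [h] nonnegative, as the density computation requires; [b = 0] is treated apart
    because there is then no density to integrate. *)
Lemma gaussian_bounded_lipschitz_stability M K h a b : bounded_lipschitz M K h ->
  0 <= a -> 0 <= b ->
  \int[N01]_z \int[N01]_u h (a * z + b * u) = \int[N01]_z h (Num.sqrt (a ^+ 2 + b ^+ 2) * z).
Proof.
move=> bh a0; rewrite le_eqVlt => /predU1P[<-|b0].
  rewrite expr0n addr0 sqrtr_sqr ger0_norm//; apply: eq_Rintegral => z _.
  by under eq_Rintegral do rewrite mul0r addr0; rewrite (integral_prob_cst N01).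
have [hM hK] := bh; set c := Num.sqrt _.
have c2 : c ^+ 2 = a ^+ 2 + b ^+ 2 by rewrite sqr_sqrtr// addr_ge0// sqr_ge0.
have c0 : 0 < c by rewrite sqrtr_gt0 ltr_wpDl ?sqr_ge0// exprn_gt0.
pose h' x := M + h x.
have h'0 x : 0 <= h' x by have := hM x; rewrite ler_norml => /andP[? _]; rewrite -lerBlDl sub0r.
have ch' : continuous h'.
  move=> x; apply: cvgD; first exact: cvg_cst.
  exact: bounded_lipschitz_continuous bh x.
have mZ (k : R) : measurable_fun [set: measurableTypeR R] (fun z => k * z : R).
  exact: measurable_funM.
have := gaussian_stability_ge0 ch' h'0 b0 c0 c2.
have inner z : (\int[N01]_u (h' (a * z + b * u))%:E = (M + \int[N01]_u h (a * z + b * u))%:E)%E.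
  have iN : N01.-integrable setT (EFin \o (fun u => h (a * z + b * u))).
    by apply: (@integrable_bounded_lipschitz _ _ _ N01 M K h (fun u => a * z + b * u)) => //; exact: measurable_funD.
  have iM : N01.-integrable setT (EFin \o (cst M)) by exact: finite_measure_integrable_cst.
  rewrite -EFin_Rintegral; last exact: (integrableD measurableT iM iN).
  by rewrite RintegralD// (integral_prob_cst N01).
under eq_integral do rewrite inner.
move=> /(congr1 fine).
rewrite -/(Rintegral _ _ _) -/(Rintegral _ _ _).
have iM : N01.-integrable setT (EFin \o (cst M)) by exact: finite_measure_integrable_cst.
rewrite !RintegralD//.
- by rewrite (integral_prob_cst N01) => /addrI.
- exact: (@integrable_bounded_lipschitz _ _ _ N01 M K h (fun z => c * z)).
- have bH := bounded_lipschitz_integral N01 (mZ b) bh.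
  exact: (integrable_bounded_lipschitz N01 (mZ a) bH).
Qed.

Variables (X : nat -> T -> R) (sigma : R) (w : nat -> R) (w0 : R).
Hypothesis sX : square_integrable P (X 0%N).
Hypothesis mX : forall i, measurable_fun setT (X i).
Hypothesis sigma0 : 0 <= sigma.
Hypothesis X0 : \int[P]_t X 0%N t = 0.
Hypothesis X2 : \int[P]_t (X 0%N t ^+ 2) = sigma ^+ 2.
Hypothesis w_itv : forall i, 0 <= w i <= w0.
Let S m t := \sum_(i < m) w i * X i t.
Hypothesis decouple : forall m M K h, bounded_lipschitz M K h ->
  \int[P]_t h (S m t + w m * X m t) = \int[P]_t \int[P]_t' h (S m t + w m * X 0%N t').

Definition lindeberg_error :=
  lindeberg_term P (X 0%N) w0 + lindeberg_term N01 (fun z => sigma * z) w0.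

Let w00 : 0 <= w0.
Proof. by have /andP[a b] := w_itv 0; exact: le_trans b. Qed.

Let sN : square_integrable N01 (fun z => sigma * z).
Proof. exact: square_integrableZ (gaussian_square_integrable R). Qed.

Let N0 : \int[N01]_z (sigma * z) = 0.
Proof.
rewrite RintegralZl//; last exact: square_integrable1 (gaussian_square_integrable R).
by rewrite gaussian_mean mulr0.
Qed.

Let N2 : \int[N01]_z (sigma * z) ^+ 2 = sigma ^+ 2.
Proof.
under eq_Rintegral do rewrite exprMn.
rewrite RintegralZl//; last by have [] := gaussian_square_integrable R.
by rewrite /Rintegral gaussian_second_moment mulr1.
Qed.

Lemma taylor_swap C h h1 h2 m x : 0 <= C -> taylor_bounded C h h1 h2 ->
  `|\int[P]_t h (x + w m * X 0%N t) - \int[N01]_z h (x + w m * (sigma * z))| <=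
    C * w m ^+ 2 * lindeberg_error.
Proof.
move=> C0 hC; have /andP[wm0 wmw0] := w_itv m.
have H1 := integral_taylor x hC sX X0 X2 wm0.
have H2 := integral_taylor x hC sN N0 N2 wm0.
rewrite distrC in H2.
rewrite -(subrKA (h x + h2 x * (w m ^+ 2 * sigma ^+ 2) / 2)).
rewrite (le_trans (ler_normD _ _))// (le_trans (lerD H1 H2))//.
rewrite -mulrDr -mulrDr -mulrA ler_wpM2l// ler_wpM2l ?sqr_ge0//.
by apply: lerD; exact: le_lindeberg_term.
Qed.

(** Induction on the number of terms, for all [h] at once. Averaging out the last summand turns [h]
    into [h'], which satisfies the same Taylor bound with the same [C], so the induction hypothesis
    replaces the first [m] summands. The last one is then exchanged by [taylor_swap] at each frozen
    value, and stability of the normal law merges the two Gaussian variables. *)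
Lemma trotter C h h1 h2 m : 0 <= C -> taylor_bounded C h h1 h2 ->
  `|\int[P]_t h (S m t) - \int[N01]_z h (sigma * Num.sqrt (\sum_(i < m) w i ^+ 2) * z)| <=
    C * (\sum_(i < m) w i ^+ 2) * lindeberg_error.
Proof.
move=> C0; elim: m h h1 h2 => [|m IH] h h1 h2 hC.
  rewrite !big_ord0 sqrtr0 !mulr0 mul0r.
  under eq_Rintegral do rewrite /S big_ord0.
  under [X in _ - X]eq_Rintegral do rewrite mul0r.
  by rewrite (integral_prob_cst P) (integral_prob_cst N01) subrr normr0.
have [[M [K bh]] _ _ _] := hC; have /andP[wm0 wmw0] := w_itv m.
have mwX : measurable_fun setT (fun t => w m * X 0%N t) by apply: measurable_funM.
have mwN (c : R) : measurable_fun [set: measurableTypeR R] (fun z => c * z : R).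
  exact: measurable_funM.
pose h' y := \int[P]_t h (y + w m * X 0%N t).
have hC' := taylor_bounded_integral P mwX hC.
have {}IH := IH _ _ _ hC'.
have bh' := bounded_lipschitz_integral P mwX bh.
set c := Num.sqrt _ in IH *.
have -> : \int[P]_t h (S m.+1 t) = \int[P]_t h' (S m t).
  under eq_Rintegral do rewrite /S big_ord_recr/=.
  exact: decouple bh.
set c' := Num.sqrt _.
have -> : \int[N01]_z h (sigma * c' * z) =
    \int[N01]_z \int[N01]_u h (sigma * c * z + w m * sigma * u).
  rewrite (gaussian_bounded_lipschitz_stability bh) ?mulr_ge0 ?sqrtr_ge0//.
  apply: eq_Rintegral => z _; congr (h (_ * _)).
  rewrite /c' big_ord_recr/= exprMn sqr_sqrtr; last by apply: sumr_ge0 => i _; exact: sqr_ge0.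
  rewrite exprMn [w m ^+ 2 * _]mulrC -mulrDr sqrtrM ?sqr_ge0//.
  by rewrite sqrtr_sqr ger0_norm.
rewrite -(subrKA (\int[N01]_z h' (sigma * c * z))) big_ord_recr/=.
rewrite (le_trans (ler_normD _ _))// (mulrDr C) (mulrDl _ _ lindeberg_error) lerD//.
rewrite -[leRHS](integral_prob_cst N01); apply: dist_Rintegral_le.
- exact: (@integrable_bounded_lipschitz _ _ _ N01 M K h' (fun z => sigma * c * z)).
- have bH := bounded_lipschitz_integral N01 (mwN (w m * sigma)) bh.
  exact: (@integrable_bounded_lipschitz _ _ _ N01 M K (fun y => \int[N01]_u h (y + w m * sigma * u))
     (fun z => sigma * c * z)).
- exact: finite_measure_integrable_cst.
- move=> z; have := taylor_swap m (sigma * c * z) C0 hC.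
  by under [X in _ - X]eq_Rintegral do rewrite mulrA.
Qed.

(** Smoothing at scale [s] costs [2 K s] in each of the two integrals, and [trotter] handles the
    smoothed function. Its constant blows up as [s] tends to 0, so [s] has to be fixed before the
    weights are made small. *)
Lemma bounded_lipschitz_clt s M K g m : 0 < s -> bounded_lipschitz M K g ->
  `|\int[P]_t g (S m t) - \int[N01]_z g (sigma * Num.sqrt (\sum_(i < m) w i ^+ 2) * z)| <=
    4 * K * s + (8 * M + 4 * K) / s ^+ 2 * (\sum_(i < m) w i ^+ 2) * lindeberg_error.
Proof.
move=> s0 bg; have [h1 [h2 hC]] := smoothing_taylor s0 bg.
have [M0 K0] := bounded_lipschitz_ge0 bg.
have C0 : 0 <= (8 * M + 4 * K) / s ^+ 2 by rewrite divr_ge0 ?sqr_ge0// addr_ge0// mulr_ge0.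
have H := trotter m C0 hC; set g2 := moving_average s _ in H.
have bg2 : bounded_lipschitz M K g2 by do 2 apply: bounded_lipschitz_moving_average => //.
set a := sigma * _ in H *.
have mS : measurable_fun setT (S m).
  by apply: measurable_sum => i; exact: measurable_funM.
have near1 : `|\int[P]_t g (S m t) - \int[P]_t g2 (S m t)| <= 2 * K * s.
  rewrite -[leRHS](integral_prob_cst P); apply: dist_Rintegral_le.
  - exact: integrable_bounded_lipschitz bg.
  - exact: integrable_bounded_lipschitz bg2.
  - exact: finite_measure_integrable_cst.
  - by move=> t; rewrite distrC; exact: (smoothing_near _ s0 bg).
have near2 : `|\int[N01]_z g2 (a * z) - \int[N01]_z g (a * z)| <= 2 * K * s.
  have ma : measurable_fun [set: measurableTypeR R] (fun z => a * z : R) by exact: measurable_funM.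
  rewrite -[leRHS](integral_prob_cst N01); apply: dist_Rintegral_le.
  - exact: (integrable_bounded_lipschitz N01 ma bg2).
  - exact: (integrable_bounded_lipschitz N01 ma bg).
  - exact: finite_measure_integrable_cst.
  - by move=> z; exact: (smoothing_near _ s0 bg).
rewrite -(subrKA (\int[P]_t g2 (S m t))) -[X in _ + X](subrKA (\int[N01]_z g2 (a * z))).
rewrite (le_trans (ler_normD _ _))// (le_trans (lerD near1 (ler_normD _ _)))//.
by rewrite (le_trans (lerD (lexx _) (lerD H near2)))//; lra.
Qed.

End trotter.

(** * Convergence in probability and in distribution *)

Section real_probability.
Context d (T : measurableType d) (R : realType) (P : probability T R).
Implicit Types (A D : set T) (U V X : T -> R).

Definition pr A := fine (P A).

Lemma pr_ge0 A : 0 <= pr A. Proof. exact: fine_ge0. Qed.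

Lemma EFin_pr A : measurable A -> (pr A)%:E = P A.
Proof. by move=> mA; rewrite /pr fineK// fin_num_measure. Qed.

Lemma le_pr A D : measurable A -> measurable D -> A `<=` D -> pr A <= pr D.
Proof.
move=> mA mD AD; rewrite /pr fine_le ?fin_num_measure//.
by apply: le_measure => //; rewrite inE.
Qed.

Lemma le_prU A D E : measurable A -> measurable D -> measurable E ->
  A `<=` D `|` E -> pr A <= pr D + pr E.
Proof.
move=> mA mD mE ADE; have mDE := measurableU _ _ mD mE.
rewrite (le_trans (le_pr mA mDE ADE))// /pr -fineD ?fin_num_measure//.
by rewrite fine_le ?fin_numD ?fin_num_measure// measureU2.
Qed.

Lemma measurable_norm_ge U c : measurable_fun setT U ->
  measurable [set w | c <= `|U w|].
Proof.
move=> mU; rewrite -[X in measurable X]setTI.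
apply: (measurable_fun_le _ _) => //.
exact: measurableT_comp.
Qed.

Lemma pr_ae_eq A D : measurable A -> measurable D ->
  {ae P, forall w, A w <-> D w} -> pr A = pr D.
Proof.
move=> mA mD AD; congr fine.
transitivity (\int[P]_w (\1_A w)%:E)%E; first by rewrite integral_indic// setIT.
transitivity (\int[P]_w (\1_D w)%:E)%E; last by rewrite integral_indic// setIT.
apply: ae_eq_integral => //; [exact/measurable_EFinP/measurable_indic..|].
apply: filterS AD => w ADw _; rewrite !indicE; have [Aw|nAw] := pselect (A w).
  by rewrite !mem_set//; exact/ADw.
by rewrite !memNset// => /ADw.
Qed.

Lemma Rintegral_indic_comp (X : T -> R) (A : set R) : measurable_fun setT X -> measurable A ->
  \int[P]_w \1_A (X w) = pr (X @^-1` A).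
Proof.
move=> mX mA; rewrite /Rintegral /pr; congr fine.
have mXA : measurable (X @^-1` A) by rewrite -[X in measurable X]setTI; exact: mX.
transitivity (\int[P]_w (\1_(X @^-1` A) w)%:E)%E; last by rewrite integral_indic// setIT.
by apply: eq_integral => w _; rewrite !indicE; congr (_%:R)%:E; rewrite !inE.
Qed.

Lemma integrable_indic_comp (X : T -> R) (A : set R) : measurable_fun setT X -> measurable A ->
  P.-integrable setT (EFin \o (fun w => \1_A (X w) : R)).
Proof.
move=> mX mA; apply: (@bounded_integrable _ _ _ _ _ 1).
  by apply: measurableT_comp mX; exact: measurable_indic.
by move=> w; rewrite indicE; case: (_ \in _); rewrite ?normr1 ?normr0.
Qed.

Lemma dist_Rintegral_event U V D M a b : measurable_fun setT U -> measurable_fun setT V ->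
  (forall w, `|U w| <= M) -> (forall w, `|V w| <= M) -> measurable D ->
  0 <= a -> 0 <= b ->
  (forall w, `|U w - V w| <= b) -> (forall w, ~ D w -> `|U w - V w| <= a) ->
  `|\int[P]_w U w - \int[P]_w V w| <= a + b * pr D.
Proof.
move=> mU mV UM VM mD a0 b0 Hb Ha.
have iD : P.-integrable setT (EFin \o (\1_D : T -> R)).
  apply: (@bounded_integrable _ _ _ _ _ 1); first exact: measurable_indic.
  by move=> w; rewrite indicE; case: (w \in D); rewrite ?normr1 ?normr0.
have ia : P.-integrable setT (EFin \o (cst a)) by exact: finite_measure_integrable_cst.
have -> : a + b * pr D = \int[P]_w (a + b * \1_D w).
  rewrite RintegralD//; last exact: integrable_scale.
  rewrite (integral_prob_cst P) RintegralZl//; congr (_ + _ * _).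
  by rewrite /Rintegral integral_indic// setIT.
apply: dist_Rintegral_le.
- exact: bounded_integrable UM.
- exact: bounded_integrable VM.
- exact: (integrableD measurableT ia (integrable_scale b iD)).
- move=> w; rewrite indicE; have [/set_mem Dw|/negP Dw] := boolP (w \in D).
    by rewrite mulr1 (le_trans (Hb w))// lerDr.
  by rewrite mulr0 addr0; apply: Ha => Dw'; apply: Dw; exact: mem_set.
Qed.

Lemma pr_markov X c : P.-integrable setT (EFin \o X) -> (forall w, 0 <= X w) -> 0 < c ->
  pr [set w | c <= X w] <= (\int[P]_w X w) / c.
Proof.
move=> iX X0 c0; have mX : measurable_fun setT X.
  by apply/measurable_EFinP; exact: (measurable_int P).
rewrite ler_pdivlMr// -lee_fin EFinM /pr fineK; last first.
  rewrite fin_num_measure// -[X in measurable X]setTI.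
  exact: measurable_fun_le.
rewrite EFin_Rintegral// muleC.
have := @le_integral_abse _ _ _ P setT measurableT (EFin \o X) c.
rewrite setTI /= => /(_ (measurable_int P iX) c0).
rewrite (_ : [set x | _] = [set w | c <= X w]).
  by under eq_integral do rewrite ger0_norm//.
by apply/seteqP; split => w /=; rewrite lee_fin ger0_norm.
Qed.

End real_probability.

Section convergence_in_probability.
Context d (T : measurableType d) (R : realType) (P : probability T R).
Implicit Types (X Y : nat -> T -> R).

(** Convergence to 0 in probability, with the measurability of each term built in. *)
Definition negligible_in_prob X :=
  (forall n, measurable_fun setT (X n)) /\
  forall c e : R, 0 < c -> 0 < e -> \forall n \near \oo, pr P [set w | c <= `|X n w|] <= e.

Definition tight X :=
  (forall n, measurable_fun setT (X n)) /\
  forall e : R, 0 < e -> exists2 K, 0 < K & \forall n \near \oo, pr P [set w | K <= `|X n w|] <= e.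

Lemma negligible_in_prob_L1 X (b : nat -> R) : (forall n, measurable_fun setT (X n)) ->
  (forall n, P.-integrable setT (EFin \o X n)) ->
  (\forall n \near \oo, \int[P]_w `|X n w| <= b n) -> b n @[n --> \oo] --> (0 : R) ->
  negligible_in_prob X.
Proof.
move=> mX iX Xb b0; split => // c e c0 e0.
have ce : 0 < c * e by rewrite mulr_gt0.
move/cvgrPdist_le : b0 => /(_ _ ce); apply: filterS2 Xb => n Xb; rewrite sub0r normrN => bn.
rewrite (le_trans (pr_markov (X := fun w => `|X n w|) _ _ c0))//.
  exact: integrable_norm.
rewrite ler_pdivrMr// mulrC (le_trans Xb)// (le_trans (ler_norm _))//.
Qed.

Lemma negligible_in_prob_L2 X (b : nat -> R) : (forall n, square_integrable P (X n)) ->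
  (forall n, \int[P]_w (X n w ^+ 2) <= b n) -> b n @[n --> \oo] --> (0 : R) ->
  negligible_in_prob X.
Proof.
move=> sX Xb b0; split => [n|c e c0 e0]; first by case: (sX n).
have ce : 0 < c ^+ 2 * e by rewrite mulr_gt0// exprn_gt0.
move/cvgrPdist_le : b0 => /(_ _ ce); apply: filterS => n; rewrite sub0r normrN => bn.
rewrite (_ : [set w | _] = [set w | c ^+ 2 <= X n w ^+ 2]); last first.
  apply/seteqP; split => w /=; rewrite -[X n w ^+ 2]real_normK ?num_real// ler_sqr ?nnegrE//.
  - exact: ltW.
  - exact: ltW.
rewrite (le_trans (pr_markov (X := fun w => X n w ^+ 2) _ _ _)) ?exprn_gt0//.
- by case: (sX n).
- by move=> w; exact: sqr_ge0.
rewrite ler_pdivrMr ?exprn_gt0// mulrC (le_trans (Xb n))// (le_trans (ler_norm _))//.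
Qed.

Lemma negligible_in_probD X Y : negligible_in_prob X -> negligible_in_prob Y ->
  negligible_in_prob (fun n w => X n w + Y n w).
Proof.
move=> [mX pX] [mY pY]; split => [n|c e c0 e0]; first exact: measurable_funD.
have c2 : 0 < c / 2 by rewrite divr_gt0.
have e2 : 0 < e / 2 by rewrite divr_gt0.
near=> n.
rewrite [e]splitr (le_trans (le_prU (D := [set w | c / 2 <= `|X n w|]) (E := [set w | c / 2 <= `|Y n w|]) _ _ _ _ _))//.
- by apply: measurable_norm_ge; exact: measurable_funD.
- exact: measurable_norm_ge.
- exact: measurable_norm_ge.
- move=> w /= cXY; have [cX|Xc] := leP (c / 2) `|X n w|; [by left|right].
  by have := ler_normD (X n w) (Y n w); lra.
- apply: lerD; near: n; [exact: pX|exact: pY].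
Unshelve. all: by end_near. Qed.

Lemma negligible_in_prob_dominated X Y : (forall n, measurable_fun setT (X n)) ->
  negligible_in_prob Y -> (\forall n \near \oo, forall w, `|X n w| <= `|Y n w|) ->
  negligible_in_prob X.
Proof.
move=> mX [mY pY] XY; split => // c e c0 e0; apply: filterS2 XY (pY c e c0 e0) => n XY.
apply: le_trans; apply: le_pr; [exact: measurable_norm_ge..|].
by move=> w /= /le_trans; apply.
Qed.

Lemma negligible_in_probM X Y : negligible_in_prob X -> tight Y ->
  negligible_in_prob (fun n w => X n w * Y n w).
Proof.
move=> [mX pX] [mY pY]; split => [n|c e c0 e0]; first exact: measurable_funM.
have e2 : 0 < e / 2 by rewrite divr_gt0.
have [K K0 YK] := pY _ e2.
have cK : 0 < c / K by rewrite divr_gt0.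
near=> n.
rewrite [e]splitr (le_trans (le_prU (D := [set w | c / K <= `|X n w|]) (E := [set w | K <= `|Y n w|]) _ _ _ _ _))//.
- by apply: measurable_norm_ge; exact: measurable_funM.
- exact: measurable_norm_ge.
- exact: measurable_norm_ge.
- move=> w /= cXY; have [KY|YK'] := leP K `|Y n w|; [by right|left].
  rewrite ler_pdivrMr// (le_trans cXY)// normrM ler_wpM2l//.
  exact: ltW.
- apply: lerD; near: n; [exact: pX|exact: YK].
Unshelve. all: by end_near. Qed.

Lemma negligible_in_prob_ae X Y : (forall n, measurable_fun setT (X n)) ->
  negligible_in_prob Y -> (forall n, {ae P, forall w, X n w = Y n w}) -> negligible_in_prob X.
Proof.
move=> mX [mY pY] XY; split => // c e c0 e0; apply: filterS (pY c e c0 e0) => n.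
rewrite (@pr_ae_eq _ _ _ _ [set w | c <= `|X n w|] [set w | c <= `|Y n w|])//.
- exact: measurable_norm_ge.
- exact: measurable_norm_ge.
- by apply: filterS (XY n) => w /= ->.
Qed.

End convergence_in_probability.

(** * Reduction of weak convergence to bounded Lipschitz functions *)

Section portmanteau.
Context (R : realType).
Implicit Types g : R -> R.

(** The Lipschitz envelope, that is the infimal convolution of [g] with [k |.|]: the largest
    [k]-Lipschitz function below a bounded [g]. It increases with [k]. *)
Definition lower_lipschitz (k : R) g (x : R) : R := inf (range (fun y => g y + k * `|x - y|)).

Lemma lower_lipschitz_has_inf k g M x : 0 <= k -> (forall x, `|g x| <= M) ->
  has_inf (range (fun y => g y + k * `|x - y|)).
Proof.
move=> k0 gM; split; first by exists (g x + k * `|x - x|); exists x.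
exists (- M) => _ [y _ <-]; have := gM y; rewrite ler_norml => /andP[gy _].
by rewrite (le_trans gy)// lerDl mulr_ge0.
Qed.

Lemma lower_lipschitz_le k g M x : 0 <= k -> (forall x, `|g x| <= M) ->
  lower_lipschitz k g x <= g x.
Proof.
move=> k0 gM; have [_ h] := lower_lipschitz_has_inf x k0 gM.
by apply: ge_inf => //; exists x => //; rewrite subrr normr0 mulr0 addr0.
Qed.

Lemma lower_lipschitz_bounded_lipschitz k g M : 0 <= k -> (forall x, `|g x| <= M) ->
  bounded_lipschitz M k (lower_lipschitz k g).
Proof.
move=> k0 gM; have hi x := lower_lipschitz_has_inf x k0 gM.
split=> [x|].
  rewrite ler_norml; apply/andP; split.
    apply: lb_le_inf; first by case: (hi x).
    move=> _ [y _ <-]; have := gM y; rewrite ler_norml => /andP[gy _].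
    by rewrite (le_trans gy)// lerDl mulr_ge0.
  rewrite (le_trans (lower_lipschitz_le x k0 gM))//.
  by have := gM x; rewrite ler_norml => /andP[].
suff H x y : lower_lipschitz k g x - lower_lipschitz k g y <= k * `|x - y|.
  by move=> x y; rewrite ler_norml lerNl opprB H andbT distrC H.
rewrite lerBlDr addrC -lerBlDr; apply: lb_le_inf; first by case: (hi y).
move=> _ [z _ <-]; rewrite lerBlDr.
apply: (@le_trans _ _ (g z + k * `|x - z|)).
  by apply: ge_inf; [case: (hi x)|exists z].
rewrite -addrA lerD2l -mulrDr ler_wpM2l// [leRHS]addrC.
by rewrite (le_trans _ (ler_normD _ _))// subrKA.
Qed.

(** A point [y] at distance at least [r] from [x] pays a penalty of at least [n r >= 2 M], as much
    as [g] can gain there; at closer points [g] is near [g x]. *)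
Lemma cvg_lower_lipschitz g M x : continuous g -> (forall x, `|g x| <= M) ->
  lower_lipschitz n%:R g x @[n --> \oo] --> g x.
Proof.
move=> cg gM; apply/cvgrPdist_le => e e0.
have M0 : 0 <= M by exact: le_trans (normr_ge0 _) (gM 0).
have := cg x; move/cvgrPdist_le => /(_ _ e0) /nbhs_ballP[r r0 gr].
near=> n.
have n2 : 2 * M <= n%:R * r.
  rewrite -ler_pdivrMr//; near: n; exact: nbhs_infty_ger.
rewrite ger0_norm ?subr_ge0; last exact: lower_lipschitz_le gM.
rewrite lerBlDr -lerBlDl; apply: lb_le_inf.
  by case: (lower_lipschitz_has_inf x (ler0n R n) gM).
move=> _ [y _ <-]; have [rxy|xyr] := leP r `|x - y|.
  have := gM x; have := gM y; rewrite !ler_norml => /andP[? _] /andP[_ ?].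
  have : n%:R * r <= n%:R * `|x - y| by rewrite ler_wpM2l.
  by lra.
have := gr y xyr; rewrite /= ler_norml => /andP[_ ?].
have : 0 <= n%:R * `|x - y| by rewrite mulr_ge0.
by lra.
Unshelve. all: by end_near. Qed.

Context d (T : measurableType d) (P : probability T R).
Context d' (T' : measurableType d') (Q : probability T' R).

(** A lower bound on the limit inferior passes from the envelopes, which lie below, to any bounded
    continuous function. Applied to [g] and to [- g], it gives the limit. *)
Lemma cvg_in_distribution_bounded_lipschitz (X : nat -> T -> R) (Z : T' -> R) :
  (forall n, measurable_fun setT (X n)) -> measurable_fun setT Z ->
  (forall M K g, bounded_lipschitz M K g -> forall e, 0 < e ->
    \forall n \near \oo, `|\int[P]_w g (X n w) - \int[Q]_z g (Z z)| <= e) ->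
  cvg_in_distribution P X Q Z.
Proof.
move=> mX mZ XZ; split => // g cg [M gM].
have mg : measurable_fun setT g by exact: continuous_measurable_fun.
have iX n (h : R -> R) : measurable_fun setT h -> (forall x, `|h x| <= M) -> P.-integrable setT (EFin \o (fun w => h (X n w))).
  by move=> mh hM; apply: (@bounded_integrable _ _ _ _ _ M) => //; exact: measurableT_comp mh (mX n).
have iZ (h : R -> R) : measurable_fun setT h -> (forall x, `|h x| <= M) -> Q.-integrable setT (EFin \o (fun w => h (Z w))).
  by move=> mh hM; apply: (@bounded_integrable _ _ _ _ _ M) => //; exact: measurableT_comp mh mZ.
have lower (h : R -> R) : continuous h -> (forall x, `|h x| <= M) -> forall e, 0 < e ->
    \forall n \near \oo, \int[Q]_z h (Z z) - e <= \int[P]_w h (X n w).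
  move=> ch hM e e0; have mh : measurable_fun setT h by exact: continuous_measurable_fun.
  have e2 : 0 < e / 2 by rewrite divr_gt0.
  have blk k := lower_lipschitz_bounded_lipschitz (ler0n R k) hM.
  have mlk k := bounded_lipschitz_measurable (blk k).
  have [k Hk] : exists k, \int[Q]_z h (Z z) - e / 2 <= \int[Q]_z lower_lipschitz k%:R h (Z z).
    have mf k : measurable_fun setT (fun z => (lower_lipschitz k%:R h (Z z))%:E).
      by apply/measurable_EFinP; exact: measurableT_comp (mlk k) mZ.
    have mf0 : measurable_fun setT (fun z => (h (Z z))%:E).
      by apply/measurable_EFinP; exact: measurableT_comp mh mZ.
    have fcv : {ae Q, forall z, setT z -> (lower_lipschitz n%:R h (Z z))%:E @[n --> \oo] --> (h (Z z))%:E}.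
      by apply: aeW => z _; apply: cvg_EFin; [exact: nearW|exact: cvg_lower_lipschitz hM].
    have fdom : {ae Q, forall z n, setT z -> (`|(lower_lipschitz n%:R h (Z z))%:E| <= (cst M%:E z))%E}.
      by apply: aeW => z n _ /=; rewrite lee_fin; case: (blk n).
    have iM : Q.-integrable setT (cst M%:E) by exact: finite_measure_integrable_cst.
    have [_ _ H] := dominated_convergence measurableT mf mf0 fcv iM fdom.
    rewrite -EFin_Rintegral in H; last exact: iZ.
    have /fine_cvgP[_ /cvgrPdist_le /(_ _ e2) [k _ /(_ k (leqnn k))]] := H.
    rewrite /= ler_norml => /andP[_]; rewrite lerBlDr -lerBlDl => Hk.
    by exists k.
  apply: filterS (XZ _ _ _ (blk k) _ e2) => n; rewrite ler_norml => /andP[Hn _].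
  apply: (@le_trans _ _ (\int[P]_w lower_lipschitz k%:R h (X n w))); first by lra.
  apply: le_Rintegral => //.
  - by apply: iX; [exact: mlk|case: (blk k)].
  - exact: iX.
  - by move=> w _; exact: lower_lipschitz_le hM.
have cNg : continuous (fun x => - g x) by move=> x; apply: cvgN; exact: cg.
have NgM x : `|- g x| <= M by rewrite normrN.
rewrite -EFin_Rintegral; last exact: iZ.
rewrite (_ : (fun n => _) = (fun n => (\int[P]_w g (X n w))%:E)); last first.
  by apply/funext => n; rewrite EFin_Rintegral//; exact: iX.
apply: cvg_EFin; first exact: nearW.
apply/cvgrPdist_le => e e0; near=> n.
have mN (S : Type) (h : S -> R) : (fun w => - h w) = (fun w => -1 * h w) by apply/funext => w; rewrite mulN1r.
have H1 : \int[Q]_z g (Z z) - e <= \int[P]_w g (X n w) by near: n; exact: lower.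
have : \int[Q]_z (- g (Z z)) - e <= \int[P]_w (- g (X n w)) by near: n; exact: lower cNg NgM _ e0.
rewrite /= !(mN _ (fun _ => g _)) !RintegralZl//; [|exact: iX|exact: iZ].
rewrite ler_norml /=; lra.
Unshelve. all: by end_near. Qed.

End portmanteau.

Lemma slutsky (R : realType) d (T : measurableType d) (P : probability T R)
    (X Y : nat -> T -> R) M K (g : R -> R) e :
  (forall n, measurable_fun setT (Y n)) -> negligible_in_prob P (fun n w => X n w - Y n w) ->
  (forall n, measurable_fun setT (X n)) ->
  bounded_lipschitz M K g -> 0 < e ->
  \forall n \near \oo, `|\int[P]_w g (X n w) - \int[P]_w g (Y n w)| <= e.
Proof.
move=> mY [_ XY] mX bg e0; have [M0 K0] := bounded_lipschitz_ge0 bg; have [gM gK] := bg.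
(* [c] and [e'] make [K c] and [2 M e'] at most [e / 2] each; the added 1 guards against [K = 0] or
   [M = 0]. *)
pose c := e / 2 / (K + 1); have c0 : 0 < c by rewrite !divr_gt0// ltr_wpDl.
pose e' := e / 2 / (M + M + 1); have e'0 : 0 < e' by rewrite !divr_gt0// ltr_wpDl// addr_ge0.
apply: filterS (XY c e' c0 e'0) => n He.
have mXY : measurable_fun setT (fun w => X n w - Y n w) by exact: measurable_funB.
rewrite (le_trans (@dist_Rintegral_event _ _ _ P (fun w => g (X n w)) (fun w => g (Y n w))
  [set w | c <= `|X n w - Y n w|] M (K * c) (M + M) _ _ _ _ _ _ _ _ _))//.
- exact: measurable_bounded_lipschitz_comp bg.
- exact: measurable_bounded_lipschitz_comp bg.
- exact: measurable_norm_ge.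
- by rewrite mulr_ge0// ltW.
- by rewrite addr_ge0.
- by move=> w; rewrite (le_trans (ler_normB _ _))// lerD.
- move=> w /= /negP; rewrite -ltNge => /ltW H; rewrite (le_trans (gK _ _))//.
  by rewrite ler_wpM2l.
rewrite [e]splitr lerD//.
- rewrite /c mulrCA ler_piMr ?divr_ge0 ?(ltW e0)//.
  by rewrite ler_pdivrMr ?mul1r ?lerDl// ltr_wpDl.
- rewrite (@le_trans _ _ ((M + M) * e'))//; first by rewrite ler_wpM2l// addr_ge0.
  rewrite /e' mulrCA ler_piMr ?divr_ge0 ?(ltW e0)//.
  by rewrite ler_pdivrMr ?mul1r ?lerDl// ltr_wpDl// addr_ge0.
Qed.

(** * Measurability of the sign and of the inverse *)

Section measurability.
Context (R : realType).

Lemma sgr_indic (x : R) : Num.sg x = (0 <= x)%R%:R - (x <= 0)%R%:R.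
Proof.
have [x0|x0|->] := ltgtP x 0.
- by rewrite ltr0_sg// sub0r.
- by rewrite gtr0_sg// subr0.
- by rewrite sgr0 subrr.
Qed.

Lemma measurable_sgr : measurable_fun setT (Num.sg : R -> R).
Proof.
rewrite (_ : Num.sg = (fun x : R => if 0 <= x then (if x <= 0 then 0 else 1) else -1)).
  apply: measurable_fun_ifT => //; first exact: measurable_fun_ler.
  by apply: measurable_fun_ifT => //; exact: measurable_fun_ler.
apply/funext => x; case: (ltgtP x 0) => x0; last by rewrite x0 sgr0.
  by rewrite ltr0_sg.
by rewrite gtr0_sg.
Qed.

Lemma sgr_le1 (x : R) : `|Num.sg x| <= 1.
Proof. by rewrite normr_sg; case: (x != 0). Qed.

(** A pointwise limit of the continuous functions [x / (x^2 + 1 / (n + 1))], also at 0, where the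
    inverse is 0 by convention. *)
Lemma measurable_invr : measurable_fun setT (GRing.inv : R -> R).
Proof.
pose f n (x : R) := x / (x ^+ 2 + n.+1%:R^-1).
have d0 n (x : R) : x ^+ 2 + n.+1%:R^-1 != 0.
  by rewrite gt_eqF// ltr_wpDl ?sqr_ge0// invr_gt0.
apply: (measurable_fun_cvg (h := f)) => [n|x _].
  apply: continuous_measurable_fun => x; apply: cvgM; first exact: cvg_id.
  apply: cvgV => //; apply: cvgD; [exact: sqr_continuous|exact: cvg_cst].
have [->|x0] := eqVneq x 0.
  by rewrite invr0 /f; under eq_fun do rewrite mul0r; exact: cvg_cst.
rewrite (_ : x^-1 = x / (x ^+ 2 + 0)); last by rewrite addr0; field.
apply: cvgM; first exact: cvg_cst.
apply: cvgV; first by rewrite addr0 expf_neq0.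
by apply: cvgD; [exact: cvg_cst|exact: cvg_harmonic].
Qed.

Lemma measurable_divr d (T : measurableType d) (f g : T -> R) :
  measurable_fun setT f -> measurable_fun setT g -> measurable_fun setT (fun w => f w / g w).
Proof.
move=> mf mg; apply: measurable_funM => //; exact: measurableT_comp measurable_invr mg.
Qed.

Lemma integral_cst_itv (a b c : R) : a <= b ->
  (\int[@lebesgue_measure R]_(x in `[a, b]) c%:E = (c * (b - a))%:E)%E.
Proof.
move=> ab; rewrite integral_cst//= lebesgue_measure_itv/= lte_fin EFinM; congr (_ * _)%E.
by move: ab; rewrite le_eqVlt => /predU1P[->|->//]; rewrite ltxx subrr.
Qed.

End measurability.

(** * Exchanging identically distributed variables *)

Section identically_distributed.
Context d (T : measurableType d) (R : realType) (P : probability T R).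
Variable eps : int -> {RV P >-> R}.
Hypothesis eps_ident : identically_distributed eps.

Lemma ge0_integral_ident i j (h : R -> \bar R) : measurable_fun setT h ->
  (forall x, 0 <= h x)%E -> (\int[P]_w h (eps i w) = \int[P]_w h (eps j w))%E.
Proof.
move=> mh h0.
rewrite -(@ge0_integral_distribution _ _ _ _ _ P (eps i) h mh h0).
rewrite -(@ge0_integral_distribution _ _ _ _ _ P (eps j) h mh h0).
by apply: eq_measure_integral => A mA _; first [exact: eps_ident|exact/esym/eps_ident].
Qed.

Lemma integral_ident i j (h : R -> R) : measurable_fun setT h ->
  (\int[P]_w (h (eps i w))%:E = \int[P]_w (h (eps j w))%:E)%E.
Proof.
move=> mh; rewrite integralE [RHS]integralE.
have p k w : (fun w => (h (eps k w))%:E)^\+%E w = ((EFin \o h)^\+ (eps k w))%E.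
  by rewrite !funeposE.
have n k w : (fun w => (h (eps k w))%:E)^\-%E w = ((EFin \o h)^\- (eps k w))%E.
  by rewrite !funenegE.
under eq_integral do rewrite p.
under [X in (_ - X)%E]eq_integral do rewrite n.
under [X in (_ = X - _)%E]eq_integral do rewrite p.
under [X in (_ = _ - X)%E]eq_integral do rewrite n.
have mhE : measurable_fun setT (EFin \o h) by exact/measurable_EFinP.
congr (_ - _)%E; apply: ge0_integral_ident.
- exact: measurable_funepos.
- by move=> x; exact: funepos_ge0.
- exact: measurable_funeneg.
- by move=> x; exact: funeneg_ge0.
Qed.

Lemma Rintegral_ident i j (h : R -> R) : measurable_fun setT h ->
  \int[P]_w h (eps i w) = \int[P]_w h (eps j w).
Proof. by move=> mh; congr fine; exact: integral_ident. Qed.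

End identically_distributed.

(** * Weighted sums of noise *)

Section martingale_differences.
Context d (T : measurableType d) (R : realType) (P : probability T R).
Variable eps : int -> {RV P >-> R}.
Hypothesis eps_indep : mutually_independent eps.

Lemma info_decouple_event J k : ~ J k ->
  forall (A : set (info eps J)) (B : set R), measurable A -> measurable B ->
  P (id @^-1` A `&` eps k @^-1` B) = (P (id @^-1` A) * P (eps k @^-1` B))%E.
Proof.
move=> Jk A B mA mB.
apply: (@info_independent _ _ _ _ _ eps_indep _ _ _ _ J [set k]) => //.
- by move=> i Ji /= ik; apply: Jk; rewrite -ik.
- exact: (@info_eps _ _ _ P eps [set k] k).
Qed.

(** Stands in for conditioning on the noise in [J]: the first argument is frozen and the independent
    [eps k] is averaged out. *)
Lemma info_ge0_decouple J k (H : T * R -> \bar R) : ~ J k ->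
  measurable_fun setT (H : info eps J * R -> \bar R) -> (forall x, 0 <= H x)%E ->
  (\int[P]_w H (w, eps k w) = \int[P]_w \int[P]_w' H (w, eps k w'))%E.
Proof.
move=> Jk mH H0.
exact (@ge0_integral_decouple _ _ _ P _ _ (info eps J) R id (eps k)
  (@info_id _ _ _ P eps J) (measurable_funPT (eps k)) (info_decouple_event Jk) H mH H0).
Qed.

Lemma info_decouple J k (H : T * R -> \bar R) : ~ J k ->
  measurable_fun setT (H : info eps J * R -> \bar R) ->
  P.-integrable setT (fun w => H (w, eps k w)) ->
  (\int[P]_w H (w, eps k w) = \int[P]_w \int[P]_w' H (w, eps k w'))%E.
Proof.
move=> Jk mH iH.
exact (@integral_decouple _ _ _ P _ _ (info eps J) R id (eps k)
  (@info_id _ _ _ P eps J) (measurable_funPT (eps k)) (info_decouple_event Jk) H mH iH).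
Qed.

Lemma square_sum_orthogonal (D : nat -> T -> R) m : (forall i, square_integrable P (D i)) ->
  (forall m, \int[P]_w ((\sum_(i < m) D i w) * D m w) = 0) ->
  \int[P]_w (\sum_(i < m) D i w) ^+ 2 = \sum_(i < m) \int[P]_w (D i w ^+ 2).
Proof.
move=> sD D0; elim: m => [|m IH].
  rewrite big_ord0; under eq_Rintegral do rewrite big_ord0 expr0n.
  exact: integral_prob_cst.
have sS : square_integrable P (fun w => \sum_(i < m) D i w) by exact: square_integrable_sum.
have [_ iS] := sS; have [_ iD] := sD m.
have iSD := square_integrableM sS (sD m).
rewrite big_ord_recr/= -IH.
transitivity (\int[P]_w ((\sum_(i < m) D i w) ^+ 2 + (2 * ((\sum_(i < m) D i w) * D m w) + D m w ^+ 2))).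
  by apply: eq_Rintegral => w _; rewrite big_ord_recr/=; ring.
have i2 := integrable_scale 2 iSD.
rewrite RintegralD//; last exact: (integrableD measurableT i2 iD).
by rewrite RintegralD// RintegralZl// D0 mulr0 add0r.
Qed.

Variables (J : nat -> set int) (k : nat -> int) (H : nat -> T * R -> R).
Hypothesis Jk : forall m, ~ J m (k m).
Hypothesis JS : forall m, J m `<=` J m.+1.
Hypothesis kS : forall m, J m.+1 (k m).
Hypothesis mH : forall m, measurable_fun setT (H m : info eps (J m) * R -> R).
Hypothesis iH : forall m w, P.-integrable setT (EFin \o (fun w' => H m (w, eps (k m) w'))).
Hypothesis H0 : forall m w, \int[P]_w' H m (w, eps (k m) w') = 0.
Let D m w := H m (w, eps (k m) w).
Hypothesis sD : forall m, square_integrable P (D m).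

(** Here [J] is a filtration, [k m] the index of the noise revealed at step [m], and [H m (w, e)] an
    increment that depends on the past [w] and on the new noise [e]. *)
Lemma martingale_difference_info m : measurable_fun setT (D m : info eps (J m.+1) -> R).
Proof.
have m1 : measurable_fun setT (id : info eps (J m.+1) -> info eps (J m)).
  exact: (@info_subset _ _ _ P eps _ (info eps (J m)) (J m) (J m.+1) id).
have m2 := @info_eps _ _ _ P eps (J m.+1) (k m) (@kS m).
exact (measurableT_comp (@mH m) (measurable_fun_pair m1 m2)).
Qed.

Lemma info_subset_le m n : (m <= n)%N -> J m `<=` J n.
Proof.
elim: n => [|n IH]; first by rewrite leqn0 => /eqP ->.
by rewrite leq_eqVlt => /predU1P[->//|/IH mn]; exact: subset_trans mn (@JS n).
Qed.

Lemma martingale_sum_info m :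
  measurable_fun setT ((fun w => \sum_(i < m) D i w) : info eps (J m) -> R).
Proof.
apply: measurable_sum => i.
apply: (@info_subset _ _ _ P eps _ _ (J i.+1)); last exact: martingale_difference_info.
exact: info_subset_le.
Qed.

(** Cross terms vanish: the sum of the earlier increments is measurable for the past, so freezing
    the past in its product with [D m] leaves the zero mean of [H m]. *)
Lemma martingale_square_sum m :
  \int[P]_w (\sum_(i < m) D i w) ^+ 2 = \sum_(i < m) \int[P]_w (D i w ^+ 2).
Proof.
apply: square_sum_orthogonal => // {}m.
pose S w := \sum_(i < m) D i w.
have sS : square_integrable P S by exact: square_integrable_sum.
have mSH : measurable_fun setT ((fun x => (S x.1 * H m x)%:E) : info eps (J m) * R -> \bar R).
  apply/measurable_EFinP; apply: measurable_funM => //.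
  exact (measurableT_comp (@martingale_sum_info m) measurable_fst).
have := info_decouple (@Jk m) mSH (square_integrableM sS (sD m)).
rewrite /= /Rintegral => ->.
rewrite integral0_eq// => w _.
under eq_integral do rewrite EFinM.
rewrite integralZl; [|exact: measurableT|exact: (iH m w)].
by rewrite -EFin_Rintegral ?H0 ?mule0//; exact: iH.
Qed.

End martingale_differences.

Section weighted_sums.
Context d (T : measurableType d) (R : realType) (P : probability T R).
Variables (eps : int -> {RV P >-> R}).
Hypothesis eps_indep : mutually_independent eps.
Hypothesis eps_ident : identically_distributed eps.
Local Notation N01 := (normal_prob (0 : R) 1).

Variables (J : nat -> set int) (k : nat -> int) (psi : R -> R) (sigma : R) (w : nat -> R).
Hypothesis Jk : forall m, ~ J m (k m).
Hypothesis JS : forall m, J m `<=` J m.+1.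
Hypothesis kS : forall m, J m.+1 (k m).
Hypothesis mpsi : measurable_fun setT psi.
Hypothesis sigma0 : 0 <= sigma.
Hypothesis psi_sq : forall i, square_integrable P (fun t => psi (eps i t)).
Hypothesis psi_mean : forall i, \int[P]_t psi (eps i t) = 0.
Hypothesis psi_var : forall i, \int[P]_t (psi (eps i t) ^+ 2) = sigma ^+ 2.

Let mpe m : measurable_fun setT (fun t => psi (eps (k m) t)).
Proof. exact: measurableT_comp. Qed.

Let mterm m : measurable_fun setT ((fun x => w m * psi x.2) : info eps (J m) * R -> R).
Proof.
by apply: measurable_funM => //; exact: (measurableT_comp mpsi measurable_snd).
Qed.

Let S m t := \sum_(i < m) w i * psi (eps (k i) t).

Lemma weighted_sum_info m : measurable_fun setT (S m : info eps (J m) -> R).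
Proof.
exact (@martingale_sum_info _ _ _ P eps J k (fun m x => w m * psi x.2) JS kS mterm m).
Qed.

Lemma weighted_sum_second_moment m :
  \int[P]_t (S m t ^+ 2) = sigma ^+ 2 * \sum_(i < m) w i ^+ 2.
Proof.
have ipsi i : P.-integrable setT (EFin \o (fun t => psi (eps i t))).
  exact: square_integrable1.
have := @martingale_square_sum _ _ _ P eps eps_indep J k (fun m x => w m * psi x.2)
  Jk JS kS mterm _ _ _ m.
rewrite /= => ->.
- rewrite mulr_sumr; apply: eq_bigr => i _.
  under eq_Rintegral do rewrite exprMn.
  by rewrite RintegralZl//; [rewrite psi_var mulrC|case: (psi_sq (k i))].
- by move=> i _; exact: integrable_scale.
- by move=> i _; rewrite RintegralZl// psi_mean mulr0.
- by move=> i; exact: square_integrableZ.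
Qed.

(** Supplies the replacement argument with its independence hypothesis: the new noise is decoupled
    from the partial sum and then exchanged for [eps (k 0)], which has the same law. *)
Lemma weighted_sum_decouple m M K h : bounded_lipschitz M K h ->
  \int[P]_t h (S m t + w m * psi (eps (k m) t)) =
  \int[P]_t \int[P]_t' h (S m t + w m * psi (eps (k 0%N) t')).
Proof.
move=> bh; have [hM _] := bh; have mh := bounded_lipschitz_measurable bh.
have mS := info_measurable (@weighted_sum_info m).
have UV (A B : set R) : measurable A -> measurable B ->
    P (S m @^-1` A `&` eps (k m) @^-1` B) = (P (S m @^-1` A) * P (eps (k m) @^-1` B))%E.
  move=> mA mB; apply: (@info_independent _ _ _ _ _ eps_indep _ _ _ _ (J m) [set k m]) => //.
  - by move=> i Ji /= ik; apply: (@Jk m); rewrite -ik.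
  - exact: weighted_sum_info.
  - exact: (@info_eps _ _ _ P eps [set k m] (k m)).
have mH : measurable_fun setT (fun x : R * R => h (x.1 + w m * psi x.2)).
  apply: (measurableT_comp mh); apply: measurable_funD => //.
  by apply: measurable_funM => //; exact: (measurableT_comp mpsi measurable_snd).
have := @Rintegral_decouple _ _ _ P _ _ R R (S m) (eps (k m)) mS
  (measurable_funPT (eps (k m))) UV (fun x => h (x.1 + w m * psi x.2)) M mH (fun x => hM _).
rewrite /= => ->; apply: eq_Rintegral => t _.
apply: (@Rintegral_ident _ _ _ P eps eps_ident (k m) (k 0%N) (fun e => h (S m t + w m * psi e))).
by apply: (measurableT_comp mh); apply: measurable_funD => //; exact: measurable_funM.
Qed.

Definition sum_error w0 := lindeberg_error P (fun m t => psi (eps (k m) t)) sigma w0.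

Lemma weighted_sum_clt w0 s M K g m : (forall i, 0 <= w i <= w0) -> 0 < s -> bounded_lipschitz M K g ->
  `|\int[P]_t g (S m t) - \int[N01]_z g (sigma * Num.sqrt (\sum_(i < m) w i ^+ 2) * z)| <=
    4 * K * s + (8 * M + 4 * K) / s ^+ 2 * (\sum_(i < m) w i ^+ 2) * sum_error w0.
Proof.
move=> w_itv s0 bg.
exact: (@bounded_lipschitz_clt _ _ _ P (fun m t => psi (eps (k m) t)) sigma w w0
  (psi_sq _) mpe sigma0 (psi_mean _) (psi_var _) w_itv weighted_sum_decouple s M K g m s0 bg).
Qed.

End weighted_sums.

(** The two filtrations in use. [upto m] is all noise through time [m], with [m + 1] revealed next;
    [between m] is a window of past noise that grows backwards in time, with [- m] revealed next,
    and serves for the partial sums that define the initial value. *)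
Definition upto (m : nat) : set int := [set i | (i <= m%:Z)%R].
Definition between (m : nat) : set int := [set i | (- m%:Z < i)%R && (i <= 0)%R].

Lemma upto_notin m : ~ upto m m.+1%:Z.
Proof. by rewrite /upto/=; lia. Qed.

Lemma uptoS m : upto m `<=` upto m.+1.
Proof. by move=> i; rewrite /upto/=; lia. Qed.

Lemma uptoSin m : upto m.+1 m.+1%:Z.
Proof. by rewrite /upto/=. Qed.

Lemma between_notin m : ~ between m (- m%:Z).
Proof. by rewrite /between/=; lia. Qed.

Lemma betweenS m : between m `<=` between m.+1.
Proof. by move=> i; rewrite /between/=; lia. Qed.

Lemma betweenSin m : between m.+1 (- m%:Z).
Proof. by rewrite /between/=; lia. Qed.

Lemma between_upto0 m : between m `<=` upto 0.
Proof. by move=> i; rewrite /upto /between/=; lia. Qed.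

Lemma upto0_subset m : upto 0 `<=` upto m.
Proof. by move=> i; rewrite /upto/=; lia. Qed.

Lemma sum_integrable d (T : measurableType d) (R : realType) (P : probability T R)
    (X : nat -> T -> R) : (forall i, P.-integrable setT (EFin \o X i)) -> forall n,
  P.-integrable setT (EFin \o (fun w => \sum_(i < n) X i w)) /\
  \int[P]_w `|\sum_(i < n) X i w| <= \sum_(i < n) \int[P]_w `|X i w|.
Proof.
move=> iX; elim=> [|n [iS IH]].
  under eq_fun do rewrite big_ord0.
  split; first exact: finite_measure_integrable_cst.
  rewrite big_ord0; under eq_Rintegral do rewrite big_ord0 normr0.
  by rewrite (integral_prob_cst P).
have i1 : P.-integrable setT (EFin \o (fun w => \sum_(i < n.+1) X i w)).
  under eq_fun do rewrite big_ord_recr/=.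
  exact: (integrableD measurableT iS (iX n)).
split => //; rewrite big_ord_recr/= (le_trans _ (lerD IH (lexx _)))//.
rewrite -RintegralD//; [|exact: integrable_norm..].
apply: le_Rintegral => //; first exact: integrable_norm.
  exact: (integrableD measurableT (integrable_norm iS) (integrable_norm (iX n))).
by move=> w _; rewrite big_ord_recr/= ler_normD.
Qed.

(** * Tight and vanishing sequences *)

Section tightness.
Context d (T : measurableType d) (R : realType) (P : probability T R).

Lemma tight_L2 (X : nat -> T -> R) C : (forall n, square_integrable P (X n)) ->
  (forall n, \int[P]_w (X n w ^+ 2) <= C) -> tight P X.
Proof.
move=> sX XC; split => [n|e e0]; first by case: (sX n).
have C0 : 0 <= C.
  by apply: le_trans (XC 0%N); apply: Rintegral_ge0 => w _; exact: sqr_ge0.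
have K0 : 0 < (C + 1) / e by rewrite divr_gt0// ltr_wpDl.
exists (Num.sqrt ((C + 1) / e)); first by rewrite sqrtr_gt0.
apply: nearW => n.
rewrite (_ : [set w | _] = [set w | (C + 1) / e <= X n w ^+ 2]); last first.
  apply/seteqP; split => w /=; rewrite -sqrtr_sqr ler_sqrt// sqr_ge0//.
rewrite (le_trans (pr_markov (X := fun w => X n w ^+ 2) _ _ K0))//.
- by case: (sX n).
- by move=> w; exact: sqr_ge0.
- rewrite ler_pdivrMr// mulrCA divff ?gt_eqF// mulr1 (le_trans (XC n))// lerDl//.
Qed.

Lemma tight_norm_exp (X : nat -> T -> R) k : tight P X -> tight P (fun n w => `|X n w| ^+ k.+1).
Proof.
move=> [mX tX]; split => [n|e e0].
  by apply: measurable_funX; exact: measurableT_comp.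
have [K K0 HK] := tX e e0; exists (K ^+ k.+1); first by rewrite exprn_gt0.
apply: filterS HK => n; apply: le_trans.
have mXk : measurable_fun setT (fun w => `|X n w| ^+ k.+1).
  by apply: measurable_funX; exact: measurableT_comp.
apply: le_pr; [exact: measurable_norm_ge..|].
by move=> w /=; rewrite normrX normr_id ler_pXn2r// nnegrE// ltW.
Qed.

Lemma negligible_in_prob_cst (b : nat -> R) : b n @[n --> \oo] --> (0 : R) ->
  negligible_in_prob P (fun n _ => b n).
Proof.
move=> b0; split => // c e c0 e0.
have c2 : 0 < c / 2 by rewrite divr_gt0.
move/cvgrPdist_le : b0 => /(_ _ c2); apply: filterS => n; rewrite sub0r normrN => bn.
rewrite (_ : [set _ | _] = set0); first by rewrite /pr measure0 ltW.
by apply/seteqP; split => // w /=; lra.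
Qed.

End tightness.

Section limits.
Context (R : realType).

Lemma cvg_invr_nat : (n%:R : R)^-1 @[n --> \oo] --> (0 : R).
Proof. by rewrite -(cvg_shiftS (fun n => n%:R^-1 : R)); exact: cvg_harmonic. Qed.

Lemma cvg_invr_sqrt_nat : (Num.sqrt (n%:R : R))^-1 @[n --> \oo] --> (0 : R).
Proof.
rewrite (_ : (fun n => _) = (fun n => Num.sqrt ((n%:R : R)^-1))); last first.
  by apply/funext => n; rewrite sqrtrV.
rewrite -[X in _ --> X]sqrtr0.
exact: (cvg_comp _ _ cvg_invr_nat (@sqrt_continuous R 0)).
Qed.

End limits.

(** * Argmin of a convex loss *)

Section argmin_convergence.
Context d (T : measurableType d) (R : realType) (P : probability T R).

Lemma le_pr_ae (A D : set T) : measurable A -> measurable D ->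
  {ae P, forall w, A w -> D w} -> pr P A <= pr P D.
Proof.
move=> mA mD AD; rewrite (@pr_ae_eq _ _ _ P A (A `&` D))//; last 2 first.
- exact: measurableI.
- by apply: filterS AD => w H; split=> [Aw|[]//]; split => //; exact: H.
by apply: le_pr => //; exact: measurableI.
Qed.

Lemma pr_finite_union_le (F : nat -> set T) (b : R) m : (forall j, measurable (F j)) ->
  (forall j, (j < m)%N -> pr P (F j) <= b) ->
  measurable [set w | exists2 j, (j < m)%N & F j w] /\
  pr P [set w | exists2 j, (j < m)%N & F j w] <= m%:R * b.
Proof.
move=> mF; elim: m => [|m IH] Fb.
  rewrite (_ : [set _ | _] = set0); last by apply/seteqP; split => // w [].
  by rewrite mul0r /pr measure0.
have [|mU Ub] := IH; first by move=> j jm; apply: Fb; exact: ltnW.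
have E : [set w | exists2 j, (j < m.+1)%N & F j w] = [set w | exists2 j, (j < m)%N & F j w] `|` F m.
  apply/seteqP; split => w /=.
    move=> [j]; rewrite ltnS leq_eqVlt => /predU1P[->|jm] Fj; first by right.
    by left; exists j.
  by move=> [[j jm Fj]|Fm]; [exists j => //; exact: ltnW|exists m].
rewrite E; split; first exact: measurableU.
have mUF := measurableU _ _ mU (mF m).
by rewrite (le_trans (le_prU P mUF mU (mF m) (subset_refl _)))// -natr1 mulrDl mul1r lerD// Fb.
Qed.

Lemma near_forall_lt (Q : nat -> nat -> Prop) m : (forall j, \forall n \near \oo, Q j n) ->
  \forall n \near \oo, forall j, (j < m)%N -> Q j n.
Proof.
move=> HQ; elim: m => [|m IH]; first exact: nearW.
near=> n => j; rewrite ltnS leq_eqVlt => /predU1P[->|jm].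
  by near: n; exact: HQ.
by move: jm; move: j; near: n.
Unshelve. all: by end_near. Qed.

(* a decreasing curve [s] within [2 c eta^2 h] of [t |-> 2 c a^2 (u - t)] on a grid of mesh [h]
   cannot change sign further than [3 h] away from [u] *)
Lemma sign_change_near (c h eta K a u th : R) (s : R -> R) N :
  0 < c -> 0 < h -> 0 < eta -> eta < `|a| -> `|u| < K -> K / h + 1 < N%:R ->
  (forall t, 0 <= (th - t) * s t) ->
  (forall j, (j < N + N + 3)%N -> let t := h * (j%:R - N%:R) in
     `|s t - 2 * c * a ^+ 2 * (u - t)| < 2 * c * eta ^+ 2 * h) ->
  `|th - u| < 3 * h.
Proof.
move=> c0 h0 eta0 a_eta uK KN sth grid_s; rewrite ltNge; apply/negP => Hd.
have aa : eta ^+ 2 <= a ^+ 2.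
  by rewrite -[leRHS]real_normK ?num_real// lerXn2r ?nnegrE// ltW.
have far v : h <= v -> 2 * c * eta ^+ 2 * h <= 2 * c * a ^+ 2 * v.
  have cc : 0 <= 2 * c by rewrite mulr_ge0// ltW.
  move=> hv; apply: ler_pM => //; [by rewrite mulr_ge0 ?sqr_ge0|exact: ltW|].
  exact: ler_wpM2l.
have [uhl uhr] : - (K / h) < u / h /\ u / h < K / h.
  move: uK; rewrite ltr_norml => /andP[u1 u2].
  by rewrite -mulNr !ltr_pM2r ?invr_gt0.
(* [x] is the position of [u] in grid units and [k] its integer part; the bound on [N] leaves room
   for the indices [k - 1] and [k + 2]. *)
pose x := u / h + N%:R.
have ux : u = h * (x - N%:R) by rewrite /x; field; rewrite gt_eqF.
have x1 : 1 <= x by rewrite /x; lra.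
have x0 : 0 <= x by lra.
have xN : x < N%:R + N%:R by rewrite /x; lra.
have /andP[kx xk] := truncn_itv x0; move: kx xk; set k := Num.truncn x => kx xk.
have kN : (k < N + N)%N by rewrite -(ltr_nat R) natrD; apply: le_lt_trans kx xN.
have k1 : (0 < k)%N by rewrite -ltnS -(ltr_nat R); apply: le_lt_trans x1 xk.
rewrite -natr1 in xk.
have h3 : 3 * h = h * 3 by ring.
move: Hd; rewrite ler_normr => /orP[Hd|Hd].
(* When [th >= u + 3 h], the grid point of index [k + 2] lies between [u + h] and [u + 2 h], hence
   to the left of [th]. The sign condition then gives [s t >= 0], while the linear curve is at most
   [- 2 c eta^2 h] there. The other case mirrors this with index [k - 1]. *)
- have jm : (k.+2 < N + N + 3)%N by rewrite addn3 !ltnS ltnW.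
  have kj : k.+2%:R = k%:R + 2 :> R by rewrite -addn2 natrD.
  have := grid_s _ jm; set t := h * _ => /= Hs.
  have tu : h <= t - u by rewrite ux /t kj -mulrBr ler_peMr// ?(ltW h0)//; lra.
  have tth : t < th.
    have : t <= u + 2 * h.
      rewrite ux /t kj (_ : h * (x - N%:R) + 2 * h = h * (x - N%:R + 2)); last by ring.
      by rewrite ler_pM2l//; lra.
    by lra.
  have := sth t; rewrite pmulr_rge0 ?subr_gt0// => s0.
  have := far _ tu; have := ltr_normlW Hs; rewrite -[u - t]opprB mulrN; lra.
- have jm : (k.-1 < N + N + 3)%N.
    by rewrite (leq_ltn_trans (leq_pred _))// (ltn_trans kN)// -{1}(addn0 (N + N)%N) ltn_add2l.
  have kj : k.-1%:R = k%:R - 1 :> R by rewrite -subn1 natrB.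
  have := grid_s _ jm; set t := h * _ => /= Hs.
  have tu : h <= u - t by rewrite ux /t kj -mulrBr ler_peMr// ?(ltW h0)//; lra.
  have tth : th < t.
    have : u - 2 * h <= t.
      rewrite ux /t kj (_ : h * (x - N%:R) - 2 * h = h * (x - N%:R - 2)); last by ring.
      by rewrite ler_pM2l//; lra.
    by lra.
  have := sth t; rewrite nmulr_rge0 ?subr_lt0// => s0.
  have := far _ tu; have := Hs; rewrite ltr_norml => /andP[]; lra.
Qed.

Variables (A B U that : nat -> T -> R) (S : R -> nat -> T -> R) (c : R).
Hypothesis c0 : 0 < c.
Hypothesis mA : forall n, measurable_fun setT (A n).
Hypothesis mthat : forall n, measurable_fun setT (that n).
Hypothesis tU : tight P U.
Hypothesis AU : forall n w, A n w != 0 -> B n w = 2 * c * A n w * U n w.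
Hypothesis small_ball : forall e, 0 < e ->
  exists2 eta, 0 < eta & \forall n \near \oo, pr P [set w | `|A n w| <= eta] <= e.
Hypothesis S_approx : forall t, negligible_in_prob P
  (fun n w => S t n w - A n w * (B n w - 2 * c * t * A n w)).
Hypothesis S_argmin : forall n, (0 < n)%N ->
  {ae P, forall w, forall t, 0 <= (that n w - t) * S t n w}.

(** Where [A] is nonzero, [A (B - 2 c t A)] equals [2 c A^2 (U - t)], so [sign_change_near] applies
    off three bad events: [A] close to 0, [U] large, a deviation of [S] at some grid point. The grid
    is finite and fixed before [n], so approximation at each single [t] is enough. *)
Lemma argmin_negligible : negligible_in_prob P (fun n w => that n w - U n w).
Proof.
have [mU tU'] := tU.
have mD n : measurable_fun setT (fun w => that n w - U n w) by exact: measurable_funB.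
split => // dl e dl0 e0.
have e3 : 0 < e / 3 by rewrite divr_gt0.
have [eta eta0 Heta] := small_ball e3.
have [K K0 HK] := tU' _ e3.
(* The sign change is located up to [3 h], and [g] below is the size of the limiting curve at
   distance [h] from its zero when [|A| = eta]. *)
pose h := dl / 3; have h0 : 0 < h by rewrite divr_gt0.
pose N := (Num.truncn (K / h)).+2; pose m := (N + N + 3)%N.
pose grid j : R := h * (j%:R - N%:R).
pose g := 2 * c * eta ^+ 2 * h; have g0 : 0 < g by rewrite !mulr_gt0// exprn_gt0.
pose dev t n w := S t n w - A n w * (B n w - 2 * c * t * A n w).
have mdev t n : measurable [set w | g <= `|dev t n w|].
  by have [mt _] := S_approx t; exact: (measurable_norm_ge _ (mt n)).
have em : 0 < e / 3 / m.+1%:R by rewrite divr_gt0.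
have Hdev := near_forall_lt m (fun j => (S_approx (grid j)).2 g _ g0 em).
near=> n.
have n0 : (0 < n)%N by near: n; exact: nbhs_infty_gt.
have Fb0 : forall j, (j < m)%N -> pr P [set w | g <= `|dev (grid j) n w|] <= e / 3 / m.+1%:R.
  by near: n; exact: Hdev.
have Pr1 : pr P [set w | `|A n w| <= eta] <= e / 3 by near: n; exact: Heta.
have Pr2 : pr P [set w | K <= `|U n w|] <= e / 3 by near: n; exact: HK.
pose F j := [set w | g <= `|dev (grid j) n w|].
have [mF Fb] := pr_finite_union_le (fun j => mdev (grid j) n) Fb0.
pose E1 := [set w | `|A n w| <= eta]; pose E2 := [set w | K <= `|U n w|].
have mE1 : measurable E1.
  rewrite -[X in measurable X]setTI; apply: measurable_fun_le => //.
  exact: measurableT_comp.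
have mE2 : measurable E2 by exact: measurable_norm_ge.
have mE12 := measurableU _ _ mE1 mE2.
have mE := measurableU _ _ mE12 mF.
apply: (@le_trans _ _ (pr P (E1 `|` E2 `|` [set w | exists2 j, (j < m)%N & F j w]))).
  apply: le_pr_ae => //; first exact: measurable_norm_ge.
  apply: filterS (S_argmin n0) => w Hw /= Hd; apply: contrapT => nE.
  have A1 : eta < `|A n w| by rewrite ltNge; apply/negP => ?; apply: nE; left; left.
  have U1 : `|U n w| < K by rewrite ltNge; apply/negP => ?; apply: nE; left; right.
  have An0 : A n w != 0 by rewrite -normr_gt0 (lt_trans eta0).
  have := @sign_change_near c h eta K (A n w) (U n w) (that n w) (fun t => S t n w) N c0 h0 eta0 A1 U1.
  have KN : K / h + 1 < N%:R.
    have /andP[_ Kh] := truncn_itv (ltW (divr_gt0 K0 h0)).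
    by rewrite /N -[X in _ < X]natr1 ltrD2r.
  move=> /(_ KN Hw) H; suff : `|that n w - U n w| < 3 * h by rewrite /h; lra.
  apply: H => j jm /=; rewrite ltNge; apply/negP => H; apply: nE; right; exists j => //.
  rewrite /F /= /dev (AU An0) (le_trans H)// le_eqVlt; apply/orP; left; apply/eqP.
  by rewrite /grid; congr (`|_|); ring.
rewrite (le_trans (le_prU P mE mE12 mF (subset_refl _)))//.
have -> : e = e / 3 + e / 3 + e / 3 by field.
apply: lerD.
  by rewrite (le_trans (le_prU P mE12 mE1 mE2 (subset_refl _)))// lerD.
rewrite (le_trans Fb)// mulrCA ler_piMr ?(ltW e3)// ler_pdivrMr// mul1r ler_nat.
exact: leqnSn.
Unshelve. all: by end_near. Qed.

End argmin_convergence.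

(** * Small balls of the Gaussian law *)

Section gaussian_events.
Context (R : realType).
Local Notation N01 := (normal_prob (0 : R) 1).

Lemma norm_le_itv (b : R) : [set z : measurableTypeR R | `|z| <= b] = `[- b, b]%classic.
Proof. by apply/seteqP; split => z /=; rewrite in_itv/= ler_norml. Qed.

Lemma gaussian_small_ball (b : R) : 0 <= b ->
  pr N01 [set z : measurableTypeR R | `|z| <= b] <= 2 * normal_peak 1 * b.
Proof.
move=> b0.
have E := norm_le_itv b.
have mE : measurable [set z : measurableTypeR R | `|z| <= b] by rewrite E.
rewrite -lee_fin EFin_pr// E.
rewrite [leLHS](_ : _ = \int[lebesgue_measure]_(x in `[(- b)%R, b%R]) (normal_pdf 0 1 x)%:E)%E//.
apply: (@le_trans _ _ (\int[lebesgue_measure]_(x in `[(- b)%R, b%R]) (cst (normal_peak 1)%:E x))%E).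
  apply: ge0_le_integral => //.
  - by move=> x _; rewrite lee_fin normal_pdf_ge0.
  - by apply/measurable_EFinP; apply: measurable_funTS; exact: measurable_normal_pdf.
  - by move=> x _; rewrite lee_fin normal_pdf_ub// oner_neq0.
rewrite integral_cst//= lebesgue_measure_itv/= lte_fin -EFinD.
have k0 := @normal_peak_ge0 R 1.
case: ifPn => _; last by rewrite mule0 lee_fin mulr_ge0// mulr_ge0.
by rewrite -EFinM lee_fin opprK mulrDr; lra.
Qed.

End gaussian_events.

(** * Central limit bounds uniform in the weights *)

Section weighted_clt.
Context d (T : measurableType d) (R : realType) (P : probability T R).
Local Notation N01 := (normal_prob (0 : R) 1).

Lemma cvg_Rintegral_bounded_lipschitz M K g (X : nat -> T -> R) (Y : T -> R) : bounded_lipschitz M K g ->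
  (forall n, measurable_fun setT (X n)) -> measurable_fun setT Y ->
  {ae P, forall w, X n w @[n --> \oo] --> Y w} ->
  \int[P]_w g (X n w) @[n --> \oo] --> \int[P]_w g (Y w).
Proof.
move=> bg mX mY XY; have [gM _] := bg.
have mg := bounded_lipschitz_measurable bg.
have iX n := integrable_bounded_lipschitz P (mX n) bg.
have iY := integrable_bounded_lipschitz P mY bg.
have iM : P.-integrable setT (cst M%:E) by exact: finite_measure_integrable_cst.
have fcv : {ae P, forall w, setT w -> (g (X n w))%:E @[n --> \oo] --> (g (Y w))%:E}.
  apply: filterS XY => w h _; apply: cvg_EFin; first exact: nearW.
  have gc := cvg_comp _ _ h (bounded_lipschitz_continuous bg (x := Y w)).
  exact gc.
have fdom : {ae P, forall w n, setT w -> (`|(g (X n w))%:E| <= cst M%:E w)%E}.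
  by apply: aeW => w n _ /=; rewrite lee_fin.
have [_ _ H] := @dominated_convergence _ _ _ P setT measurableT (fun n w => (g (X n w))%:E)
  (fun w => (g (Y w))%:E) (cst M%:E) (fun n => measurable_int _ (iX n)) (measurable_int _ iY)
  fcv iM fdom.
rewrite -EFin_Rintegral// in H.
by have /fine_cvgP[_] := H.
Qed.

Variables (eps : int -> {RV P >-> R}).
Hypothesis eps_indep : mutually_independent eps.
Hypothesis eps_ident : identically_distributed eps.
Variables (J : nat -> set int) (k : nat -> int) (psi : R -> R) (sigma : R).
Hypothesis Jk : forall m, ~ J m (k m).
Hypothesis JS : forall m, J m `<=` J m.+1.
Hypothesis kS : forall m, J m.+1 (k m).
Hypothesis mpsi : measurable_fun setT psi.
Hypothesis sigma0 : 0 <= sigma.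
Hypothesis psi_sq : forall i, square_integrable P (fun t => psi (eps i t)).
Hypothesis psi_mean : forall i, \int[P]_t psi (eps i t) = 0.
Hypothesis psi_var : forall i, \int[P]_t (psi (eps i t) ^+ 2) = sigma ^+ 2.

Lemma sum_error_small e : 0 < e ->
  exists2 a, 0 < a & forall w0, 0 <= w0 <= a -> sum_error eps k psi sigma w0 <= e.
Proof.
move=> e0; have e2 : 0 < e / 2 by rewrite divr_gt0.
have sN : square_integrable N01 (fun z => sigma * z).
  by apply: square_integrableZ; exact: gaussian_square_integrable.
have [a1 a10 H1] := lindeberg_term_small (psi_sq (k 0%N)) e2.
have [a2 a20 H2] := lindeberg_term_small sN e2.
exists (Num.min a1 a2); first by rewrite lt_min a10.
move=> w0 /andP[w00]; rewrite le_min => /andP[w1 w2].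
rewrite [e]splitr /sum_error /lindeberg_error lerD//.
  by rewrite (le_trans _ H1)//; exact: le_lindeberg_term.
by rewrite (le_trans _ H2)//; exact: le_lindeberg_term.
Qed.

(** The smoothing scale [s] is chosen first, so that [4 K s <= e / 2]; then the largest weight is
    made small enough for the Lindeberg error to absorb the constant [C]. The threshold [a] depends
    neither on [g] beyond [M] and [K], nor on the number of terms. *)
Lemma weighted_sum_clt_uniform M K e : 0 <= M -> 0 <= K -> 0 < e ->
  exists2 a, 0 < a & forall w w0 m g, (forall i : nat, 0 <= w i <= w0) -> w0 <= a ->
    \sum_(i < m) w i ^+ 2 <= 1 -> bounded_lipschitz M K g ->
    `|\int[P]_t g (\sum_(i < m) w i * psi (eps (k i) t)) -
      \int[N01]_z g (sigma * Num.sqrt (\sum_(i < m) w i ^+ 2) * z)| <= e.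
Proof.
move=> M0 K0 e0.
pose s := e / (8 * (K + 1)); have s0 : 0 < s by rewrite divr_gt0// mulr_gt0// ltr_wpDl.
pose C := (8 * M + 4 * K) / s ^+ 2.
have C0 : 0 <= C by rewrite divr_ge0 ?sqr_ge0// addr_ge0// mulr_ge0.
have eC : 0 < e / (2 * (C + 1)) by rewrite divr_gt0// mulr_gt0// ltr_wpDl.
have [a a0 Ha] := sum_error_small eC; exists a => // w w0 m g w_itv w0a w1 bg.
have w00 : 0 <= w0 by have /andP[h1 h2] := w_itv 0%N; exact: le_trans h2.
rewrite (le_trans (weighted_sum_clt eps_indep eps_ident Jk JS kS mpsi sigma0 psi_sq psi_mean psi_var m w_itv s0 bg))//.
rewrite -/C [leRHS]splitr lerD//.
  rewrite /s mulrA ler_pdivrMr ?mulr_gt0 ?ltr_wpDl//.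
  by rewrite (_ : e / 2 * (8 * (K + 1)) = 4 * (K + 1) * e); [rewrite ler_wpM2r ?(ltW e0)// ler_wpM2l// lerDl|field].
have err : sum_error eps k psi sigma w0 <= e / (2 * (C + 1)) by apply: Ha; rewrite w00.
have W0 : 0 <= \sum_(i < m) w i ^+ 2 by apply: sumr_ge0 => i _; exact: sqr_ge0.
apply: (@le_trans _ _ (C * 1 * (e / (2 * (C + 1))))).
  apply: (@le_trans _ _ (C * (\sum_(i < m) w i ^+ 2) * (e / (2 * (C + 1))))).
    by rewrite ler_wpM2l// mulr_ge0.
  by rewrite ler_wpM2r ?(ltW eC)// ler_wpM2l.
rewrite mulr1 mulrA ler_pdivrMr ?mulr_gt0 ?ltr_wpDl//.
by rewrite (_ : e / 2 * (2 * (C + 1)) = (C + 1) * e); [rewrite ler_wpM2r ?(ltW e0)// lerDl|field].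
Qed.

End weighted_clt.

Lemma ler_dist_quarters (R : realFieldType) (x y z t v e : R) : `|x - y| <= e / 4 + v ->
  v <= e / 4 -> `|y - z| <= e / 4 -> `|z - t| <= e / 4 -> `|x - t| <= e.
Proof. by rewrite !ler_norml => /andP[? ?] ? /andP[? ?] /andP[? ?]; lra. Qed.

(** Transfers identities known for nonnegative functions to bounded ones: both sides are shifted by
    [M], whose integral is the same on the two probability spaces. *)
Lemma eq_Rintegral_shift (R : realType) d1 (T1 : measurableType d1) (P1 : probability T1 R)
    d2 (T2 : measurableType d2) (P2 : probability T2 R) (X : T1 -> R) (Y : T2 -> R) M :
  P1.-integrable setT (EFin \o X) -> P2.-integrable setT (EFin \o Y) ->
  (\int[P1]_w (X w + M)%:E = \int[P2]_w (Y w + M)%:E)%E ->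
  \int[P1]_w X w = \int[P2]_w Y w.
Proof.
move=> iX iY XY; apply: (@addIr _ M).
have c1 : P1.-integrable setT (EFin \o (cst M)) by exact: finite_measure_integrable_cst.
have c2 : P2.-integrable setT (EFin \o (cst M)) by exact: finite_measure_integrable_cst.
rewrite -[in LHS](integral_prob_cst P1 M) -[in RHS](integral_prob_cst P2 M).
rewrite -(RintegralD measurableT iX c1) -(RintegralD measurableT iY c2).
exact: (congr1 fine XY).
Qed.

(** * Gaussian identities for bounded Lipschitz functions *)

Section gaussian_integrals.
Context (R : realType).
Local Notation N01 := (normal_prob (0 : R) 1).

Lemma Rintegral_normal_oppr M K (g : R -> R) : bounded_lipschitz M K g ->
  \int[N01]_z g (- z) = \int[N01]_z g z.
Proof.
move=> bg; have [gM _] := bg; have mg := bounded_lipschitz_measurable bg.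
have i1 : N01.-integrable setT (EFin \o (fun z : measurableTypeR R => g (- z))).
  exact (integrable_bounded_lipschitz N01 (@oppr_measurable R setT) bg).
have i2 : N01.-integrable setT (EFin \o (fun z : measurableTypeR R => g z)).
  exact (integrable_bounded_lipschitz N01 (@measurable_id _ _ setT) bg).
apply: (eq_Rintegral_shift (M := M) i1 i2).
apply: (@integral_normal_oppr R (fun z => g z + M)); first exact: measurable_funD.
by move=> x; have := gM x; rewrite ler_norml; lra.
Qed.

Lemma gaussian_ratio_bounded_lipschitz M K (h : R -> R) : bounded_lipschitz M K h ->
  measurable_fun [set: measurableTypeR R] (fun x => \int[N01]_z h (z / `|x|)) /\
  \int[N01]_x \int[N01]_z h (z / `|x|) = \int[cauchy_prob]_u h u.
Proof.
move=> bh; have [hM _] := bh; have mh := bounded_lipschitz_measurable bh.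
have ch := bounded_lipschitz_continuous bh.
have hM0 x : 0 <= h x + M by have := hM x; rewrite ler_norml; lra.
have chM : continuous (fun x => h x + M) by move=> x; apply: cvgD; [exact: ch|exact: cvg_cst].
have mdiv (x : R) : measurable_fun [set: measurableTypeR R] (fun z : R => z / `|x|) by exact: measurable_funM.
have ih (x : R) : N01.-integrable setT (EFin \o (fun z : measurableTypeR R => h (z / `|x|))).
  exact (integrable_bounded_lipschitz N01 (mdiv x) bh).
have iM : N01.-integrable setT (EFin \o (cst M)) by exact: finite_measure_integrable_cst.
pose J (x : measurableTypeR R * measurableTypeR R) : \bar R := (h ((x.2 : R) / `|x.1 : R|) + M)%:E.
have mJ : measurable_fun setT J.
  apply/measurable_EFinP; apply: measurable_funD => //; apply: (measurableT_comp mh).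
  by apply: measurable_divr => //; exact: measurableT_comp.
have mG := @measurable_fun_fubini_tonelli_F _ _ _ _ _ N01 _ mJ (fun x => hM0 _ : (0 <= J x)%E).
have GE (x : R) : fubini_F N01 J x = (\int[N01]_z h (z / `|x|) + M)%:E.
  rewrite /fubini_F/= -[in RHS](integral_prob_cst N01 M) -(RintegralD measurableT (ih x) iM).
  rewrite EFin_Rintegral//.
  exact: (integrableD measurableT (ih x) iM).
have mF : measurable_fun [set: measurableTypeR R] (fun x => \int[N01]_z h (z / `|x|)).
  rewrite (_ : (fun x => _) = (fun x => (\int[N01]_z h (z / `|x|) + M) - M)); last first.
    by apply/funext => x; rewrite addrK.
  apply: measurable_funB => //; apply/measurable_EFinP.
  by apply: eq_measurable_fun mG => x _ /=; rewrite GE.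
split => //.
have FM (x : measurableTypeR R) : `|\int[N01]_z h (z / `|x|)| <= M.
  exact: norm_Rintegral_bounded (measurableT_comp mh (mdiv x)) (fun z => hM _).
have iF := bounded_integrable N01 mF FM.
have ihc : cauchy_prob.-integrable setT (EFin \o (fun z : measurableTypeR R => h z)).
  exact (integrable_bounded_lipschitz cauchy_prob (@measurable_id _ _ setT) bh).
apply: (eq_Rintegral_shift (M := M) iF ihc).
rewrite -(gaussian_ratio chM hM0); apply: eq_integral => x _.
by rewrite -GE.
Qed.

End gaussian_integrals.

(** The subgradient inequality [|b| >= |a| + sg a (b - a)] is summed over the residuals at [r] and
    compared with the minimality of the loss at [rh]. The first-order condition thus takes the form
    of a sign change at [rh], whichever minimiser is chosen. *)
Lemma lad_subgradient (R : realType) n (y : nat -> R) rh r : (0 < n)%N -> lad_solution n y rh ->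
  0 <= (rh - r) * \sum_(i < n) y i * Num.sg (y i.+1 - r * y i).
Proof.
move=> n0 /(_ r); rewrite /lad_loss ler_pM2l ?invr_gt0 ?ltr0n// !big_add1/= !big_mkord => H.
have sub (a b : R) : `|a| + Num.sg a * (b - a) <= `|b|.
  rewrite mulrBr -normrEsg addrCA subrr addr0 (le_trans (ler_norm _))// normrM.
  by rewrite ler_piMl// sgr_le1.
have S : \sum_(i < n) `|y i.+1 - r * y i| + (r - rh) * \sum_(i < n) y i * Num.sg (y i.+1 - r * y i) <=
    \sum_(i < n) `|y i.+1 - rh * y i|.
  rewrite mulr_sumr -big_split/=; apply: ler_sum => i _.
  rewrite (le_trans _ (sub (y i.+1 - r * y i) _))// lerD2l le_eqVlt; apply/orP; left; apply/eqP.
  ring.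
have := le_trans S H; rewrite gerDl -opprB mulNr oppr_le0.
by [].
Qed.

Section negligible_sequences.
Context d (T : measurableType d) (R : realType) (P : probability T R).

Lemma negligible_tight (X : nat -> T -> R) : negligible_in_prob P X -> tight P X.
Proof. by move=> [mX pX]; split => // e e0; exists 1 => //; exact: pX. Qed.

(** On the event [|A| > eta] the denominator exceeds [c eta] in absolute value; the complement,
    which contains the zeros of [A], has small probability. *)
Lemma tight_ratio (A B : nat -> T -> R) c : 0 < c -> (forall n, measurable_fun setT (A n)) ->
  (forall e, 0 < e -> exists2 eta, 0 < eta & \forall n \near \oo, pr P [set w | `|A n w| <= eta] <= e) ->
  tight P B -> tight P (fun n w => B n w / (c * A n w)).
Proof.
move=> c0 mA smallA [mB tB].
have mU n : measurable_fun setT (fun w => B n w / (c * A n w)).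
  by apply: measurable_divr => //; exact: measurable_funM.
split => // e e0; have e2 : 0 < e / 2 by rewrite divr_gt0.
have [eta eta0 Heta] := smallA _ e2; have [K K0 HK] := tB _ e2.
have ce0 : 0 < c * eta by exact: mulr_gt0.
exists (K / (c * eta)); first exact: divr_gt0.
near=> n.
have P1 : pr P [set w | `|A n w| <= eta] <= e / 2 by near: n; exact: Heta.
have P2 : pr P [set w | K <= `|B n w|] <= e / 2 by near: n; exact: HK.
have mE : measurable [set w | `|A n w| <= eta].
  rewrite -[X in measurable X]setTI; apply: measurable_fun_le => //.
  exact: measurableT_comp.
have mU' := measurable_norm_ge (K / (c * eta)) (mU n).
rewrite (le_trans (le_prU P mU' mE (measurable_norm_ge K (mB n)) _))//; last by rewrite [leRHS]splitr lerD.
move=> w /= KU; have [Ae|eA] := leP `|A n w| eta; [by left|right].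
have A0 : 0 < `|A n w| by exact: lt_trans eA.
move: KU; rewrite normrM normfV normrM (gtr0_norm c0) ler_pdivlMr ?mulr_gt0//.
apply: le_trans; rewrite mulrAC ler_pdivlMr// ler_wpM2l ?(ltW K0)// ler_wpM2l ?(ltW c0)//.
exact: ltW.
Unshelve. all: by end_near. Qed.

(** With [s = sqrt Q] and [a = |A|], the inequality [|s - a| <= s + a] gives
    [|s - a|^2 <= |Q - A^2|]. *)
Lemma negligible_sqrt (Q A : nat -> T -> R) : (forall n, measurable_fun setT (Q n)) ->
  (forall n, measurable_fun setT (A n)) -> (forall n w, 0 <= Q n w) ->
  negligible_in_prob P (fun n w => Q n w - A n w ^+ 2) ->
  negligible_in_prob P (fun n w => Num.sqrt (Q n w) - `|A n w|).
Proof.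
move=> mQ mA Q0 [mQA pQA].
have ms : measurable_fun setT (Num.sqrt : R -> R).
  by apply: continuous_measurable_fun; exact: sqrt_continuous.
have mX n : measurable_fun setT (fun w => Num.sqrt (Q n w) - `|A n w|).
  by apply: measurable_funB; [exact: measurableT_comp ms (mQ n)|exact: measurableT_comp].
split => // c e c0 e0; apply: filterS (pQA (c ^+ 2) e (exprn_gt0 _ c0) e0) => n.
apply: le_trans; apply: le_pr; [exact: measurable_norm_ge..|].
move=> w /= H; set s := Num.sqrt (Q n w) in H *; set a := `|A n w| in H *.
have s0 : 0 <= s by exact: sqrtr_ge0.
have a0 : 0 <= a by exact: normr_ge0.
have -> : Q n w - A n w ^+ 2 = (s - a) * (s + a).
  by rewrite -[Q n w]sqr_sqrtr// -[A n w ^+ 2]real_normK ?num_real// -/s -/a; ring.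
rewrite normrM expr2 ler_pM ?(ltW c0)// (le_trans H)// (le_trans (ler_normB _ _))//.
by rewrite !ger0_norm ?addr_ge0.
Qed.

End negligible_sequences.

Lemma Rintegral_normal_scale (R : realType) M K (g : R -> R) s : bounded_lipschitz M K g -> 0 < s ->
  \int[normal_prob 0 s]_z g z = \int[normal_prob 0 1]_z g (s * z).
Proof.
move=> bg s0; have [gM _] := bg; have mg := bounded_lipschitz_measurable bg.
have ch : continuous (fun x => g x + M).
  by move=> x; apply: cvgD; [exact: (bounded_lipschitz_continuous bg)|exact: cvg_cst].
have h0 x : 0 <= g x + M by have := gM x; rewrite ler_norml; lra.
have i1 : (normal_prob 0 s).-integrable setT (EFin \o (fun z : measurableTypeR R => g z)).
  exact (integrable_bounded_lipschitz (normal_prob 0 s) (@measurable_id _ _ setT) bg).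
have ms : measurable_fun [set: measurableTypeR R] (fun z : R => s * z) by exact: measurable_funM.
have i2 : (normal_prob 0 1).-integrable setT (EFin \o (fun z : measurableTypeR R => g (s * z))).
  exact (integrable_bounded_lipschitz (normal_prob 0 1) ms bg).
apply: (eq_Rintegral_shift (M := M) i1 i2).
rewrite (integral_normal_affine 0 ch h0 s0).
by apply: eq_integral => z _; rewrite add0r.
Qed.

(** * The nearly unstable autoregression *)

Section autoregression.
Context d (T : measurableType d) (R : realType) (P : probability T R).
Variables (eps : int -> {RV P >-> R}) (sigma : R) (f : R -> R) (M : R).
Hypothesis eps_indep : mutually_independent eps.
Hypothesis eps_ident : identically_distributed eps.
Hypothesis sigma_ge0 : 0 <= sigma.
Hypothesis eps_mean : forall i, ('E_P[eps i] = 0)%E.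
Hypothesis eps_var : forall i, ('V_P[eps i] = (sigma ^+ 2)%:E)%E.
Hypothesis eps_median : is_median 0 (eps 1).
Hypothesis f_density : has_density (eps 1) f.
Hypothesis f_derivable : forall x, derivable f x 1.
Hypothesis f'_bounded : forall x, `|(f^`())%classic x| <= M.
Local Notation mu := (@lebesgue_measure R).
Local Notation N01 := (normal_prob (0 : R) 1).

Lemma noise_second_moment i : (\int[P]_w (eps i w ^+ 2)%:E = (sigma ^+ 2)%:E)%E.
Proof.
have := eps_var i; rewrite /variance unlock eps_mean/= unlock => <-.
by apply: eq_integral => w _; rewrite !fctE/= subr0 expr2.
Qed.

Lemma noise_square_integrable i : square_integrable P (eps i).
Proof.
split => //; apply/integrableP; split.
  by apply/measurable_EFinP; exact: measurable_funX.
under eq_integral do rewrite gee0_abs ?lee_fin ?sqr_ge0//.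
by rewrite noise_second_moment ltry.
Qed.

Lemma noise_mean i : \int[P]_w eps i w = 0.
Proof. by have := eps_mean i; rewrite unlock /Rintegral => ->. Qed.

Lemma noise_variance i : \int[P]_w (eps i w ^+ 2) = sigma ^+ 2.
Proof. by rewrite /Rintegral noise_second_moment. Qed.

Let f_ge0 x : 0 <= f x. Proof. by case: f_density. Qed.

Let cf : continuous f.
Proof.
move=> x; apply: differentiable_continuous; exact/derivable1_diffP/f_derivable.
Qed.

Let f_lip x y : `|f x - f y| <= M * `|x - y|.
Proof.
apply: (@derivative_bounded_lipschitz _ f (f^`())%classic) => // z.
by rewrite derive1E; exact: derivableP.
Qed.

Let M0 : 0 <= M.
Proof. exact: le_trans (normr_ge0 _) (f'_bounded 0). Qed.

Let mfE (A : set (measurableTypeR R)) : measurable_fun A (fun x : measurableTypeR R => (f x)%:E).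
Proof.
by apply/measurable_EFinP; apply: measurable_funTS; exact: continuous_measurable_fun.
Qed.

Let prE i (A : set R) : measurable A ->
  (P (eps i @^-1` A) = \int[mu]_(x in A) (f x)%:E)%E.
Proof.
move=> mA; have [_ fd] := f_density.
by rewrite -fd//; exact: eps_ident.
Qed.

Let pr_itv i (a b : R) : a <= b ->
  ((pr P (eps i @^-1` `[a, b]))%:E = \int[mu]_(x in `[a, b]) (f x)%:E)%E.
Proof.
move=> ab; rewrite EFin_pr ?prE//; exact: measurable_funPTI.
Qed.

(** If [f x > M + 1], the bound on the derivative keeps [f] above 1 on [[x, x + 1]], and this
    interval would have probability above 1. *)
Lemma density_bounded x : f x <= M + 1.
Proof.
rewrite leNgt; apply/negP => fx.
have x1 : x <= x + 1 by rewrite lerDl.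
have : pr P (eps 1 @^-1` `[x, x + 1]) <= 1.
  rewrite -lee_fin /pr fineK; last by apply: fin_num_measure; exact: measurable_funPTI.
  by apply: probability_le1; exact: measurable_funPTI.
rewrite -lee_fin pr_itv// leNgt => /negP; apply.
apply: (@lt_le_trans _ _ (\int[mu]_(z in `[x, (x + 1)%R]) (f x - M)%:E)%E).
  rewrite integral_cst_itv// (addrC x) addrK mulr1 lte_fin.
  by rewrite ltrBrDl.
apply: ge0_le_integral => //.
- by move=> z _; rewrite lee_fin subr_ge0 ltW// (lt_trans _ fx)// ltrDl.
- move=> z; rewrite /= in_itv/= => /andP[xz zx]; rewrite lee_fin.
  have := f_lip x z; rewrite ler_norml => /andP[_ H].
  have : M * `|x - z| <= M.
    by rewrite ler_piMr// distrC ger0_norm ?subr_ge0// lerBlDl.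
  by lra.
Qed.

Lemma pr_itv_le i (a b : R) : a <= b -> pr P (eps i @^-1` `[a, b]) <= (M + 1) * (b - a).
Proof.
move=> ab; rewrite -lee_fin pr_itv//.
apply: (@le_trans _ _ (\int[mu]_(z in `[a, b]) (M + 1)%:E)%E).
  apply: ge0_le_integral => //.
  - by move=> z _; rewrite lee_fin.
  - by move=> z _; rewrite lee_fin density_bounded.
by rewrite integral_cst_itv.
Qed.

Lemma pr_point i (a : R) : pr P (eps i @^-1` [set a]) = 0.
Proof.
apply/eqP; rewrite eq_le pr_ge0 andbT.
have := @pr_itv_le i a a (lexx a); rewrite subrr mulr0 set_itv1; exact.
Qed.

(* |f x - f 0| <= M |x| integrated over an interval with endpoint 0 *)
Lemma pr_itv_near0 i (a b : R) : a <= 0 -> 0 <= b ->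
  `|pr P (eps i @^-1` `[a, b]) - f 0 * (b - a)| <= M * (b - a) ^+ 2.
Proof.
move=> a0 b0; have ab : a <= b by exact: le_trans b0.
have bnd z : z \in `[a, b] -> `|f z - f 0| <= M * (b - a).
  rewrite in_itv/= => /andP[az zb]; rewrite (le_trans (f_lip _ _))//.
  rewrite ler_wpM2l// subr0 ler_norml; lra.
rewrite ler_norml; apply/andP; split.
  rewrite lerBrDl (_ : _ - _ = (f 0 - M * (b - a)) * (b - a)); last by ring.
  have [fM|fM] := leP 0 (f 0 - M * (b - a)); last first.
    by rewrite (le_trans _ (pr_ge0 _ _))// mulr_le0_ge0 ?subr_ge0// ltW.
  rewrite -lee_fin pr_itv//.
  apply: (@le_trans _ _ (\int[mu]_(z in `[a, b]) (f 0 - M * (b - a))%:E)%E).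
    by rewrite integral_cst_itv.
  apply: ge0_le_integral => //.
  - move=> z /= zab; rewrite lee_fin; have := bnd z zab.
    by rewrite ler_norml => /andP[]; lra.
rewrite lerBlDl (_ : _ + _ = (f 0 + M * (b - a)) * (b - a)); last by ring.
rewrite -lee_fin pr_itv//.
apply: (@le_trans _ _ (\int[mu]_(z in `[a, b]) (f 0 + M * (b - a))%:E)%E).
  apply: ge0_le_integral => //.
  - by move=> z _; rewrite lee_fin.
  - move=> z /= zab; rewrite lee_fin; have := bnd z zab.
    by rewrite ler_norml => /andP[]; lra.
by rewrite integral_cst_itv.
Qed.

(** With zero variance the noise would be 0 almost surely, but a law with a density has no atom. *)
Lemma sigma_gt0 : 0 < sigma.
Proof.
rewrite lt_neqAle sigma_ge0 andbT eq_sym; apply/eqP => s0.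
have m2 : measurable_fun setT (fun w => (eps 1 w ^+ 2)%:E).
  by apply/measurable_EFinP; exact: measurable_funX.
have : (\int[P]_w `|(eps 1 w ^+ 2)%:E| = 0)%E.
  under eq_integral do rewrite gee0_abs ?lee_fin ?sqr_ge0//.
  by rewrite noise_second_moment s0 expr0n.
move/(ae_eq_integral_abs P measurableT m2) => H.
have := @pr_point 1 0; rewrite (@pr_ae_eq _ _ _ _ _ setT) /pr ?probability_setT.
- by move/eqP; rewrite oner_eq0.
- exact: measurable_funPTI.
- exact: measurableT.
apply: filterS H => w /= /(_ I) [] /eqP; rewrite sqrf_eq0 => /eqP.
by [].
Qed.

Let msg (c : R) : measurable_fun setT (fun x : R => Num.sg (x - c)).
Proof.
by apply: (measurableT_comp (@measurable_sgr R)); exact: measurable_funB.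
Qed.

(** The two signs differ, by at most 2, only when the noise falls into the interval between [a] and
    [b], and the density is at most [M + 1]. *)
Lemma noise_sgr_lipschitz i (a b : R) :
  \int[P]_w `|Num.sg (eps i w - a) - Num.sg (eps i w - b)| <= 2 * (M + 1) * `|a - b|.
Proof.
wlog ab : a b / a <= b => [H|].
  have [|/ltW ba] := leP a b; first exact: H.
  by under eq_Rintegral do rewrite distrC; rewrite [`|a - b|]distrC; exact: H.
have mab : measurable `[a, b]%classic by exact: measurable_itv.
have iab := integrable_indic_comp P (measurable_funPT (eps i)) mab.
apply: (@le_trans _ _ (\int[P]_w (2 * \1_`[a, b]%classic (eps i w)))).
  apply: le_Rintegral => //.
  - apply: (@bounded_integrable _ _ _ _ _ 2).
      apply: measurableT_comp => //; apply: measurable_funB.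
        exact: measurableT_comp (msg a) _.
      exact: measurableT_comp (msg b) _.
    move=> w; rewrite normr_id (le_trans (ler_normB _ _))//.
    by rewrite (le_trans (lerD (sgr_le1 _) (sgr_le1 _))).
  - exact: integrable_scale.
  - move=> w _; rewrite indicE mem_setE in_itv/=.
    have [aw|wa] := leP a (eps i w); have [wb|bw] := leP (eps i w) b => /=.
    + rewrite mulr1 (le_trans (ler_normB _ _))//.
      by rewrite (le_trans (lerD (sgr_le1 _) (sgr_le1 _))).
    + by rewrite !gtr0_sg ?subr_gt0// ?subrr ?normr0 ?mulr0// (le_lt_trans ab).
    + by rewrite !ltr0_sg ?subr_lt0// ?subrr ?normr0 ?mulr0// (lt_le_trans wa).
    + by have := lt_le_trans (lt_trans bw wa) ab; rewrite ltxx.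
rewrite RintegralZl// Rintegral_indic_comp// -mulrA ler_wpM2l//.
by rewrite distrC ger0_norm ?subr_ge0// pr_itv_le.
Qed.

(** The median condition gives both closed half-lines probability at least 1/2; as 0 is not an atom,
    the two add up to 1 and are therefore equal. *)
Lemma noise_sgr_mean i : \int[P]_w Num.sg (eps i w) = 0.
Proof.
rewrite (Rintegral_ident eps_ident i 1 (@measurable_sgr R)).
have [H1 H2] := eps_median.
have mge : measurable `[(0:R), +oo[%classic by exact: measurable_itv.
have mle : measurable `]-oo, (0:R)]%classic by exact: measurable_itv.
have mp0 : measurable [set (0:R)] by exact: measurable_set1.
have i1 := integrable_indic_comp P (measurable_funPT (eps 1)) mge.
have i2 := integrable_indic_comp P (measurable_funPT (eps 1)) mle.
have i3 := integrable_indic_comp P (measurable_funPT (eps 1)) mp0.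
have E1 : \int[P]_w Num.sg (eps 1 w) =
    pr P (eps 1 @^-1` `[0, +oo[) - pr P (eps 1 @^-1` `]-oo, 0]).
  rewrite -!Rintegral_indic_comp// -RintegralB//.
  by apply: eq_Rintegral => w _; rewrite sgr_indic !indicE !mem_setE !in_itv/= andbT.
have E2 : pr P (eps 1 @^-1` `[0, +oo[) + pr P (eps 1 @^-1` `]-oo, 0]) = 1.
  transitivity (\int[P]_w (1 : R) + pr P (eps 1 @^-1` [set (0:R)])); last first.
    by rewrite pr_point (integral_prob_cst P) addr0.
  rewrite -!Rintegral_indic_comp// -!RintegralD//; last exact: finite_measure_integrable_cst.
  apply: eq_Rintegral => w _; rewrite !indicE !mem_setE !in_itv/= andbT.
  rewrite in_set1; case: (ltgtP (eps 1 w) 0) => _ /=; lra.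
have h (A : set R) : measurable A -> ((2^-1)%:E <= P (eps 1 @^-1` A))%E -> 2^-1 <= pr P (eps 1 @^-1` A).
  by move=> mA; rewrite -EFin_pr ?lee_fin//; exact: measurable_funPTI.
have {}H1 : 2^-1 <= pr P (eps 1 @^-1` `]-oo, 0]).
  apply: h => //; move: H1; rewrite (_ : [set w | _] = eps 1 @^-1` `]-oo, 0])//.
have {}H2 : 2^-1 <= pr P (eps 1 @^-1` `[0, +oo[).
  apply: h => //; move: H2; rewrite (_ : [set w | _] = eps 1 @^-1` `[0, +oo[)//.
  by apply/seteqP; split => w /=; rewrite in_itv/= andbT.
rewrite E1; lra.
Qed.

(** Shifting by [s] changes the sign only between 0 and [s], by 2 in absolute value off the
    endpoints. The mean is thus twice the probability of that interval, up to sign, and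
    [pr_itv_near0] expands this probability with a quadratic error. *)
Lemma noise_sgr_shift i (s : R) :
  `|\int[P]_w Num.sg (eps i w - s) + 2 * f 0 * s| <= 2 * M * s ^+ 2.
Proof.
have isg (c : R) : P.-integrable setT (EFin \o (fun w => Num.sg (eps i w - c))).
  apply: (@bounded_integrable _ _ _ _ _ 1); first exact: measurableT_comp (msg c) _.
  by move=> w; exact: sgr_le1.
have ms (c : R) : measurable [set c] by exact: measurable_set1.
have ip (c : R) := integrable_indic_comp P (measurable_funPT (eps i)) (ms c).
(* The sign is 0 at its jump, so the change is only 1 in absolute value at each endpoint when
   [a < b]; the two point indicators record this, and they integrate to 0. *)
have key (a b : R) (k : R) :
    (forall e : R, Num.sg (e - s) - Num.sg (e - 0) = k * (2 * \1_`[a, b]%classic e - \1_[set a] e - \1_[set b] e)) ->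
    \int[P]_w Num.sg (eps i w - s) = 2 * k * pr P (eps i @^-1` `[a, b]).
  move=> H; have mab : measurable `[a, b]%classic by exact: measurable_itv.
  have iab := integrable_indic_comp P (measurable_funPT (eps i)) mab.
  have i2 := integrable_scale 2 iab.
  have i3 : P.-integrable setT (EFin \o (fun w => 2 * \1_`[a, b]%classic (eps i w) - \1_[set a] (eps i w))).
    exact: (integrableB measurableT i2 (ip a)).
  have i4 : P.-integrable setT (EFin \o (fun w => 2 * \1_`[a, b]%classic (eps i w) - \1_[set a] (eps i w) - \1_[set b] (eps i w))).
    exact: (integrableB measurableT i3 (ip b)).
  transitivity (\int[P]_w Num.sg (eps i w - s) - \int[P]_w Num.sg (eps i w - 0)).
    by under [X in _ = _ - X]eq_Rintegral do rewrite subr0; rewrite noise_sgr_mean subr0.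
  rewrite -RintegralB//; under eq_Rintegral do rewrite H.
  rewrite RintegralZl// RintegralB// RintegralB// RintegralZl// !Rintegral_indic_comp//.
  by rewrite !pr_point !subr0; ring.
have [s0|/ltW s0] := leP 0 s.
  rewrite (key 0 s (-1)); last first.
    move=> e; rewrite subr0 !sgr_indic !indicE mem_setE in_itv/= !in_set1 subr_ge0 subr_le0.
    by case: (ltgtP e 0) => e0 /=; case: (ltgtP e s) => es /=; lra.
  have := pr_itv_near0 i (lexx 0) s0; rewrite subr0.
  move: (pr _ _) => p; rewrite !ler_norml => /andP[? ?]; apply/andP; split; lra.
rewrite (key s 0 1); last first.
  move=> e; rewrite subr0 !sgr_indic !indicE mem_setE in_itv/= !in_set1 subr_ge0 subr_le0.
  by case: (ltgtP e 0) => e0 /=; case: (ltgtP e s) => es /=; lra.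
have := pr_itv_near0 i s0 (lexx 0); rewrite sub0r sqrrN.
move: (pr _ _) => p; rewrite !ler_norml => /andP[? ?]; apply/andP; split; lra.
Qed.

Lemma noise_sum_second_moment (J : nat -> set int) (k : nat -> int) (w : nat -> R) m :
  (forall m, ~ J m (k m)) -> (forall m, J m `<=` J m.+1) -> (forall m, J m.+1 (k m)) ->
  \int[P]_t (\sum_(i < m) w i * eps (k i) t) ^+ 2 = sigma ^+ 2 * \sum_(i < m) w i ^+ 2.
Proof.
move=> Jk JS kS.
exact (@weighted_sum_second_moment _ _ _ P eps eps_indep J k id sigma w Jk JS kS
  (@measurable_id _ _ _) (noise_square_integrable) (noise_mean)
  (noise_variance) m).
Qed.

Lemma noise_sum_square_integrable (k : nat -> int) (w : nat -> R) m :
  square_integrable P (fun t => \sum_(i < m) w i * eps (k i) t).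
Proof.
apply: square_integrable_sum => i _; apply: square_integrableZ.
exact: noise_square_integrable _.
Qed.

(** * Estimates for a fixed autoregressive coefficient *)

Section fixed_coefficient.
Variable r : R.
Hypothesis r_itv : 0 < r < 1.

Definition past_sum m w := \sum_(j < m) r ^+ j * eps (- j%:Z) w.

(* a version of the stationary initial value that is measurable with respect to the past noise *)
Definition past_value w : R := fine (limn_esup (fun m => (past_sum m w)%:E)).

Lemma past_sum_between m : measurable_fun setT (past_sum m : info eps (between m) -> R).
Proof.
exact (@weighted_sum_info _ _ _ P eps between (fun j => - j%:Z) id (fun j => r ^+ j)
  betweenS betweenSin (@measurable_id _ _ _) m).
Qed.

Lemma past_value_info : measurable_fun setT (past_value : info eps (upto 0) -> R).
Proof.
have mZ m : measurable_fun setT (past_sum m : info eps (upto 0) -> R).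
  exact: info_subset (@between_upto0 m) (@past_sum_between m).
have mlim := @measurable_fun_limn_esup _ (info eps (upto 0)) R setT (fun m w => (past_sum m w)%:E)
  (fun m => (measurable_EFinP _ _).2 (mZ m)).
exact (measurableT_comp (@fine_measurable R setT measurableT) mlim).
Qed.

Lemma past_sum_series w : past_sum^~ w = series (fun j => r ^+ j * eps (- j%:Z) w).
Proof. by apply/funext => m; rewrite /past_sum /series/= big_mkord. Qed.

Lemma past_value_ae (V : T -> R) : {ae P, forall w,
    series (fun j => r ^+ j * eps (- j%:Z) w) @ \oo --> V w} ->
  {ae P, forall w, V w = past_value w}.
Proof.
apply: filterS => w H.
have /cvg_limn_einf_sup[_] : (past_sum m w)%:E @[m --> \oo] --> (V w)%:E.
  apply: cvg_EFin; first exact: nearW.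
  by have := H; rewrite -past_sum_series.
by rewrite /past_value => ->.
Qed.

Lemma sqr1_gt0 : 0 < 1 - r ^+ 2.
Proof. by have /andP[r0 r1] := r_itv; rewrite subr_gt0 expr_lt1// ltW. Qed.

Lemma geometric_sqr_le m : \sum_(i < m) (r ^+ i) ^+ 2 <= (1 - r ^+ 2)^-1.
Proof.
have /andP[r0 r1] := r_itv; have k0 := sqr1_gt0.
rewrite -[leRHS]mul1r ler_pdivlMr//.
have := subrX1 (r ^+ 2) m.
under [X in _ = _ * X -> _]eq_bigr do rewrite -exprM mulnC exprM.
have : 0 <= (r ^+ 2) ^+ m by rewrite exprn_ge0// sqr_ge0.
lra.
Qed.

Hypothesis past_cvg : {ae P, forall w, cvgn (series (fun j => r ^+ j * eps (- j%:Z) w))}.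

Let V := past_value.

Lemma past_value_measurable : measurable_fun setT V.
Proof. exact: info_measurable past_value_info. Qed.

Lemma past_sum_cvg : {ae P, forall w, past_sum m w @[m --> \oo] --> V w}.
Proof.
have := @past_value_ae (fun w => limn (series (fun j => r ^+ j * eps (- j%:Z) w))) past_cvg.
move: past_cvg; apply: filterS2 => w Hc Hl; rewrite /V -Hl.
by rewrite past_sum_series.
Qed.

Lemma past_sum_square_integrable m : square_integrable P (past_sum m).
Proof. exact: (@noise_sum_square_integrable (fun j => - j%:Z)). Qed.

(** The series is only known to converge almost surely, so the square is written as a limit inferior
    and Fatou's lemma transfers the bound from the partial sums. *)
Lemma past_value_second_moment_le :
  (\int[P]_w (V w ^+ 2)%:E <= (sigma ^+ 2 / (1 - r ^+ 2))%:E)%E.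
Proof.
have mV := past_value_measurable.
have sZ := past_sum_square_integrable.
have mZ m : measurable_fun setT (fun w => (past_sum m w ^+ 2)%:E).
  by apply/measurable_EFinP; apply: measurable_funX; case: (sZ m).
rewrite (@ae_eq_integral _ _ _ P setT (fun w => limn_einf (fun m => (past_sum m w ^+ 2)%:E)))//; last 3 first.
- exact/measurable_EFinP/measurable_funX.
- under eq_fun do rewrite -[limn_einf _]oppeK -limn_esupN.
  apply: measurableT_comp => //.
  apply: (@measurable_fun_limn_esup _ T R setT (fun m w => (- (past_sum m w ^+ 2)%:E)%E)) => m.
  exact: measurableT_comp.
- move: past_sum_cvg; apply: filterS => w H _.
  have /cvg_limn_einf_sup[-> _]// : (past_sum m w ^+ 2)%:E @[m --> \oo] --> (V w ^+ 2)%:E.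
  apply: cvg_EFin; first exact: nearW.
  exact: (cvg_comp _ _ H (@exprn_continuous _ 2 _)).
apply: (le_trans (fatou P measurableT mZ _)); first by move=> m w _; rewrite lee_fin sqr_ge0.
rewrite limn_einf_lim; apply: lime_le; first exact: is_cvg_einfs.
apply: nearW => m; apply: (@le_trans _ _ (\int[P]_w (past_sum m w ^+ 2)%:E)%E).
  by apply: ereal_inf_lbound; exists m => /=.
rewrite -EFin_Rintegral; last by case: (sZ m).
rewrite lee_fin (@noise_sum_second_moment _ _ _ _ between_notin betweenS betweenSin).
by rewrite ler_wpM2l ?sqr_ge0// geometric_sqr_le.
Qed.

Lemma past_value_square_integrable : square_integrable P V.
Proof.
have mV := past_value_measurable.
split => //; apply/integrableP; split; first exact/measurable_EFinP/measurable_funX.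
under eq_integral do rewrite /= ger0_norm ?sqr_ge0//.
by rewrite (le_lt_trans past_value_second_moment_le)// ltry.
Qed.

Lemma past_value_second_moment : \int[P]_w (V w ^+ 2) <= sigma ^+ 2 / (1 - r ^+ 2).
Proof.
rewrite -lee_fin EFin_Rintegral; first exact: past_value_second_moment_le.
by case: past_value_square_integrable.
Qed.

Definition innovation_sum i w := \sum_(j < i) r ^+ (i.-1 - j) * eps j.+1%:Z w.

(** The solution of the recursion started from the measurable version of the initial value, in
    closed form so that its difference from [V] splits into [- (1 - r^i) V] and a sum of new
    noise. *)
Definition ar_path i w := r ^+ i * V w + innovation_sum i w.

Lemma ar_path0 w : ar_path 0 w = V w.
Proof. by rewrite /ar_path /innovation_sum expr0 mul1r big_ord0 addr0. Qed.

Lemma ar_pathS i w : ar_path i.+1 w = r * ar_path i w + eps i.+1%:Z w.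
Proof.
rewrite /ar_path /innovation_sum big_ord_recr/= subnn expr0 mul1r exprS mulrDr !mulrA -addrA.
congr (_ + (_ + _)); rewrite mulr_sumr; apply: eq_bigr => j _.
by rewrite mulrA -exprS; congr (_ ^+ _ * _); move: (ltn_ord j); clear; lia.
Qed.

Lemma ar_path_info i : measurable_fun setT (ar_path i : info eps (upto i) -> R).
Proof.
elim: i => [|i IH].
  rewrite (_ : ar_path 0 = V); last by apply/funext => w; exact: ar_path0.
  exact: past_value_info.
rewrite (_ : ar_path i.+1 = fun w => r * ar_path i w + eps i.+1%:Z w); last first.
  by apply/funext => w; exact: ar_pathS.
have me := @info_eps _ _ _ P eps (upto i.+1) i.+1%:Z (uptoSin i).
have mp := @info_subset _ _ _ P eps _ _ (upto i) (upto i.+1) (ar_path i) (@uptoS i) IH.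
have mr : measurable_fun setT (fun w : info eps (upto i.+1) => r) by [].
exact (measurable_funD (measurable_funM mr mp) me).
Qed.

Lemma ar_path_square_integrable i : square_integrable P (ar_path i).
Proof.
apply: square_integrableD; last exact: (@noise_sum_square_integrable (fun j => Posz j.+1) (fun j => r ^+ (i.-1 - j))).
by apply: square_integrableZ; exact: past_value_square_integrable.
Qed.

(** Bernoulli's inequality bounds [1 - r^i] by [n (1 - r)], and [V] has second moment at most
    [sigma^2 / (1 - r^2)]; the new noise has second moment at most [sigma^2 n], which is damped by
    [1 - r^2 <= 2 (1 - r)]. On the scale of [V] the path is therefore constant up to powers of
    [n (1 - r)]. *)
Lemma ar_path_increment i n : (i <= n)%N ->
  (1 - r ^+ 2) * \int[P]_w ((ar_path i w - V w) ^+ 2) <=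
    2 * sigma ^+ 2 * ((n%:R * (1 - r)) ^+ 2 + 2 * (n%:R * (1 - r))).
Proof.
move=> i_n; have /andP[r0 r1] := r_itv; have k0 := sqr1_gt0.
have sV := past_value_square_integrable.
have sW : square_integrable P (innovation_sum i).
  exact: (@noise_sum_square_integrable (fun j => Posz j.+1) (fun j => r ^+ (i.-1 - j))).
have [_ iV] := sV; have [_ iW] := sW.
have EW : \int[P]_w (innovation_sum i w ^+ 2) <= sigma ^+ 2 * i%:R.
  rewrite (@noise_sum_second_moment _ _ (fun j => r ^+ (i.-1 - j)) _ upto_notin uptoS uptoSin).
  rewrite ler_wpM2l ?sqr_ge0// -[X in _ <= X%:R]card_ord -sumr_const ler_sum// => j _.
  by rewrite -exprM exprn_ile1// ltW.
have EV := past_value_second_moment.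
have bern m : 1 - r ^+ m <= m%:R * (1 - r).
  elim: m => [|m IH]; first by rewrite expr0 subrr mul0r.
  have rm : r ^+ m <= 1 by rewrite exprn_ile1// ltW.
  by rewrite exprS -natr1; nra.
have bern0 : 0 <= 1 - r ^+ i by rewrite subr_ge0 exprn_ile1// ltW.
have step : \int[P]_w ((ar_path i w - V w) ^+ 2) <=
    2 * (1 - r ^+ i) ^+ 2 * (sigma ^+ 2 / (1 - r ^+ 2)) + 2 * (sigma ^+ 2 * i%:R).
  apply: (@le_trans _ _ (\int[P]_w (2 * (1 - r ^+ i) ^+ 2 * V w ^+ 2 + 2 * innovation_sum i w ^+ 2))).
    apply: le_Rintegral => //.
    - by case: (square_integrableB (ar_path_square_integrable i) sV).
    - exact: (integrableD measurableT (integrable_scale _ iV) (integrable_scale 2 iW)).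
    - move=> w _; rewrite /ar_path.
      have -> : r ^+ i * V w + innovation_sum i w - V w = innovation_sum i w - (1 - r ^+ i) * V w by ring.
      have := sqr_ge0 (innovation_sum i w + (1 - r ^+ i) * V w).
      rewrite -mulrA -exprMn; nra.
  rewrite RintegralD//; [|exact: integrable_scale..].
  rewrite !RintegralZl// lerD//.
    by rewrite ler_wpM2l// mulr_ge0// sqr_ge0.
  by rewrite ler_wpM2l.
apply: (le_trans (ler_wpM2l (ltW k0) step)).
have -> : (1 - r ^+ 2) * (2 * (1 - r ^+ i) ^+ 2 * (sigma ^+ 2 / (1 - r ^+ 2)) + 2 * (sigma ^+ 2 * i%:R))
  = 2 * sigma ^+ 2 * ((1 - r ^+ i) ^+ 2 + (1 - r ^+ 2) * i%:R).
  by field; rewrite gt_eqF.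
apply: ler_wpM2l; first by rewrite mulr_ge0// sqr_ge0.
apply: lerD.
  rewrite ler_sqr ?nnegrE//; last by rewrite mulr_ge0// subr_ge0 ltW.
  by rewrite (le_trans (bern i))// ler_wpM2r ?subr_ge0 ?ler_nat// ltW.
have : i%:R <= n%:R :> R by rewrite ler_nat.
have : 0 <= i%:R :> R by [].
have -> : 1 - r ^+ 2 = (1 - r) * (1 + r) by ring.
move=> i0 ni.
have h1 : (1 - r) * i%:R <= (1 - r) * n%:R by rewrite ler_wpM2l// subr_ge0 ltW.
have h2 : 0 <= (1 - r) * i%:R by rewrite mulr_ge0// subr_ge0 ltW.
by nra.
Qed.

Let Y := ar_path.
Let L := 2 * (M + 1).
Let sV : square_integrable P V := past_value_square_integrable.
Let sY i : square_integrable P (Y i) := ar_path_square_integrable i.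
Let mV : measurable_fun setT V := sV.1.
Let mY i : measurable_fun setT (Y i) := (sY i).1.
Let L_ge0 : 0 <= L.
Proof. by rewrite mulr_ge0// addr_ge0// (le_trans (normr_ge0 _) (f'_bounded 0)). Qed.
Let k0 : 0 < 1 - r ^+ 2 := sqr1_gt0.

Definition increment_bound n : R := 2 * sigma ^+ 2 * ((n%:R * (1 - r)) ^+ 2 + 2 * (n%:R * (1 - r))).

Lemma increment_bound_ge0 n : 0 <= increment_bound n.
Proof.
have /andP[r0 r1] := r_itv.
rewrite mulr_ge0 ?mulr_ge0 ?sqr_ge0// addr_ge0 ?sqr_ge0// !mulr_ge0// subr_ge0 ltW//.
Qed.

(** What Young's inequality yields in [gap_le] with parameter
    [sqrt (increment_bound n) + 1 / (n + 1)]; the added fraction keeps the parameter positive. *)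
Definition gap_bound n : R := increment_bound n + Num.sqrt (increment_bound n) +
  (Num.sqrt (increment_bound n) + n.+1%:R^-1) * sigma ^+ 2.

Lemma gap_bound_ge0 n : 0 <= gap_bound n.
Proof.
have i0 := increment_bound_ge0 n; have s0 : 0 <= Num.sqrt (increment_bound n) by exact: sqrtr_ge0.
by rewrite addr_ge0 ?addr_ge0// mulr_ge0 ?sqr_ge0// addr_ge0.
Qed.

(** Dominates [|Y^2 - V^2|] and, in mean and up to a constant, the effect of replacing [Y i] by [V]
    inside the shifted signs. *)
Definition gap i w := `|Y i w - V w| * (`|Y i w| + `|V w|).

Lemma gap_integrable i : P.-integrable setT (EFin \o gap i).
Proof.
have [_ iY] := sY i; have [_ iV] := sV.
apply: (le_integrable_norm _ (integrableD measurableT (integrable_scale 2 iY) (integrable_scale 2 iV))).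
  apply: measurable_funM; first by apply: measurableT_comp => //; exact: measurable_funB.
  by apply: measurable_funD; exact: measurableT_comp.
move=> w; rewrite normrM normr_id.
have h : `|Y i w - V w| <= `|Y i w| + `|V w| by exact: ler_normB.
rewrite ger0_norm ?addr_ge0//.
apply: (@le_trans _ _ ((`|Y i w| + `|V w|) ^+ 2)); first by rewrite expr2 ler_wpM2r// addr_ge0.
rewrite -[Y i w ^+ 2]real_normK ?num_real// -[V w ^+ 2]real_normK ?num_real//.
have := sqr_ge0 (`|Y i w| - `|V w|); nra.
Qed.

(** Young's inequality [2 D v <= D^2 / tau + tau v^2] for [D = |Y - V|] and [v = |V|], with [tau]
    slightly above [s = sqrt (increment_bound n)]: then [s^2 / tau <= s], and the bound is small
    whenever the increments and [1 / n] are. *)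
Lemma gap_le i n : (i <= n)%N -> (1 - r ^+ 2) * \int[P]_w gap i w <= gap_bound n.
Proof.
move=> i_n.
pose s := Num.sqrt (increment_bound n); pose tau := s + n.+1%:R^-1.
have s0 : 0 <= s by exact: sqrtr_ge0.
have ss : s ^+ 2 = increment_bound n by rewrite sqr_sqrtr// increment_bound_ge0.
have tau0 : 0 < tau by rewrite ltr_wpDl// invr_gt0.
have [_ iV] := sV; have [_ iD] := square_integrableB (sY i) sV.
have step : \int[P]_w gap i w <=
    (1 + tau^-1) * \int[P]_w ((Y i w - V w) ^+ 2) + tau * \int[P]_w (V w ^+ 2).
  rewrite -!RintegralZl// -RintegralD//; [|exact: integrable_scale..].
  apply: le_Rintegral => //; first exact: gap_integrable.
    exact: (integrableD measurableT (integrable_scale _ iD) (integrable_scale _ iV)).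
  move=> w _; rewrite /gap.
  have h : `|Y i w| <= `|Y i w - V w| + `|V w|.
    by rewrite -[X in `|X| <= _](subrK (V w)) ler_normD.
  rewrite -[(Y i w - V w) ^+ 2]real_normK ?num_real// -[V w ^+ 2]real_normK ?num_real//.
  set D := `|Y i w - V w| in h *; set v := `|V w| in h *.
  have D0 : 0 <= D := normr_ge0 _.
  apply: (@le_trans _ _ (D * (D + v + v))); first by rewrite ler_wpM2l// lerD2r.
  have : 0 <= tau^-1 * (D - tau * v) ^+ 2 by rewrite mulr_ge0 ?sqr_ge0// invr_ge0 ltW.
  have -> : tau^-1 * (D - tau * v) ^+ 2 = tau^-1 * D ^+ 2 - 2 * D * v + tau * v ^+ 2.
    by field; rewrite gt_eqF.
  nra.
have EV : (1 - r ^+ 2) * \int[P]_w (V w ^+ 2) <= sigma ^+ 2.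
  have := past_value_second_moment.
  by rewrite ler_pdivlMr// mulrC.
have ED : (1 - r ^+ 2) * \int[P]_w ((Y i w - V w) ^+ 2) <= s ^+ 2.
  rewrite ss; exact: (ar_path_increment i_n).
apply: (le_trans (ler_wpM2l (ltW k0) step)).
rewrite mulrDr !(mulrCA (1 - r ^+ 2)) /gap_bound -/s -/tau -ss lerD//; last by rewrite ler_wpM2l// ltW.
apply: (@le_trans _ _ ((1 + tau^-1) * s ^+ 2)).
  by rewrite ler_wpM2l// addr_ge0// invr_ge0 ltW.
rewrite mulrDl mul1r lerD2l mulrC ler_pdivrMr// expr2 ler_wpM2l//.
by rewrite lerDl invr_ge0.
Qed.

Definition rate n : R := Num.sqrt ((1 - r ^+ 2) / n%:R).

Lemma sqr_rate n : rate n ^+ 2 = (1 - r ^+ 2) / n%:R.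
Proof. by rewrite sqr_sqrtr// divr_ge0// ltW. Qed.

Lemma rate_ge0 n : 0 <= rate n. Proof. exact: sqrtr_ge0. Qed.

Lemma rateE n : rate n = Num.sqrt (1 - r ^+ 2) / Num.sqrt n%:R.
Proof. by rewrite /rate sqrtrM ?(ltW k0)// sqrtrV. Qed.

(* dividing by [n] loses nothing when [n = 0], where the sum is empty *)
Lemma sqr_rate_sum_le n (c : nat -> R) b : 0 <= b ->
  (forall i, (i <= n)%N -> (1 - r ^+ 2) * c i <= b) -> rate n ^+ 2 * \sum_(i < n) c i <= b.
Proof.
move=> b0 cb; rewrite sqr_rate mulrAC mulr_sumr.
have [->|n0] := posnP n; first by rewrite invr0 mulr0.
rewrite ler_pdivrMr ?ltr0n// mulr_natr -[X in _ *+ X]card_ord -sumr_const.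
by apply: ler_sum => i _; apply: cb; exact: ltnW.
Qed.

Definition drift_remainder n w := rate n * \sum_(i < n) (Y i w - V w) * Num.sg (eps i.+1%:Z w).

Lemma drift_square_integrable i : square_integrable P (fun w => (Y i w - V w) * Num.sg (eps i.+1%:Z w)).
Proof.
rewrite (_ : (fun w => _) = (fun w => Num.sg (eps i.+1%:Z w) * (Y i w - V w))); last first.
  by apply/funext => w; rewrite mulrC.
apply: (@square_integrable_bdM _ _ _ _ _ _ 1) => [|w|].
- exact: (measurableT_comp (@measurable_sgr R)).
- exact: sgr_le1.
- exact: square_integrableB.
Qed.

Lemma drift_remainder_square_integrable n : square_integrable P (drift_remainder n).
Proof.
apply: square_integrableZ; apply: square_integrable_sum => i _.
exact: drift_square_integrable.
Qed.

(** The terms are orthogonal, since [Y i - V] is measurable for the noise up to time [i] and the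
    sign of the next noise has mean 0. Each square is bounded by that of the path increment. *)
Lemma drift_remainder_le n : \int[P]_w (drift_remainder n w ^+ 2) <= increment_bound n.
Proof.
have mH m : measurable_fun setT ((fun x => (Y m x.1 - V x.1) * Num.sg x.2) : info eps (upto m) * R -> R).
  have mYm : measurable_fun setT (Y m : info eps (upto m) -> R) by exact: ar_path_info.
  have mVm : measurable_fun setT (V : info eps (upto m) -> R).
    exact (@info_subset _ _ _ P eps _ _ (upto 0) (upto m) V (@upto0_subset m) (past_value_info)).
  apply: measurable_funM; last exact: (measurableT_comp (@measurable_sgr R) measurable_snd).
  exact: (measurableT_comp (measurable_funB mYm mVm) measurable_fst).
have isg m : P.-integrable setT (EFin \o (fun w => Num.sg (eps m w))).
  apply: (@bounded_integrable _ _ _ _ _ 1) => [|w]; last exact: sgr_le1.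
  exact: (measurableT_comp (@measurable_sgr R)).
have sD := drift_square_integrable.
have := @martingale_square_sum _ _ _ P eps eps_indep upto (fun m => m.+1%:Z)
  (fun m x => (Y m x.1 - V x.1) * Num.sg x.2) upto_notin uptoS uptoSin mH
  (fun m w => integrable_scale (Y m w - V w) (isg m.+1%:Z)) _ sD n.
rewrite /= => H.
have [_ iS] : square_integrable P (fun w => \sum_(i < n) (Y i w - V w) * Num.sg (eps i.+1%:Z w)).
  by apply: square_integrable_sum.
rewrite /drift_remainder; under eq_Rintegral do rewrite exprMn.
rewrite RintegralZl// H.
  apply: (@sqr_rate_sum_le n (fun i => \int[P]_w (((Y i w - V w) * Num.sg (eps i.+1%:Z w)) ^+ 2))).
    exact: increment_bound_ge0.
  move=> i i_n; rewrite -/(increment_bound n) (le_trans _ (ar_path_increment i_n))//.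
  rewrite ler_wpM2l ?(ltW k0)//; apply: le_Rintegral => //.
  - by case: (sD i).
  - by case: (square_integrableB (sY i) sV).
  - move=> w _; rewrite exprMn ler_piMr ?sqr_ge0// -real_normK ?num_real//.
    by rewrite expr_le1// sgr_le1.
move=> m w; rewrite RintegralZl// (noise_sgr_mean).
by rewrite mulr0.
Qed.

Definition kink c y e : R := y * (Num.sg (e - c * y) - Num.sg e).

Lemma kinkB_le c y v e : `|kink c y e - kink c v e| <= 2 * (`|y| + `|v|).
Proof.
have h x : `|kink c x e| <= `|x| * 2.
  rewrite /kink normrM ler_wpM2l// (le_trans (ler_normB _ _))//.
  by have := @sgr_le1 R (e - c * x); have := @sgr_le1 R e; lra.
rewrite (le_trans (ler_normB _ _))//; have := h y; have := h v; lra.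
Qed.

Lemma measurable_sgr_shift i s : measurable_fun setT (fun w => Num.sg (eps i w - s)).
Proof. by apply: (measurableT_comp (@measurable_sgr R)); exact: measurable_funB. Qed.

Lemma integrable_sgr_shift i s : P.-integrable setT (EFin \o (fun w => Num.sg (eps i w - s))).
Proof.
apply: (@bounded_integrable _ _ _ _ _ 1) => [|w]; last exact: sgr_le1.
exact: measurable_sgr_shift.
Qed.

Lemma measurable_kink c : measurable_fun setT (fun x : R * R => kink c x.1 x.2).
Proof.
apply: measurable_funM => //; apply: measurable_funB.
  apply: (measurableT_comp (@measurable_sgr R)); apply: measurable_funB => //.
  exact: measurable_funM.
exact: (measurableT_comp (@measurable_sgr R) measurable_snd).
Qed.

(** The difference is [(y - v) (sg (e - c y) - sg e) + v (sg (e - c y) - sg (e - c v))], and the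
    mean Lipschitz bound on signs applies to each part. *)
Lemma kink_lipschitz i c y v :
  (\int[P]_w `|kink c y (eps i w) - kink c v (eps i w)|%:E <=
   (L * `|c| * (`|y - v| * (`|y| + `|v|)))%:E)%E.
Proof.
have mk x : measurable_fun setT (fun w => kink c x (eps i w)).
  exact: (measurableT_comp (measurable_kink c) (measurable_fun_pair (measurable_cst x) (measurable_funPT (eps i)))).
have inorm a b : P.-integrable setT (EFin \o (fun w => `|Num.sg (eps i w - a) - Num.sg (eps i w - b)|)).
  apply: (@bounded_integrable _ _ _ _ _ 2) => [|w].
    by apply: measurableT_comp => //; apply: measurable_funB; exact: measurable_sgr_shift.
  rewrite normr_id (le_trans (ler_normB _ _))//.
  by have := @sgr_le1 R (eps i w - a); have := @sgr_le1 R (eps i w - b); lra.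
have lip := noise_sgr_lipschitz i.
rewrite -EFin_Rintegral; last first.
  apply: (@bounded_integrable _ _ _ _ _ (2 * (`|y| + `|v|))) => [|w].
    by apply: measurableT_comp => //; exact: measurable_funB.
  by rewrite normr_id kinkB_le.
rewrite lee_fin.
pose h a b w := `|Num.sg (eps i w - a) - Num.sg (eps i w - b)|.
apply: (@le_trans _ _ (\int[P]_w (`|y - v| * h (c * y) 0 w + `|v| * h (c * y) (c * v) w))).
  rewrite -[leLHS]ger0_norm; last by apply: Rintegral_ge0 => w _.
  apply: norm_Rintegral_le => [||w].
  - by apply: measurableT_comp => //; exact: measurable_funB.
  - exact: (integrableD measurableT (integrable_scale _ (inorm _ _)) (integrable_scale _ (inorm _ _))).
  - rewrite normr_id /h subr0 -!normrM (le_trans _ (ler_normD _ _))// /kink.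
    by rewrite le_eqVlt; apply/orP; left; apply/eqP; congr (`|_|); ring.
have i1 : P.-integrable setT (EFin \o (fun w => `|y - v| * h (c * y) 0 w)) := integrable_scale _ (inorm _ _).
have i2 : P.-integrable setT (EFin \o (fun w => `|v| * h (c * y) (c * v) w)) := integrable_scale _ (inorm _ _).
rewrite (RintegralD measurableT i1 i2) !RintegralZl//.
have h1 := lip (c * y) 0; have h2 := lip (c * y) (c * v).
rewrite subr0 normrM in h1; rewrite -mulrBr normrM in h2.
have -> : L * `|c| * (`|y - v| * (`|y| + `|v|)) =
  `|y - v| * (L * (`|c| * `|y|)) + `|v| * (L * (`|c| * `|y - v|)) by ring.
- by rewrite lerD// ler_wpM2l.
- exact: inorm.
- exact: inorm.
Qed.

Lemma ar_path_upto i : measurable_fun setT (Y i : info eps (upto i) -> R).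
Proof. exact: ar_path_info. Qed.

Lemma past_value_upto i : measurable_fun setT (V : info eps (upto i) -> R).
Proof.
exact (@info_subset _ _ _ P eps _ _ (upto 0) (upto i) V (@upto0_subset i) (past_value_info)).
Qed.

Lemma measurable_kink_upto c i (X : T -> R) : measurable_fun setT (X : info eps (upto i) -> R) ->
  measurable_fun setT ((fun x => kink c (X x.1) x.2) : info eps (upto i) * R -> R).
Proof.
move=> mX.
exact (measurableT_comp (measurable_kink c)
  (measurable_fun_pair (measurableT_comp mX measurable_fst) measurable_snd)).
Qed.

Definition kink_gap c i w := kink c (Y i w) (eps i.+1%:Z w) - kink c (V w) (eps i.+1%:Z w).

Lemma measurable_kink_gap c i : measurable_fun setT (kink_gap c i).
Proof.
apply: measurable_funB.
  exact: (measurableT_comp (measurable_kink c) (measurable_fun_pair (mY i) (measurable_funPT (eps i.+1%:Z)))).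
exact: (measurableT_comp (measurable_kink c) (measurable_fun_pair mV (measurable_funPT (eps i.+1%:Z)))).
Qed.

Lemma kink_gap_integrable c i : P.-integrable setT (EFin \o kink_gap c i).
Proof.
have iY := integrable_norm (square_integrable1 (sY i)).
have iV := integrable_norm (square_integrable1 sV).
apply: (le_integrable_norm _ (integrable_scale 2 (integrableD measurableT iY iV))) => [|w].
  exact: measurable_kink_gap.
exact: kinkB_le.
Qed.

(** The past fixes [Y i] and [V], and only the new noise is averaged. The estimate is in L1, because
    the same bound on squares would produce third powers of the path. *)
Lemma kink_gap_le c i : \int[P]_w `|kink_gap c i w| <= L * `|c| * \int[P]_w gap i w.
Proof.
have ig := gap_integrable i; have ik := integrable_norm (kink_gap_integrable c i).
rewrite -RintegralZl// -lee_fin !EFin_Rintegral//; last exact: integrable_scale.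
have mH : measurable_fun setT ((fun x => `|kink c (Y i x.1) x.2 - kink c (V x.1) x.2|%:E) :
    info eps (upto i) * R -> \bar R).
  apply/measurable_EFinP; apply: measurableT_comp => //.
  have m1 := measurable_kink_upto c (@ar_path_upto i).
  have m2 := measurable_kink_upto c (@past_value_upto i).
  exact (measurable_funB m1 m2).
have := info_ge0_decouple eps_indep (@upto_notin i) mH; rewrite /= => ->; last by move=> x; rewrite lee_fin.
apply: ge0_le_integral => //.
- by move=> w _; exact: integral_ge0.
- apply: (@measurable_integral_decouple _ _ _ P _ _ (info eps (upto i)) R id (eps i.+1%:Z)
    (@info_id _ _ _ P eps (upto i)) (measurable_funPT (eps i.+1%:Z)) _ mH) => x; by rewrite lee_fin.
- by apply: (measurable_int P); exact: integrable_scale.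
- by move=> w _; exact: kink_lipschitz.
Qed.

Definition kink_remainder c n w := rate n * \sum_(i < n) kink_gap (c * rate n) i w.

Lemma kink_remainder_integrable c n : P.-integrable setT (EFin \o kink_remainder c n).
Proof.
by apply: integrable_scale; apply: (sum_integrable (kink_gap_integrable (c * rate n)) n).1.
Qed.

(** Of the two factors [rate n], one normalises the score and the other is the size of the shift;
    together they turn the sum into an average of [(1 - r^2)] times the mean gaps. *)
Lemma kink_remainder_le c n : \int[P]_w `|kink_remainder c n w| <= L * `|c| * gap_bound n.
Proof.
have ik i := kink_gap_integrable (c * rate n) i.
have [iS leS] := sum_integrable ik n.
rewrite /kink_remainder; under eq_Rintegral do rewrite normrM.
rewrite RintegralZl//; last exact: integrable_norm.
rewrite ger0_norm ?rate_ge0//.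
apply: (@le_trans _ _ (rate n * \sum_(i < n) (L * `|c * rate n| * \int[P]_w gap i w))).
  rewrite ler_wpM2l ?rate_ge0// (le_trans leS)// ler_sum// => i _.
  exact: kink_gap_le.
rewrite -mulr_sumr normrM (ger0_norm (rate_ge0 n)).
have -> : rate n * (L * (`|c| * rate n) * \sum_(i < n) \int[P]_w gap i w) =
  L * `|c| * (rate n ^+ 2 * \sum_(i < n) \int[P]_w gap i w) by ring.
apply: ler_wpM2l; first exact: mulr_ge0.
apply: (@sqr_rate_sum_le n (fun i => \int[P]_w gap i w)); last by move=> i; exact: gap_le.
exact: gap_bound_ge0.
Qed.

Lemma square_sum_gap_le n : (0 < n)%N ->
  \int[P]_w `|(1 - r ^+ 2) / n%:R * \sum_(i < n) Y i w ^+ 2 - (1 - r ^+ 2) * V w ^+ 2| <= gap_bound n.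
Proof.
move=> n0; have [_ iV] := sV.
have iYV i : P.-integrable setT (EFin \o (fun w => Y i w ^+ 2 - V w ^+ 2)).
  by have [_ iY] := sY i; exact: (integrableB measurableT iY iV).
have [iS leS] := sum_integrable iYV n.
under eq_Rintegral => w _.
  have -> : (1 - r ^+ 2) / n%:R * \sum_(i < n) Y i w ^+ 2 - (1 - r ^+ 2) * V w ^+ 2 =
      rate n ^+ 2 * \sum_(i < n) (Y i w ^+ 2 - V w ^+ 2).
    rewrite sqr_rate sumrB sumr_const card_ord -(mulr_natl _ n) mulrBr; congr (_ - _).
    by field; rewrite pnatr_eq0 -lt0n.
  rewrite normrM ger0_norm ?sqr_ge0//.
  over.
rewrite RintegralZl//; last exact: integrable_norm.
apply: (@le_trans _ _ (rate n ^+ 2 * \sum_(i < n) \int[P]_w gap i w)).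
  rewrite ler_wpM2l ?sqr_ge0// (le_trans leS)// ler_sum// => i _.
  apply: le_Rintegral => //; [exact: integrable_norm|exact: gap_integrable|].
  by move=> w _; rewrite subr_sqr normrM ler_wpM2l// ler_normD.
apply: (@sqr_rate_sum_le n (fun i => \int[P]_w gap i w)); last by move=> i; exact: gap_le.
exact: gap_bound_ge0.
Qed.

Definition shift_mean s := \int[P]_w Num.sg (eps 1 w - s).

Lemma shift_meanE i s : \int[P]_w Num.sg (eps i w - s) = shift_mean s.
Proof.
apply: (@Rintegral_ident _ _ _ P eps eps_ident i 1 (fun e => Num.sg (e - s))).
by apply: (measurableT_comp (@measurable_sgr R)); exact: measurable_funB.
Qed.

Lemma shift_mean0 : shift_mean 0 = 0.
Proof.
rewrite /shift_mean; under eq_Rintegral do rewrite subr0.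
exact: noise_sgr_mean 1.
Qed.

Lemma shift_mean_lipschitz s t : `|shift_mean s - shift_mean t| <= L * `|s - t|.
Proof.
rewrite (le_trans _ (noise_sgr_lipschitz 1 s t))//.
apply: dist_Rintegral_le => //; [exact: integrable_sgr_shift..|].
by apply: integrable_norm; exact: (integrableB measurableT (integrable_sgr_shift _ _) (integrable_sgr_shift _ _)).
Qed.

Lemma shift_mean_le s : `|shift_mean s| <= L * `|s|.
Proof. by have := shift_mean_lipschitz s 0; rewrite shift_mean0 !subr0. Qed.

Lemma shift_mean_le1 s : `|shift_mean s| <= 1.
Proof.
by apply: norm_Rintegral_bounded => [|w]; [exact: measurable_sgr_shift|exact: sgr_le1].
Qed.

Lemma measurable_shift_mean : measurable_fun setT shift_mean.
Proof. by apply: continuous_measurable_fun; exact: lipschitz_continuous shift_mean_lipschitz. Qed.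

(** The jump of the sign under a shift [s], centred at its mean, so that for a shift known from the
    past the jumps are martingale differences. *)
Definition kick s e : R := Num.sg (e - s) - Num.sg e - shift_mean s.

Lemma kick_le3 s e : `|kick s e| <= 3.
Proof.
rewrite (le_trans (ler_normB _ _))// (_ : 3 = 2 + 1); last by ring.
rewrite lerD ?shift_mean_le1// (le_trans (ler_normB _ _))//.
by have := @sgr_le1 R (e - s); have := @sgr_le1 R e; lra.
Qed.

Lemma measurable_kick : measurable_fun setT (fun x : R * R => kick x.1 x.2).
Proof.
apply: measurable_funB; last exact: (measurableT_comp measurable_shift_mean measurable_fst).
apply: measurable_funB; last exact: (measurableT_comp (@measurable_sgr R) measurable_snd).
by apply: (measurableT_comp (@measurable_sgr R)); exact: measurable_funB.
Qed.

Lemma kick_mean i s : \int[P]_w kick s (eps i w) = 0.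
Proof.
have i1 : P.-integrable setT (EFin \o (fun w => Num.sg (eps i w))).
  by have := integrable_sgr_shift i 0; under eq_fun do rewrite subr0.
have i2 := integrable_sgr_shift i s.
have ic : P.-integrable setT (EFin \o (cst (shift_mean s))) by exact: finite_measure_integrable_cst.
have i12 := integrableB measurableT i2 i1.
rewrite /kick RintegralB// RintegralB// shift_meanE (integral_prob_cst P).
have := shift_meanE i 0; under eq_Rintegral do rewrite subr0.
by move=> ->; rewrite shift_mean0; ring.
Qed.

(** One factor is bounded by 3; the other has mean absolute value at most [2 L |s|], half of it from
    the jump and half from its centring. *)
Lemma kick_second_moment i s : \int[P]_w (kick s (eps i w) ^+ 2) <= 6 * L * `|s|.
Proof.
have i0 (a b : R) : P.-integrable setT (EFin \o (fun w => `|Num.sg (eps i w - a) - Num.sg (eps i w - b)|)).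
  apply: integrable_norm.
  exact: (integrableB measurableT (integrable_sgr_shift _ _) (integrable_sgr_shift _ _)).
have ic : P.-integrable setT (EFin \o (cst `|shift_mean s|)) by exact: finite_measure_integrable_cst.
have mk : measurable_fun setT (fun w => kick s (eps i w)).
  exact: (measurableT_comp measurable_kick (measurable_fun_pair (measurable_cst s) (measurable_funPT (eps i)))).
apply: (@le_trans _ _ (\int[P]_w (3 * (`|Num.sg (eps i w - s) - Num.sg (eps i w - 0)| + `|shift_mean s|)))).
  rewrite -[leLHS]ger0_norm; last by apply: Rintegral_ge0 => w _; exact: sqr_ge0.
  apply: norm_Rintegral_le => [||w].
  - exact: measurable_funX.
  - exact: (integrable_scale 3 (integrableD measurableT (i0 s 0) ic)).
  - rewrite normrX expr2 ler_pM ?kick_le3// subr0.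
    by rewrite /kick (le_trans (ler_normB _ _)).
rewrite RintegralZl//; last exact: (integrableD measurableT (i0 s 0) ic).
rewrite RintegralD// (integral_prob_cst P).
have := noise_sgr_lipschitz i s 0.
by rewrite subr0; have := shift_mean_le s; rewrite -/L; lra.
Qed.

Definition kick_remainder c n w :=
  (Num.sqrt n%:R)^-1 * \sum_(i < n) kick (c * V w) (eps i.+1%:Z w).

Lemma measurable_kick_past c i : measurable_fun setT (fun w => kick (c * V w) (eps i w)).
Proof.
exact: (measurableT_comp measurable_kick (measurable_fun_pair (measurable_funM (measurable_cst c) mV) (measurable_funPT (eps i)))).
Qed.

Lemma kick_past_square_integrable c i : square_integrable P (fun w => kick (c * V w) (eps i w)).
Proof.
by apply: (@bounded_square_integrable _ _ _ _ _ 3) => [|w];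
  [exact: measurable_kick_past|exact: kick_le3].
Qed.

Lemma kick_remainder_square_integrable c n : square_integrable P (kick_remainder c n).
Proof.
apply: square_integrableZ; apply: square_integrable_sum => i _.
exact: kick_past_square_integrable.
Qed.

(** The shift depends only on [V], so the kicks are orthogonal and each has a second moment of the
    order of its shift. The factor [V] of the score stays outside this sum, which leaves a first
    moment of [V] instead of a third. *)
Lemma kick_remainder_le c n :
  \int[P]_w (kick_remainder c n w ^+ 2) <= 6 * L * `|c| * \int[P]_w `|V w|.
Proof.
have iV := integrable_norm (square_integrable1 sV).
have C0 : 0 <= 6 * L * `|c| * \int[P]_w `|V w|.
  rewrite mulr_ge0//; last by apply: Rintegral_ge0 => w _.
  by rewrite mulr_ge0// mulr_ge0.
have mH m : measurable_fun setT ((fun x => kick (c * V x.1) x.2) : info eps (upto m) * R -> R).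
  have mcV := measurable_funM (@measurable_cst _ _ (info eps (upto m)) R setT c) (@past_value_upto m).
  exact (measurableT_comp measurable_kick
    (measurable_fun_pair (measurableT_comp mcV measurable_fst) measurable_snd)).
have ik m w : P.-integrable setT (EFin \o (fun w' => kick (c * V w) (eps m w'))).
  apply: (@bounded_integrable _ _ _ _ _ 3) => [|w']; last exact: kick_le3.
  exact: (measurableT_comp measurable_kick (measurable_fun_pair (measurable_cst (c * V w)) (measurable_funPT (eps m)))).
have sD i := kick_past_square_integrable c i.+1%:Z.
have := @martingale_square_sum _ _ _ P eps eps_indep upto (fun m => m.+1%:Z)
  (fun m x => kick (c * V x.1) x.2) upto_notin uptoS uptoSin mH
  (fun m w => ik m.+1%:Z w) (fun m w => kick_mean m.+1%:Z (c * V w)) sD n.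
rewrite /= => H.
have [_ iS] : square_integrable P (fun w => \sum_(i < n) kick (c * V w) (eps i.+1%:Z w)).
  by apply: square_integrable_sum => i _; exact: sD.
rewrite /kick_remainder; under eq_Rintegral do rewrite exprMn.
rewrite RintegralZl// H exprVn sqr_sqrtr//.
have [->|n0] := posnP n; first by rewrite big_ord0 mulr0.
rewrite mulrC ler_pdivrMr ?ltr0n// mulr_natr -[X in _ *+ X]card_ord -sumr_const.
apply: ler_sum => i _; rewrite -lee_fin -RintegralZl//.
have [_ iD] := sD i.
rewrite !EFin_Rintegral//; last exact: integrable_scale.
have mH2 : measurable_fun setT ((fun x => (kick (c * V x.1) x.2 ^+ 2)%:E) : info eps (upto i) * R -> \bar R).
  by apply/measurable_EFinP; apply: measurable_funX; exact: mH.
have := info_ge0_decouple eps_indep (@upto_notin i) mH2; rewrite /= => ->; last by move=> x; rewrite lee_fin sqr_ge0.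
apply: ge0_le_integral => //.
- by move=> w _; apply: integral_ge0 => w' _; rewrite lee_fin sqr_ge0.
- apply: (@measurable_integral_decouple _ _ _ P _ _ (info eps (upto i)) R id (eps i.+1%:Z)
    (@info_id _ _ _ P eps (upto i)) (measurable_funPT (eps i.+1%:Z)) _ mH2) => x; by rewrite lee_fin sqr_ge0.
- by apply: (measurable_int P); exact: integrable_scale.
- move=> w _; rewrite -EFin_Rintegral; last first.
    apply: (@bounded_integrable _ _ _ _ _ (3 ^+ 2)) => [|w'].
      apply: measurable_funX.
      exact: (measurableT_comp measurable_kick (measurable_fun_pair (measurable_cst (c * V w)) (measurable_funPT (eps i.+1%:Z)))).
    by rewrite normrX lerXn2r ?nnegrE// kick_le3.
  by rewrite lee_fin (le_trans (kick_second_moment _ _))// normrM !mulrA.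
Qed.

Lemma rate_past_moment n : rate n * \int[P]_w `|V w| <= (1 + sigma ^+ 2) / Num.sqrt n%:R.
Proof.
rewrite rateE mulrAC ler_wpM2r ?invr_ge0 ?sqrtr_ge0//.
have iV := integrable_norm (square_integrable1 sV); have [_ iVV] := sV.
have ic : P.-integrable setT (EFin \o (cst (1 : R))) by exact: finite_measure_integrable_cst.
rewrite -RintegralZl//.
apply: (@le_trans _ _ (\int[P]_w (1 + (1 - r ^+ 2) * V w ^+ 2))).
  apply: le_Rintegral => //; first exact: integrable_scale.
    exact: (integrableD measurableT ic (integrable_scale _ iVV)).
  move=> w _; set a := Num.sqrt (1 - r ^+ 2).
  have -> : 1 - r ^+ 2 = a ^+ 2 by rewrite sqr_sqrtr// ltW.
  rewrite -[V w ^+ 2]real_normK ?num_real// -exprMn.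
  by have := sqr_ge0 (a * `|V w| - 1); have := sqr_ge0 (a * `|V w|); nra.
rewrite RintegralD//; last exact: integrable_scale.
rewrite (integral_prob_cst P) RintegralZl// lerD2l.
have := past_value_second_moment.
by rewrite ler_pdivlMr// mulrC.
Qed.

Definition past_scale w := Num.sqrt (1 - r ^+ 2) * V w.

Definition bias_remainder t n w :=
  past_scale w * (Num.sqrt n%:R * shift_mean (t * rate n * V w) + 2 * f 0 * t * past_scale w).

(** The argument of [shift_mean] equals [t A / sqrt n] with [A = past_scale w], so the linear terms
    cancel and the quadratic error of [noise_sgr_shift] remains. *)
Lemma bias_remainder_le t n w : (0 < n)%N ->
  `|bias_remainder t n w| <= 2 * M * t ^+ 2 / Num.sqrt n%:R * `|past_scale w| ^+ 3.
Proof.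
move=> n0; pose s : R := Num.sqrt n%:R; have s0 : 0 < s by rewrite sqrtr_gt0 ltr0n.
set u := t * rate n * V w.
have uE : u = t * past_scale w / s.
  by rewrite /u rateE /past_scale -/s; field; rewrite gt_eqF.
have := noise_sgr_shift 1 u.
rewrite -/(shift_mean u) => H.
rewrite /bias_remainder -/u -/s normrM (exprS _ 2) [leRHS]mulrCA; apply: ler_wpM2l => //.
have -> : s * shift_mean u + 2 * f 0 * t * past_scale w = s * (shift_mean u + 2 * f 0 * u).
  by rewrite uE; field; rewrite gt_eqF.
rewrite normrM (ger0_norm (ltW s0)) (le_trans (ler_wpM2l (ltW s0) H))//.
rewrite real_normK ?num_real// uE le_eqVlt; apply/orP; left; apply/eqP.
by field; rewrite gt_eqF.
Qed.

Definition sign_sum n w := (Num.sqrt n%:R)^-1 * \sum_(i < n) Num.sg (eps i.+1%:Z w).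

Definition score t n w := rate n * \sum_(i < n) Y i w * Num.sg (eps i.+1%:Z w - t * rate n * Y i w).

(** Each summand splits as [(Y - V) sg e + (kink Y - kink V) + V (kick + shift_mean + sg e)]. The
    last sign gives the product of [past_scale] and [sign_sum], and [shift_mean] gives the term
    linear in [t] up to [bias_remainder]; the rest are the remainders estimated above. *)
Lemma score_decomposition t n w : (0 < n)%N ->
  score t n w - past_scale w * (sign_sum n w - 2 * f 0 * t * past_scale w) =
  drift_remainder n w + kink_remainder t n w + (past_scale w * kick_remainder (t * rate n) n w + bias_remainder t n w).
Proof.
move=> n0; pose s : R := Num.sqrt n%:R; have s0 : s != 0 by rewrite gt_eqF// sqrtr_gt0 ltr0n.
pose psi := shift_mean (t * rate n * V w).
have E : \sum_(i < n) Y i w * Num.sg (eps i.+1%:Z w - t * rate n * Y i w) =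
   \sum_(i < n) (Y i w - V w) * Num.sg (eps i.+1%:Z w) +
   \sum_(i < n) kink_gap (t * rate n) i w +
   V w * (\sum_(i < n) kick (t * rate n * V w) (eps i.+1%:Z w) + s ^+ 2 * psi
     + \sum_(i < n) Num.sg (eps i.+1%:Z w)).
  rewrite sqr_sqrtr// mulr_natl -[X in _ *+ X]card_ord -sumr_const -!big_split/= mulr_sumr -big_split/=.
  by apply: eq_bigr => i _; rewrite /kink_gap /kink /kick /psi; ring.
rewrite /score E /drift_remainder /kink_remainder /kick_remainder /bias_remainder /sign_sum -/psi.
rewrite /past_scale rateE -/s.
by field.
Qed.

End fixed_coefficient.

(** * Coefficients tending to one *)

Variable rho : nat -> R.
Hypothesis rho_itv : forall n, 0 < rho n < 1.
Hypothesis rho_cvg : n%:R * (rho n - 1) @[n --> \oo] --> (0 : R).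

Lemma theta_cvg : n%:R * (1 - rho n) @[n --> \oo] --> (0 : R).
Proof.
rewrite -oppr0 (_ : (fun n => _) = (fun n => - (n%:R * (rho n - 1)))).
  exact: cvgN.
by apply/funext => n; rewrite -mulrN opprB.
Qed.

Lemma cvg_sqr1 : (1 - rho n ^+ 2) @[n --> \oo] --> (0 : R).
Proof.
apply: (@squeeze_cvgr _ _ _ _ (fun=> 0) (fun n => 2 * (n%:R * (1 - rho n)))).
- near=> n; have /andP[r0 r1] := rho_itv n; rewrite ltW ?sqr1_gt0//=.
  have n1 : 1 <= n%:R :> R by rewrite ler1n; near: n; exact: nbhs_infty_gt.
  have h : 0 <= (n%:R - 1) * (1 - rho n) by rewrite mulr_ge0// subr_ge0// ltW.
  by nra.
- exact: cvg_cst.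
- by rewrite -[X in _ --> X](mulr0 2); apply: cvgM; [exact: cvg_cst|exact: theta_cvg].
Unshelve. all: by end_near. Qed.

Lemma cvg_sqrt_sqr1 : Num.sqrt (1 - rho n ^+ 2) @[n --> \oo] --> (0 : R).
Proof.
rewrite -[X in _ --> X]sqrtr0.
exact: (cvg_comp _ _ cvg_sqr1 (@sqrt_continuous R 0)).
Qed.

Lemma cvg_increment_bound : increment_bound (rho n) n @[n --> \oo] --> (0 : R).
Proof.
rewrite /increment_bound -(mulr0 (2 * sigma ^+ 2)); apply: cvgM; first exact: cvg_cst.
rewrite -(addr0 0); apply: cvgD.
  rewrite -[X in _ --> X](expr0n _ 2)/=.
  exact: (cvg_comp _ _ theta_cvg (@exprn_continuous _ 2 _)).
by rewrite -(mulr0 2); apply: cvgM; [exact: cvg_cst|exact: theta_cvg].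
Qed.

Lemma cvg_gap_bound : gap_bound (rho n) n @[n --> \oo] --> (0 : R).
Proof.
have s0 : Num.sqrt (increment_bound (rho n) n) @[n --> \oo] --> (0 : R).
  rewrite -[X in _ --> X]sqrtr0.
  exact: (cvg_comp _ _ cvg_increment_bound (@sqrt_continuous R 0)).
rewrite /gap_bound -(addr0 0) -{1}(addr0 0); apply: cvgD.
  by apply: cvgD => //; exact: cvg_increment_bound.
rewrite -(mul0r (sigma ^+ 2)); apply: cvgM; last exact: cvg_cst.
by rewrite -(addr0 0); apply: cvgD => //; exact: cvg_harmonic.
Qed.

Hypothesis past_cvg : forall n,
  {ae P, forall w, cvgn (series (fun j => rho n ^+ j * eps (- j%:Z) w))}.

Let A n := past_scale (rho n).
Let B n := sign_sum n.
Let sV n : square_integrable P (past_value (rho n)) :=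
  past_value_square_integrable (rho_itv n) (@past_cvg n).

Lemma past_scale_square_integrable n : square_integrable P (A n).
Proof. exact: square_integrableZ. Qed.

Lemma past_scale_tight : tight P A.
Proof.
apply: (@tight_L2 _ _ _ _ _ (sigma ^+ 2)); first exact: past_scale_square_integrable.
move=> n; have k0 := sqr1_gt0 (rho_itv n).
rewrite /A /past_scale; under eq_Rintegral do rewrite exprMn sqr_sqrtr ?(ltW k0)//.
have [_ iV] := sV n; rewrite RintegralZl//.
have := past_value_second_moment (rho_itv n) (@past_cvg n).
by rewrite ler_pdivlMr// mulrC.
Qed.

Lemma sgr_square_integrable i : square_integrable P (fun w => Num.sg (eps i w)).
Proof.
apply: (@bounded_square_integrable _ _ _ _ _ 1) => [|w]; last exact: sgr_le1.
exact: (measurableT_comp (@measurable_sgr R)).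
Qed.

Lemma sgr_second_moment i : \int[P]_w (Num.sg (eps i w) ^+ 2) = 1 ^+ 2.
Proof.
have ms : measurable_fun setT (fun w => Num.sg (eps i w) ^+ 2).
  by apply: measurable_funX; exact: (measurableT_comp (@measurable_sgr R)).
rewrite expr1n -[RHS](integral_prob_cst P) /Rintegral; congr fine.
apply: ae_eq_integral => //; first exact/measurable_EFinP.
have p0 : P (eps i @^-1` [set 0]) = 0%E.
  have m0 : measurable (eps i @^-1` [set (0 : R)]) by exact: measurable_funPTI.
  by rewrite -EFin_pr// (pr_point).
have m0 : measurable (eps i @^-1` [set (0 : R)]) by exact: measurable_funPTI.
exists (eps i @^-1` [set 0]); split => // w /= H; apply: contrapT => e0; apply: H => _.
by rewrite sqr_sg; case: eqP.
Qed.

Lemma sign_sum_square_integrable n : square_integrable P (B n).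
Proof.
by apply: square_integrableZ; apply: square_integrable_sum => i _; exact: sgr_square_integrable.
Qed.

Lemma sign_sum_tight : tight P B.
Proof.
apply: (@tight_L2 _ _ _ _ _ 1); first exact: sign_sum_square_integrable.
move=> n.
have := @weighted_sum_second_moment _ _ _ P eps eps_indep upto (fun m => m.+1%:Z) Num.sg 1
  (fun=> (Num.sqrt n%:R)^-1) upto_notin uptoS uptoSin (@measurable_sgr R) sgr_square_integrable
  (noise_sgr_mean) sgr_second_moment n.
under eq_Rintegral do rewrite -mulr_sumr.
rewrite -/(sign_sum n) => ->; rewrite expr1n mul1r sumr_const card_ord exprVn sqr_sqrtr//.
have [->|n0] := posnP n; first by rewrite mulr0n.
by rewrite -[leLHS]mulr_natl mulfV// pnatr_eq0 -lt0n.
Qed.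

Let mA n : measurable_fun setT (A n) := (past_scale_square_integrable n).1.

Lemma measurable_score t n : measurable_fun setT (score (rho n) t n).
Proof.
apply: measurable_funM => //; apply: measurable_sum => i.
have [mY _] := ar_path_square_integrable (rho_itv n) (@past_cvg n) i.
apply: measurable_funM => //; apply: (measurableT_comp (@measurable_sgr R)).
by apply: measurable_funB => //; exact: measurable_funM.
Qed.

Lemma score_negligible t : negligible_in_prob P (fun n w =>
  score (rho n) t n w - A n w * (B n w - 2 * f 0 * t * A n w)).
Proof.
pose s n : R := (Num.sqrt n%:R)^-1.
have s0 : s n @[n --> \oo] --> (0 : R) by exact: cvg_invr_sqrt_nat.
have bnd0 c (b : nat -> R) : b n @[n --> \oo] --> (0 : R) -> c * b n @[n --> \oo] --> (0 : R).
  by move=> b0; rewrite -(mulr0 c); apply: cvgM => //; exact: cvg_cst.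
have L0 : 0 <= 2 * (M + 1) by rewrite mulr_ge0// addr_ge0// (le_trans (normr_ge0 _) (f'_bounded 0)).
have N1 : negligible_in_prob P (fun n => drift_remainder (rho n) n).
  apply: (@negligible_in_prob_L2 _ _ _ _ _ (fun n => increment_bound (rho n) n)).
  - move=> n; exact: (drift_remainder_square_integrable (rho_itv n) (@past_cvg n)).
  - move=> n; exact: (drift_remainder_le (rho_itv n) (@past_cvg n)).
  - exact: cvg_increment_bound.
have N2 : negligible_in_prob P (fun n => kink_remainder (rho n) t n).
  have ik n := kink_remainder_integrable (rho_itv n) (@past_cvg n) t n.
  apply: (@negligible_in_prob_L1 _ _ _ _ _ (fun n => 2 * (M + 1) * `|t| * gap_bound (rho n) n)).
  - by move=> n; apply/measurable_EFinP; exact: (measurable_int P).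
  - exact: ik.
  - by apply: nearW => n; exact: (kink_remainder_le (rho_itv n) (@past_cvg n)).
  - by apply: bnd0; exact: cvg_gap_bound.
have N3 : negligible_in_prob P (fun n => kick_remainder (rho n) (t * rate (rho n) n) n).
  apply: (@negligible_in_prob_L2 _ _ _ _ _ (fun n => 6 * (2 * (M + 1)) * `|t| * (1 + sigma ^+ 2) * s n)).
  - move=> n; exact: (kick_remainder_square_integrable (rho_itv n) (@past_cvg n)).
  - move=> n.
    rewrite (le_trans (kick_remainder_le (rho_itv n) (@past_cvg n) _ _))//.
    rewrite normrM (ger0_norm (rate_ge0 _ _)) -!mulrA !ler_wpM2l//.
      by have := L0; rewrite pmulr_rge0.
    exact: (rate_past_moment (rho_itv n) (@past_cvg n)).
  - exact: bnd0.
have N4 : negligible_in_prob P (fun n => bias_remainder (rho n) t n).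
  apply: (@negligible_in_prob_dominated _ _ _ _ _ (fun n w => (2 * M * t ^+ 2 * s n) * `|A n w| ^+ 3)).
  - move=> n; apply: measurable_funM; first exact: mA.
    apply: measurable_funD; last by apply: measurable_funM => //; exact: mA.
    apply: measurable_funM => //.
    apply: (measurableT_comp (measurable_shift_mean)).
    by apply: measurable_funM => //; case: (sV n).
  - apply: negligible_in_probM; last by apply: tight_norm_exp; exact: past_scale_tight.
    by apply: negligible_in_prob_cst; exact: bnd0.
  - near=> n => w; rewrite (le_trans (@bias_remainder_le _ (rho_itv n) t n w _))//.
      by near: n; exact: nbhs_infty_gt.
    by rewrite ler_norm.
apply: (negligible_in_prob_dominated _ (negligible_in_probD (negligible_in_probD N1 N2)
  (negligible_in_probD (negligible_in_probM N3 past_scale_tight) N4))) => [n|].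
  apply: measurable_funB; first exact: measurable_score.
  apply: measurable_funM => //; apply: measurable_funB; first by case: (sign_sum_square_integrable n).
  exact: measurable_funM.
near=> n => w; rewrite (@score_decomposition (rho n) (rho_itv n))//.
  by rewrite [in leRHS](mulrC _ (A n w)).
by near: n; exact: nbhs_infty_gt.
Unshelve. all: by end_near. Qed.

Lemma square_sum_negligible : negligible_in_prob P (fun n w =>
  (1 - rho n ^+ 2) / n%:R * \sum_(i < n) ar_path (rho n) i w ^+ 2 - A n w ^+ 2).
Proof.
have sY n i := ar_path_square_integrable (rho_itv n) (@past_cvg n) i.
have iS n : P.-integrable setT (EFin \o (fun w => (1 - rho n ^+ 2) / n%:R * \sum_(i < n) ar_path (rho n) i w ^+ 2 - A n w ^+ 2)).
  have [_ iA] := past_scale_square_integrable n.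
  have [i1 _] := sum_integrable (fun i => (sY n i).2) n.
  exact: (integrableB measurableT (integrable_scale _ i1) iA).
apply: (@negligible_in_prob_L1 _ _ _ _ _ (fun n => gap_bound (rho n) n)).
- by move=> n; apply/measurable_EFinP; exact: (measurable_int P).
- exact: iS.
- near=> n; rewrite (le_trans _ (square_sum_gap_le (rho_itv n) (@past_cvg n) _))//.
    by rewrite /A /past_scale; under eq_Rintegral do rewrite exprMn sqr_sqrtr ?(ltW (sqr1_gt0 (rho_itv n)))//.
  by near: n; exact: nbhs_infty_gt.
- exact: cvg_gap_bound.
Unshelve. all: by end_near. Qed.

Let s_gt0 : 0 < sigma := sigma_gt0.
Let mB n : measurable_fun setT (B n) := (sign_sum_square_integrable n).1.

(** The threshold in [n] precedes [g], because in [joint_limit] the test function depends on the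
    value of [A]. *)
Lemma sign_sum_clt Mg K e : 0 <= Mg -> 0 <= K -> 0 < e ->
  \forall n \near \oo, forall g, bounded_lipschitz Mg K g ->
    `|\int[P]_w g (B n w) - \int[N01]_z g z| <= e.
Proof.
move=> Mg0 K0 e0.
have [a a0 Ha] := @weighted_sum_clt_uniform _ _ _ P eps eps_indep eps_ident upto (fun m => m.+1%:Z) Num.sg 1
  upto_notin uptoS uptoSin (@measurable_sgr R) ler01 (sgr_square_integrable)
  (noise_sgr_mean)
  (sgr_second_moment) Mg K e Mg0 K0 e0.
have /cvgrPdist_le/(_ _ a0) Hs := @cvg_invr_sqrt_nat R.
near=> n => g bg.
have n0 : (0 < n)%N by near: n; exact: nbhs_infty_gt.
have w1 : \sum_(i < n) (Num.sqrt (n%:R : R))^-1 ^+ 2 = 1.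
  by rewrite sumr_const card_ord exprVn sqr_sqrtr// -[LHS]mulr_natl mulfV// pnatr_eq0 -lt0n.
have := Ha (fun=> (Num.sqrt n%:R)^-1) (Num.sqrt n%:R)^-1 n g.
rewrite w1 sqrtr1 mulr1.
under [X in `|_ - X|]eq_Rintegral do rewrite mul1r.
under eq_Rintegral do rewrite -mulr_sumr.
apply => //.
- by move=> _; rewrite lexx invr_ge0 sqrtr_ge0.
- rewrite -[leLHS]ger0_norm ?invr_ge0 ?sqrtr_ge0// -normrN -[X in `|X|]sub0r.
  by near: n; exact: Hs.
Unshelve. all: by end_near. Qed.

(** At fixed [n], [A n] is an almost sure limit of weighted sums with weights [q rho^j], none above
    [q = sqrt (1 - rho^2)] and with squares adding up to at most 1. The central limit bound is
    uniform in the number of terms, so it survives the passage to the infinite sum, and [q] tends to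
    0 with [n]. *)
Lemma past_scale_clt Mg K g e : bounded_lipschitz Mg K g -> 0 < e ->
  \forall n \near \oo, `|\int[P]_w g (A n w) - \int[N01]_z g (sigma * z)| <= e.
Proof.
move=> bg e0; have [Mg0 K0] := bounded_lipschitz_ge0 bg.
have [a a0 Ha] := @weighted_sum_clt_uniform _ _ _ P eps eps_indep eps_ident between (fun m => - m%:Z) id sigma
  between_notin betweenS betweenSin (@measurable_id _ _ _) sigma_ge0
  (noise_square_integrable) (noise_mean) (noise_variance)
  Mg K e Mg0 K0 e0.
have /cvgrPdist_le/(_ _ a0) Hs := cvg_sqrt_sqr1.
near=> n; have k0 := sqr1_gt0 (rho_itv n); have /andP[r0 r1] := rho_itv n.
have qa : Num.sqrt (1 - rho n ^+ 2) <= a.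
  rewrite -[leLHS]ger0_norm ?sqrtr_ge0// -normrN -[X in `|X|]sub0r.
  by near: n; exact: Hs.
pose q := Num.sqrt (1 - rho n ^+ 2); have q0 : 0 <= q by exact: sqrtr_ge0.
pose w j := q * rho n ^+ j.
have sumE m : \sum_(j < m) w j ^+ 2 = 1 - (rho n ^+ 2) ^+ m.
  have -> : \sum_(j < m) w j ^+ 2 = (1 - rho n ^+ 2) * \sum_(j < m) (rho n ^+ 2) ^+ j.
    rewrite mulr_sumr; apply: eq_bigr => j _.
    by rewrite /w exprMn sqr_sqrtr ?(ltW k0)// -!exprM mulnC.
  by rewrite -[LHS]opprK -mulNr opprB -subrX1 opprB.
have r2 : 0 <= rho n ^+ 2 by exact: sqr_ge0.
have H m : `|\int[P]_t g (q * past_sum (rho n) m t) -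
    \int[N01]_z g (sigma * Num.sqrt (1 - (rho n ^+ 2) ^+ m) * z)| <= e.
  have := Ha w q m g; rewrite sumE.
  under eq_Rintegral do under eq_bigr do rewrite -mulrA.
  under eq_Rintegral do rewrite -mulr_sumr.
  apply => //.
  - move=> i; have ri : 0 <= rho n ^+ i by rewrite exprn_ge0// ltW.
    by rewrite mulr_ge0//= ler_piMr// exprn_ile1// ltW.
  - by rewrite gerBl exprn_ge0.
have mS m : measurable_fun setT (past_sum (rho n) m).
  by case: (past_sum_square_integrable (rho n) m).
have C1 : \int[P]_t g (q * past_sum (rho n) m t) @[m --> \oo] --> \int[P]_w g (A n w).
  apply: (cvg_Rintegral_bounded_lipschitz bg) => //.
  - by move=> m; exact: measurable_funM.
  - apply: filterS (past_sum_cvg (@past_cvg n)) => t Ht.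
    by apply: cvgM => //; exact: cvg_cst.
have C2 : \int[N01]_z g (sigma * Num.sqrt (1 - (rho n ^+ 2) ^+ m) * z) @[m --> \oo] --> \int[N01]_z g (sigma * z).
  apply: (cvg_Rintegral_bounded_lipschitz bg) => //.
  - by move=> m; exact: measurable_funM.
  - apply: aeW => z; apply: cvgM; last exact: cvg_cst.
    rewrite -[X in _ --> X](mulr1 sigma); apply: cvgM; first exact: cvg_cst.
    have h : 1 - (rho n ^+ 2) ^+ m @[m --> \oo] --> (1 : R).
      rewrite -[X in _ --> X](subr0 1); apply: cvgB; first exact: cvg_cst.
      by apply: cvg_expr; rewrite ger0_norm// expr_lt1// ltW.
    rewrite -[X in _ --> X]sqrtr1.
    exact: (cvg_comp _ _ h (@sqrt_continuous R 1)).
have C : `|\int[P]_t g (q * past_sum (rho n) m t) -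
    \int[N01]_z g (sigma * Num.sqrt (1 - (rho n ^+ 2) ^+ m) * z)| @[m --> \oo] -->
    `|\int[P]_w g (A n w) - \int[N01]_z g (sigma * z)|.
  by apply: cvg_norm; exact: cvgB.
rewrite -(cvg_lim _ C)//; apply: limr_le; first by apply/cvg_ex; eexists; exact: C.
exact: nearW.
Unshelve. all: by end_near. Qed.

Lemma past_scale_small_ball e : 0 < e ->
  exists2 eta, 0 < eta & \forall n \near \oo, pr P [set w | `|A n w| <= eta] <= e.
Proof.
move=> e0; pose p : R := normal_peak 1.
have p0 : 0 < p by rewrite normal_peak_gt0// oner_neq0.
(* At radius [b = 2 eta / sigma] the Gaussian small-ball bound [2 p b] equals [e / 4]. *)
pose eta := e * sigma / (16 * p).
have eta0 : 0 < eta by rewrite divr_gt0 ?mulr_gt0.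
exists eta => //.
have e4 : 0 < e / 4 by rewrite divr_gt0.
(* A Lipschitz tent, at least 1/2 where [|x| <= eta] and zero beyond [2 eta]. Markov's inequality at
   level 1/2 doubles its integral, which is at most [e / 4 + e / 4]. *)
pose tent (x : R) : R := Num.max 0 (1 - `|x| / (2 * eta)).
have eta20 : 0 < 2 * eta by rewrite mulr_gt0.
have tent0 x : 0 <= tent x by rewrite /tent le_max lexx.
have tent1 x : tent x <= 1 by rewrite /tent ge_max ler01 gerBl divr_ge0// ltW.
have bt : bounded_lipschitz 1 (2 * eta)^-1 tent.
  split => [x|x y]; first by rewrite ger0_norm.
  have H x' y' : tent x' - tent y' <= (2 * eta)^-1 * `|x' - y'|.
    rewrite lerBlDr {1}/tent ge_max; apply/andP; split.
      by rewrite addr_ge0// mulr_ge0// invr_ge0 ltW.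
    have : 1 - `|y'| / (2 * eta) <= tent y' by rewrite /tent le_max lexx orbT.
    have : `|y'| <= `|x'| + `|x' - y'|.
      by rewrite -[X in `|X| <= _](subKr x' y') ler_normB.
    move: (2 * eta)^-1 (invr_ge0 (2 * eta)) => i i0.
    have {}i0 : 0 <= i by rewrite i0 ltW.
    by move=> /(ler_wpM2r i0); lra.
  by rewrite ler_norml lerNl opprB H andbT distrC H.
have mt := bounded_lipschitz_measurable bt.
have gauss : \int[N01]_z tent (sigma * z) <= e / 4.
  have mE : measurable [set z : measurableTypeR R | `|z| <= 2 * eta / sigma].
    by rewrite norm_le_itv.
  have mts : measurable_fun [set: measurableTypeR R] (fun z : R => tent (sigma * z)).
    by apply: measurableT_comp mt _; exact: measurable_funM.
  have := @dist_Rintegral_event _ _ _ N01 (fun z => tent (sigma * z)) (fun=> 0)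
    [set z : measurableTypeR R | `|z| <= 2 * eta / sigma] 1 0 1 mts (measurable_cst _) _ _ mE (lexx 0) ler01.
  rewrite (integral_prob_cst N01) subr0 add0r mul1r => H.
  apply: (le_trans (ler_norm _)); apply: (le_trans (H _ _ _ _)).
  - by move=> z; rewrite ger0_norm.
  - by move=> z; rewrite normr0.
  - by move=> z; rewrite subr0 ger0_norm.
  - move=> z /= /negP; rewrite -ltNge => zb; rewrite subr0 ger0_norm// /tent ge_max lexx/=.
    rewrite subr_le0 ler_pdivlMr// mul1r normrM (gtr0_norm s_gt0) -ler_pdivrMl//.
    by rewrite mulrC ltW.
  - apply: (le_trans (gaussian_small_ball _)); first by rewrite divr_ge0// ltW.
    rewrite -/p le_eqVlt; apply/orP; left; apply/eqP.
    by rewrite /eta; field; rewrite !gt_eqF.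
apply: filterS (past_scale_clt bt e4) => n Hn.
have mE : measurable [set w | `|A n w| <= eta].
  rewrite -[X in measurable X]setTI; apply: measurable_fun_le => //.
  exact: measurableT_comp.
have it : P.-integrable setT (EFin \o (fun w => tent (A n w))).
  exact (integrable_bounded_lipschitz P (mA n) bt).
have Et : \int[P]_w tent (A n w) <= e / 2.
  move: Hn; rewrite ler_norml => /andP[_]; rewrite lerBlDr => /le_trans; apply.
  by apply: (@le_trans _ _ (e / 4 + e / 4)); [rewrite lerD2l|lra].
have half : 0 < 2^-1 :> R by rewrite invr_gt0.
apply: (@le_trans _ _ (pr P [set w | 2^-1 <= tent (A n w)])).
  apply: le_pr => //.
    rewrite -[X in measurable X]setTI; apply: measurable_fun_le => //.
    exact: measurableT_comp mt (mA n).
  move=> w /= wA; rewrite /tent le_max; apply/orP; right.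
  have : `|A n w| / (2 * eta) <= 2^-1.
    by rewrite ler_pdivrMr// mulrA mulVf ?mul1r// pnatr_eq0.
  by lra.
rewrite (le_trans (pr_markov it _ half))// invrK.
by lra.
Qed.

Lemma past_scale_info n : measurable_fun setT (A n : info eps (upto 0) -> R).
Proof.
have mr := @measurable_cst _ _ (info eps (upto 0)) R setT (Num.sqrt (1 - rho n ^+ 2)).
exact (measurable_funM mr (past_value_info (rho n))).
Qed.

Lemma sign_sum_info n : measurable_fun setT (B n : info eps [set i | (0 < i)%R] -> R).
Proof.
have mr := @measurable_cst _ _ (info eps [set i | (0 < i)%R]) R setT (Num.sqrt n%:R)^-1.
have ms : measurable_fun setT ((fun w => \sum_(i < n) Num.sg (eps i.+1%:Z w)) : info eps [set i | (0 < i)%R] -> R).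
  apply: measurable_sum => i.
  have me := @info_eps _ _ _ P eps [set i | (0 < i)%R] i.+1%:Z isT.
  exact (measurableT_comp (@measurable_sgr R) me).
exact (measurable_funM mr ms).
Qed.

Lemma past_future_independent n (C D : set R) : measurable C -> measurable D ->
  P (A n @^-1` C `&` B n @^-1` D) = (P (A n @^-1` C) * P (B n @^-1` D))%E.
Proof.
move=> mC mD.
apply: (@info_independent _ _ _ _ _ eps_indep _ _ _ _ (upto 0) [set i | (0 < i)%R]) => //.
- by move=> i; rewrite /upto/= => i0; rewrite ltNge i0.
- exact: past_scale_info.
- exact: sign_sum_info.
Qed.

(** By independence [A n] can be frozen at [a] and [B n] replaced by a normal variable, uniformly
    over [|a| > eta] because the bounds on [Phi (a, .)] are uniform there. On the remaining event
    only boundedness is used. *)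
Lemma joint_limit (Phi : R * R -> R) (H : R -> R) Mb K eta e :
  measurable_fun setT Phi -> (forall x, `|Phi x| <= Mb) -> 0 <= K -> 0 < e ->
  (forall a, eta < `|a| -> bounded_lipschitz Mb K (fun b => Phi (a, b))) ->
  measurable_fun setT H -> (forall a, `|H a| <= Mb) ->
  (forall a, eta < `|a| -> \int[N01]_z Phi (a, z) = H a) ->
  \forall n \near \oo, `|\int[P]_w Phi (A n w, B n w) - \int[P]_w H (A n w)| <=
    e + (Mb + Mb) * pr P [set w | `|A n w| <= eta].
Proof.
move=> mPhi PhiM K0 e0 bPhi mH HM PhiH.
have Mg0 : 0 <= Mb by exact: le_trans (normr_ge0 _) (HM 0).
apply: filterS (sign_sum_clt Mg0 K0 e0) => n Hn.
rewrite (Rintegral_decouple (@mA n) (@mB n) (@past_future_independent n) mPhi PhiM).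
have mPa a : measurable_fun setT (fun w => Phi (a, B n w)).
  exact: (measurableT_comp mPhi (measurable_fun_pair (measurable_cst a) (@mB n))).
have mPhiM : measurable_fun setT (fun x => (Phi x + Mb)%:E).
  by apply/measurable_EFinP; exact: measurable_funD.
have Phi0 x : (0 <= (Phi x + Mb)%:E)%E by have := PhiM x; rewrite lee_fin ler_norml; lra.
have mU : measurable_fun setT (fun w => \int[P]_w' Phi (A n w, B n w')).
  have mI := measurable_integral_decouple P (@mA n) (@mB n) mPhiM Phi0.
  have iM : P.-integrable setT (EFin \o (cst Mb)) by exact: finite_measure_integrable_cst.
  have iP w : P.-integrable setT (EFin \o (fun w' => Phi (A n w, B n w'))).
    by apply: (@bounded_integrable _ _ _ _ _ Mb).
  rewrite (_ : (fun w => _) = (fun w => (\int[P]_w' Phi (A n w, B n w') + Mb) - Mb)); last first.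
    by apply/funext => w; rewrite addrK.
  apply: measurable_funB => //; apply/measurable_EFinP; apply: eq_measurable_fun mI => w _ /=.
  rewrite -[in RHS](integral_prob_cst P Mb) -RintegralD// EFin_Rintegral//.
  exact: (integrableD measurableT (iP w) iM).
apply: (@dist_Rintegral_event _ _ _ P (fun w => \int[P]_w' Phi (A n w, B n w')) (fun w => H (A n w))
  [set w | `|A n w| <= eta] Mb) => //.
- exact: measurableT_comp mH (@mA n).
- by move=> w; apply: norm_Rintegral_bounded.
- rewrite -[X in measurable X]setTI; apply: measurable_fun_le => //.
  exact: measurableT_comp.
- exact: ltW.
- exact: addr_ge0.
- move=> w; rewrite (le_trans (ler_normB _ _))// lerD//.
  exact: norm_Rintegral_bounded.
- move=> w /= /negP; rewrite -ltNge => wA.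
  by rewrite -(PhiH _ wA); exact: Hn (bPhi _ wA).
Qed.

Let c := f 0.
Hypothesis c0 : 0 < c.

Lemma past_scale_pr_le (a b : R) n : a <= b ->
  pr P [set w | `|A n w| <= a] <= pr P [set w | `|A n w| <= b].
Proof.
move=> ab; have mE x : measurable [set w | `|A n w| <= x].
  rewrite -[X in measurable X]setTI; apply: measurable_fun_le => //.
  exact: measurableT_comp.
by apply: le_pr => // w /= /le_trans; apply.
Qed.

(** By symmetry of the normal law the factor [sg a] has no effect when [a != 0], so the limit
    function [H] is constant. *)
Lemma sign_limit Mg K g e : bounded_lipschitz Mg K g -> 0 < e ->
  \forall n \near \oo,
    `|\int[P]_w g (Num.sg (A n w) * B n w / (2 * c)) - \int[N01]_z g (z / (2 * c))| <= e.
Proof.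
move=> bg e0; have [Mg0 K0] := bounded_lipschitz_ge0 bg; have [gM gK] := bg.
have mg := bounded_lipschitz_measurable bg.
have e2 : 0 < e / 2 by rewrite divr_gt0.
have e4 : 0 < e / 2 / (Mg + Mg + 1) by rewrite divr_gt0// ltr_wpDl// addr_ge0.
have [eta eta0 Heta] := past_scale_small_ball e4.
pose Phi (x : R * R) := g (Num.sg x.1 * x.2 / (2 * c)).
have c20 : 0 < (2 * c)^-1 by rewrite invr_gt0 mulr_gt0.
have mPhi : measurable_fun setT Phi.
  apply: (measurableT_comp mg); apply: measurable_funM => //; apply: measurable_funM => //.
  exact: (measurableT_comp (@measurable_sgr R) measurable_fst).
pose H (a : R) := \int[N01]_z g (z / (2 * c)).
have blin (b : R) : bounded_lipschitz Mg (K * `|b|) (fun x => g (x * b)).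
  have := bounded_lipschitz_affine 0 b bg.
  by under eq_fun do rewrite add0r mulrC.
have HM a : `|H a| <= Mg.
  by apply: norm_Rintegral_bounded => //; apply: (measurableT_comp mg); exact: measurable_funM.
have bPhi a : eta < `|a| -> bounded_lipschitz Mg (K / (2 * c)) (fun b => Phi (a, b)).
  move=> ea; split => [x|x y]; first exact: gM.
  apply: (le_trans (gK _ _)); rewrite -[leRHS]mulrA; apply: ler_wpM2l => //=.
  rewrite -mulrBl -mulrBr !normrM (gtr0_norm c20).
  by rewrite mulrC ler_wpM2l ?(ltW c20)// ler_piMl// sgr_le1.
have PhiH a : eta < `|a| -> \int[N01]_z Phi (a, z) = H a.
  move=> ea; have a0 : a != 0 by rewrite -normr_gt0 (lt_trans eta0).
  rewrite /Phi/H /=; have [an|ap|] := ltgtP a 0; last by move/eqP; rewrite (negbTE a0).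
    rewrite -(Rintegral_normal_oppr (blin (2 * c)^-1)); apply: eq_Rintegral => z _.
    by rewrite ltr0_sg// mulN1r.
  by apply: eq_Rintegral => z _; rewrite gtr0_sg// mul1r.
have Kc : 0 <= K / (2 * c) by rewrite mulr_ge0// ltW.
have J := joint_limit mPhi (fun x => gM _) Kc e2 bPhi (measurable_cst _) HM PhiH.
near=> n.
have Jn : `|\int[P]_w Phi (A n w, B n w) - \int[P]_w H (A n w)| <=
    e / 2 + (Mg + Mg) * pr P [set w | `|A n w| <= eta] by near: n; exact: J.
rewrite /H (integral_prob_cst P) in Jn.
apply: (le_trans Jn); rewrite [leRHS]splitr lerD2l.
have pn : pr P [set w | `|A n w| <= eta] <= e / 2 / (Mg + Mg + 1) by near: n; exact: Heta.
apply: (@le_trans _ _ ((Mg + Mg) * (e / 2 / (Mg + Mg + 1)))).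
  by rewrite ler_wpM2l// addr_ge0.
rewrite mulrCA ler_piMr ?(ltW e2)// ler_pdivrMr ?ltr_wpDl ?addr_ge0//.
by rewrite mul1r lerDl.
Unshelve. all: by end_near. Qed.

(** The quotient is singular at [a = 0], so the limit function divides by [max(|a|, eta)], which
    makes it Lipschitz and lets [past_scale_clt] apply. The truncation is undone afterwards under
    the Gaussian law, where the ratio formula produces the Cauchy variable. *)
Lemma ratio_limit Mg K g e : bounded_lipschitz Mg K g -> 0 < e ->
  \forall n \near \oo,
    `|\int[P]_w g (B n w / (2 * c * A n w)) - \int[cauchy_prob]_u g (u / (2 * sigma * c))| <= e.
Proof.
move=> bg e0; have [Mg0 K0] := bounded_lipschitz_ge0 bg; have [gM gK] := bg.
have mg := bounded_lipschitz_measurable bg.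
have e4 : 0 < e / 4 by rewrite divr_gt0.
have M1 : 0 < Mg + Mg + 1 by rewrite ltr_wpDl// addr_ge0.
pose e' := e / 4 / (Mg + Mg + 1); have e'0 : 0 < e' by rewrite divr_gt0.
have Me' : (Mg + Mg) * e' <= e / 4.
  by rewrite /e' mulrCA ler_piMr ?(ltW e4)// ler_pdivrMr// mul1r lerDl.
have [eta1 eta10 Heta] := past_scale_small_ball e'0.
pose p : R := normal_peak 1.
have p0 : 0 < p by rewrite normal_peak_gt0// oner_neq0.
(* The first bound controls the event [|A n| <= eta], the second the Gaussian event
   [|z| <= eta / sigma]. *)
pose eta := Num.min eta1 (e' * sigma / (2 * p)).
have eta0 : 0 < eta by rewrite lt_min eta10/=; apply: divr_gt0; exact: mulr_gt0.
have eta_small : 2 * p * (eta / sigma) <= e'.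
  have p2 : 0 < 2 * p by exact: mulr_gt0.
  have h : eta <= e' * sigma / (2 * p) by rewrite /eta ge_min lexx orbT.
  by rewrite ler_pdivlMr// in h; rewrite mulrA ler_pdivrMr// mulrC.
pose Phi (x : R * R) := g (x.2 / (2 * c * x.1)).
have mPhi : measurable_fun setT Phi.
  by apply: (measurableT_comp mg); apply: measurable_divr => //; exact: measurable_funM.
pose q (a : R) := 2 * c * Num.max `|a| eta.
have q0 a : 0 < q a by rewrite !mulr_gt0// lt_max eta0 orbT.
have blin (b : R) : bounded_lipschitz Mg (K * `|b|) (fun x => g (x * b)).
  have := bounded_lipschitz_affine 0 b bg.
  by under eq_fun do rewrite add0r mulrC.
have mgb (b : R) : measurable_fun [set: measurableTypeR R] (fun z : R => g (z * b)).
  by apply: (measurableT_comp mg); exact: measurable_funM.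
pose H (a : R) := \int[N01]_z g (z / q a).
have HM a : `|H a| <= Mg by apply: norm_Rintegral_bounded.
have inorm : N01.-integrable setT (EFin \o (fun z : measurableTypeR R => `|z : R|)).
  exact: (integrable_norm (square_integrable1 (@gaussian_square_integrable R))).
(* [1 / q] is Lipschitz with constant [1 / (2 c eta^2)]; the other factor is the mean of the
   multiplier [|z|]. *)
pose L := K / (2 * c * eta ^+ 2) * \int[N01]_z `|z|.
have bH : bounded_lipschitz Mg L H.
  split => [//|a b].
  rewrite /L mulrAC -RintegralZl//.
  have igb (x : R) : N01.-integrable setT (EFin \o (fun z : measurableTypeR R => g (z * x))).
    exact (bounded_integrable N01 (mgb x) (fun z => gM _)).
  apply: dist_Rintegral_le => //; first exact: integrable_scale.
  move=> z; rewrite (le_trans (gK _ _))// -mulrBr normrM [leRHS]mulrC mulrCA ler_wpM2l//.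
  rewrite -!mulrA ler_wpM2l//.
  have maxL : `|Num.max `|b| eta - Num.max `|a| eta| <= `|a - b|.
    have maxH (x y : R) : Num.max `|x| eta <= `|x - y| + Num.max `|y| eta.
      rewrite ge_max; apply/andP; split; last by rewrite ler_wpDl// le_max lexx orbT.
      rewrite (le_trans (_ : `|x| <= `|x - y| + `|y|))//; last by rewrite lerD2l le_max lexx.
      by rewrite -[X in `|X| <= _](subrK y) ler_normD.
    by rewrite ler_norml; have := maxH a b; have := maxH b a; rewrite (distrC b a); lra.
  have -> : (q a)^-1 - (q b)^-1 = (Num.max `|b| eta - Num.max `|a| eta) / (2 * c * (Num.max `|a| eta * Num.max `|b| eta)).
    have ma0 : 0 < Num.max `|a| eta by rewrite lt_max eta0 orbT.
    have mb0 : 0 < Num.max `|b| eta by rewrite lt_max eta0 orbT.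
    by rewrite /q; field; rewrite !gt_eqF.
  have mm0 : 0 < Num.max `|a| eta * Num.max `|b| eta by rewrite mulr_gt0// lt_max eta0 orbT.
  rewrite normrM mulrC.
  have c20 : 0 < 2 * c by rewrite mulr_gt0.
  rewrite (_ : `|(2 * c * _)^-1| = (2 * c * (Num.max `|a| eta * Num.max `|b| eta))^-1); last first.
    by rewrite gtr0_norm// invr_gt0 mulr_gt0.
  rewrite ler_pM ?invr_ge0 ?(ltW (mulr_gt0 _ _))//.
  rewrite (mulrA 2 c) lef_pV2 ?posrE; [|exact: mulr_gt0|by apply: mulr_gt0 => //; exact: exprn_gt0].
  apply: ler_wpM2l; first exact: ltW.
  by rewrite expr2; apply: ler_pM; rewrite ?(ltW eta0)// le_max lexx orbT.
have bPhi a : eta < `|a| -> bounded_lipschitz Mg (K / (2 * c * eta)) (fun b => Phi (a, b)).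
  move=> ea; split => [x|x y]; first exact: gM.
  have c20 : 0 < 2 * c by exact: mulr_gt0.
  apply: (le_trans (gK _ _)); rewrite -[leRHS]mulrA; apply: ler_wpM2l => //=.
  rewrite -mulrBl normrM mulrC; apply: ler_wpM2r => //.
  rewrite normfV normrM (gtr0_norm c20) lef_pV2 ?posrE ?mulr_gt0 ?(lt_trans eta0 ea)//.
  by rewrite ler_wpM2l// ltW.
have PhiH a : eta < `|a| -> \int[N01]_z Phi (a, z) = H a.
  move=> ea; have a0 : a != 0 by rewrite -normr_gt0 (lt_trans eta0).
  have qE : q a = 2 * c * `|a| by rewrite /q max_l// ltW.
  rewrite /Phi/H /= qE; have [an|ap|] := ltgtP a 0; last by move/eqP; rewrite (negbTE a0).
    rewrite -(Rintegral_normal_oppr (blin (2 * c * `|a|)^-1)); apply: eq_Rintegral => z _.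
    by rewrite ltr0_norm// mulrN invrN mulrNN.
  by apply: eq_Rintegral => z _; rewrite gtr0_norm.
have Kc : 0 <= K / (2 * c * eta) by rewrite divr_ge0// !mulr_ge0// ltW.
have J := joint_limit mPhi (fun x => gM _) Kc e4 bPhi (bounded_lipschitz_measurable bH) HM PhiH.
have HA := past_scale_clt bH e4.
have [mG EG] := gaussian_ratio_bounded_lipschitz (blin (2 * sigma * c)^-1).
have mgG (x : R) : measurable_fun [set: measurableTypeR R] (fun z : R => g (z / `|x| / (2 * sigma * c))).
  rewrite (_ : (fun z => _) = (fun z => g (z * (`|x|^-1 / (2 * sigma * c))))); first exact: mgb.
  by apply/funext => z; rewrite mulrA.
have HG : `|\int[N01]_x H (sigma * x) - \int[N01]_x \int[N01]_z g (z / `|x| / (2 * sigma * c))| <= e / 4.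
  have mE : measurable [set z : measurableTypeR R | `|z| <= eta / sigma] by rewrite norm_le_itv.
  have mHs : measurable_fun [set: measurableTypeR R] (fun x : R => H (sigma * x)).
    by apply: (measurableT_comp (bounded_lipschitz_measurable bH)); exact: measurable_funM.
  apply: (le_trans (@dist_Rintegral_event _ _ _ N01 (fun x => H (sigma * x))
    (fun x => \int[N01]_z g (z / `|x| / (2 * sigma * c)))
    [set z : measurableTypeR R | `|z| <= eta / sigma] Mg 0 (Mg + Mg) mHs mG _ _ mE (lexx 0) _ _ _)).
  - by move=> x; exact: HM.
  - by move=> x; exact: norm_Rintegral_bounded (mgG x) (fun z => gM _).
  - exact: addr_ge0.
  - move=> x; rewrite (le_trans (ler_normB _ _))// lerD//.
    exact: norm_Rintegral_bounded (mgG x) (fun z => gM _).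
  - move=> x /= /negP; rewrite -ltNge ltr_pdivrMr// => xe.
    have qE : q (sigma * x) = `|x| * (2 * sigma * c).
      rewrite /q normrM (gtr0_norm s_gt0) max_l; last by rewrite mulrC ltW.
      by ring.
    rewrite (_ : H _ = \int[N01]_z g (z / `|x| / (2 * sigma * c))) ?subrr ?normr0//.
    by apply: eq_Rintegral => z _; rewrite qE invfM mulrA.
  - rewrite add0r (le_trans _ Me')// ler_wpM2l ?addr_ge0//.
    apply: (le_trans (gaussian_small_ball _)); first by rewrite divr_ge0// ltW.
    exact: eta_small.
near=> n.
have Jn : `|\int[P]_w Phi (A n w, B n w) - \int[P]_w H (A n w)| <=
    e / 4 + (Mg + Mg) * pr P [set w | `|A n w| <= eta] by near: n; exact: J.
have An : `|\int[P]_w H (A n w) - \int[N01]_z H (sigma * z)| <= e / 4 by near: n; exact: HA.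
have pn : pr P [set w | `|A n w| <= eta] <= e'.
  rewrite (le_trans (past_scale_pr_le n (_ : eta <= eta1)))//; first by rewrite ge_min lexx.
  by near: n; exact: Heta.
have pM : (Mg + Mg) * pr P [set w | `|A n w| <= eta] <= e / 4.
  by rewrite (le_trans _ Me')// ler_wpM2l// addr_ge0.
rewrite EG in HG; exact: ler_dist_quarters Jn pM An HG.
Unshelve. all: by end_near. Qed.

End autoregression.

Theorem theorem2p1 (R : realType) (d : measure_display) (T : measurableType d)
  (P : probability T R)
  (eps : int -> {RV P >-> R}) (sigma : R) (f : R -> R)
  (eps_indep : mutually_independent eps)
  (eps_ident : identically_distributed eps)
  (sigma_ge0 : 0 <= sigma)
  (eps_mean : forall i, ('E_P[eps i] = 0)%E)
  (eps_var : forall i, ('V_P[eps i] = (sigma ^+ 2)%:E)%E)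
  (eps_median : is_median 0 (eps 1))
  (f_density : has_density (eps 1) f)
  (f_derivable : forall x, derivable f x 1)
  (f0_gt0 : 0 < f 0)
  (f'_bounded : exists M : R, forall x, `|(f^`())%classic x| <= M)
  (rho : nat -> R)
  (rho_itv : forall n, 0 < rho n < 1)
  (rho_cvg : n%:R * (rho n - 1) @[n --> \oo] --> (0 : R))
  (y : nat -> nat -> {RV P >-> R})
  (y_init : forall n, {ae P, forall w,
     series (fun j : nat => rho n ^+ j * eps (- j%:Z) w) @ \oo --> y n 0%N w})
  (y_rec : forall n i w, (1 <= i <= n)%N ->
     y n i w = rho n * y n i.-1 w + eps i%:Z w)
  (rho_lad : nat -> {RV P >-> R})
  (rho_lad_sol : forall n, (0 < n)%N ->
     {ae P, forall w, lad_solution n (fun i => y n i w) (rho_lad n w)}) :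
  cvg_in_distribution P
    (fun n w => Num.sqrt (n%:R / (1 - rho n ^+ 2)) * (rho_lad n w - rho n))
    cauchy_prob (fun c => c / (2 * sigma * f 0))
  /\
  cvg_in_distribution P
    (fun n w => Num.sqrt (\sum_(1 <= i < n.+1) y n i.-1 w ^+ 2)
                * (rho_lad n w - rho n))
    (normal_prob 0 (Num.sqrt (1 / (4 * f 0 ^+ 2)))) id.

Proof.
have [M f'M] := f'_bounded.
have past_cvg n : {ae P, forall w, cvgn (series (fun j => rho n ^+ j * eps (- j%:Z) w))}.
  by apply: filterS (y_init n) => w H; apply/cvg_ex; eexists; exact: H.
(* Almost surely the given path coincides up to time [n] with the one started from [past_value]; the
   recursion holds pointwise, so the only exceptional set is that of the initial value. *)
have yE n : {ae P, forall w, forall i, (i <= n)%N -> y n i w = ar_path eps (rho n) i w}.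
  apply: filterS (past_value_ae (y_init n)) => w y0; elim=> [_|i IH i_n].
    by rewrite ar_path0.
  by rewrite ar_pathS -IH ?(ltnW i_n)//; exact: (y_rec n i.+1 w i_n).
pose A n := past_scale eps (rho n).
pose B n := sign_sum eps n.
pose U n w := B n w / (2 * f 0 * A n w).
pose that n w := Num.sqrt (n%:R / (1 - rho n ^+ 2)) * (rho_lad n w - rho n).
pose S t n := score eps (rho n) t n.
pose Q n w := (1 - rho n ^+ 2) / n%:R * \sum_(i < n) ar_path eps (rho n) i w ^+ 2.
have mQ n : measurable_fun setT (Q n).
  apply: measurable_funM => //; apply: measurable_sum => i; apply: measurable_funX.
  exact: (ar_path_square_integrable eps_indep eps_mean eps_var (rho_itv n) (past_cvg n) i).1.
have c0 : 0 < 2 * f 0 by exact: mulr_gt0.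
have k0 n : 0 < 1 - rho n ^+ 2 by exact: sqr1_gt0.
have mA n : measurable_fun setT (A n) := (past_scale_square_integrable eps_indep eps_mean eps_var rho_itv past_cvg n).1.
have mB n : measurable_fun setT (B n) := (sign_sum_square_integrable eps n).1.
have mthat n : measurable_fun setT (that n).
  by apply: measurable_funM => //; exact: measurable_funB.
have smallA e (e0 : 0 < e) := past_scale_small_ball eps_indep eps_ident sigma_ge0 eps_mean eps_var
  f_density f_derivable f'M rho_itv rho_cvg past_cvg e0.
have tA : tight P A := past_scale_tight eps_indep eps_mean eps_var rho_itv past_cvg.
have tB : tight P B := sign_sum_tight eps_indep eps_ident eps_median f_density f_derivable f'M.
have tU : tight P U := tight_ratio c0 mA smallA tB.
have mU n : measurable_fun setT (U n) := tU.1 n.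
have rate_inv n : (0 < n)%N -> rate (rho n) n * Num.sqrt (n%:R / (1 - rho n ^+ 2)) = 1.
  move=> n0; have n0' : 0 < n%:R :> R by rewrite ltr0n.
  rewrite /rate -sqrtrM; last by rewrite divr_ge0// ltW.
  by rewrite mulf_div [X in _ / X]mulrC divff ?sqrtr1// mulf_neq0 ?gt_eqF.
have S_argmin n : (0 < n)%N -> {ae P, forall w, forall t, 0 <= (that n w - t) * S t n w}.
  move=> n0; move: (yE n) (rho_lad_sol n n0); apply: filterS2 => w Ew Lw t.
  (* At the coefficient [rho n + t * rate (rho n) n] the residual of the path is
     [eps (i + 1) - t * rate (rho n) n * y i], so the first-order condition becomes the sign
     condition on the score. *)
  have := lad_subgradient (rho n + t * rate (rho n) n) n0 Lw.
  have -> : rho_lad n w - (rho n + t * rate (rho n) n) = rate (rho n) n * (that n w - t).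
    by rewrite /that mulrBr mulrA rate_inv// mul1r; ring.
  rewrite mulrAC mulrC /S /score; congr (_ <= _); congr (_ * (_ * _)).
  apply: eq_bigr => i _; rewrite -!Ew ?(ltnW (ltn_ord i))// (y_rec n i.+1 w)/=; last exact: ltn_ord.
  by congr (_ * Num.sg _); ring.
have UN : negligible_in_prob P (fun n w => that n w - U n w).
  apply: (@argmin_negligible _ _ _ P A B U that S (f 0)) => //.
  - by move=> n w An0; rewrite /U; field; rewrite An0 gt_eqF.
  - move=> t; exact: (score_negligible eps_indep eps_ident sigma_ge0 eps_mean eps_var eps_median f_density
      f_derivable f'M rho_itv rho_cvg past_cvg t).
split; apply: cvg_in_distribution_bounded_lipschitz.
- exact: mthat.
- exact: measurable_funM.
- move=> Mg K g bg e e0; have e2 : 0 < e / 2 by rewrite divr_gt0.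
  have H1 := slutsky mU UN mthat bg e2.
  have H2 := ratio_limit eps_indep eps_ident sigma_ge0 eps_mean eps_var eps_median f_density
    f_derivable f'M rho_itv rho_cvg past_cvg f0_gt0 bg e2.
  apply: filterS2 H1 H2 => n h1 h2.
  by rewrite [e]splitr (le_trans (ler_distD _ _ _) (lerD h1 h2)).
- move=> n; apply: measurable_funM; last exact: measurable_funB.
  apply: (measurableT_comp (continuous_measurable_fun (@sqrt_continuous R))).
  by apply: measurable_sum => i; exact: measurable_funX.
- exact: measurable_id.
- move=> Mg K g bg e e0; have e2 : 0 < e / 2 by rewrite divr_gt0.
  pose X n w := Num.sqrt (Q n w) * that n w.
  pose Y n w := Num.sg (A n w) * B n w / (2 * f 0).
  have Q0 n w : 0 <= Q n w.
    by apply: mulr_ge0; [rewrite divr_ge0// ltW|apply: sumr_ge0 => i _; exact: sqr_ge0].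
  have QN : negligible_in_prob P (fun n w => Num.sqrt (Q n w) - `|A n w|).
    apply: negligible_sqrt => //.
    exact: (square_sum_negligible eps_indep sigma_ge0 eps_mean eps_var rho_itv rho_cvg past_cvg).
  have mX n : measurable_fun setT (X n).
    apply: measurable_funM => //.
    by apply: (measurableT_comp (continuous_measurable_fun (@sqrt_continuous R))).
  have mY n : measurable_fun setT (Y n).
    apply: measurable_funM => //; apply: measurable_funM => //.
    exact: (measurableT_comp (@measurable_sgr R)).
  have XY : negligible_in_prob P (fun n w => X n w - Y n w).
    have N1 := negligible_in_probM QN (negligible_tight UN).
    have N2 := negligible_in_probM UN (tight_norm_exp 0 tA).
    have N3 := negligible_in_probM QN tU.
    (* Since [Y = |A| U], the difference [sqrt Q * that - |A| U] expands into products of a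
       negligible factor and a tight one. *)
    rewrite (_ : (fun n w => _) = (fun n w => (Num.sqrt (Q n w) - `|A n w|) * (that n w - U n w) +
      (that n w - U n w) * `|A n w| ^+ 1 + (Num.sqrt (Q n w) - `|A n w|) * U n w)).
      exact: negligible_in_probD (negligible_in_probD N1 N2) N3.
    apply/funext => n; apply/funext => w; rewrite expr1.
    have -> : Y n w = `|A n w| * U n w.
      rewrite /Y /U; have [->|An0] := eqVneq (A n w) 0; first by rewrite sgr0 normr0 !mul0r.
      by rewrite [in RHS]normrEsg; field; rewrite An0 gt_eqF.
    by rewrite /X; ring.
  have E n : {ae P, forall w, Num.sqrt (\sum_(1 <= i < n.+1) y n i.-1 w ^+ 2) * (rho_lad n w - rho n) = X n w}.
    apply: filterS (yE n) => w Ew; rewrite /X /Q /that big_add1/= big_mkord.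
    rewrite (eq_bigr (fun i : 'I_n => ar_path eps (rho n) i w ^+ 2)); last first.
      by move=> i _; rewrite -Ew// ltnW.
    have [->|n0] := posnP n; first by rewrite !big_ord0 mulr0 sqrtr0 !mul0r.
    rewrite sqrtrM ?divr_ge0 ?(ltW (k0 n))// -/(rate (rho n) n).
    by rewrite -[LHS]mul1r -[X in X * _ = _](rate_inv n n0); ring.
  have mX' n : measurable_fun setT (fun w => Num.sqrt (\sum_(1 <= i < n.+1) y n i.-1 w ^+ 2) * (rho_lad n w - rho n)).
    apply: measurable_funM; last exact: measurable_funB.
    apply: (measurableT_comp (continuous_measurable_fun (@sqrt_continuous R))).
    by apply: measurable_sum => i; exact: measurable_funX.
  have XY' : negligible_in_prob P (fun n w =>
      Num.sqrt (\sum_(1 <= i < n.+1) y n i.-1 w ^+ 2) * (rho_lad n w - rho n) - Y n w).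
    apply: (negligible_in_prob_ae _ XY) => n; first exact: measurable_funB.
    by apply: filterS (E n) => w ->.
  have H1 := slutsky mY XY' mX' bg e2.
  have H2 := sign_limit eps_indep eps_ident sigma_ge0 eps_mean eps_var eps_median f_density
    f_derivable f'M rho_itv rho_cvg past_cvg f0_gt0 bg e2.
  have s0 : 0 < Num.sqrt (1 / (4 * f 0 ^+ 2)).
    by rewrite sqrtr_gt0 divr_gt0// mulr_gt0// exprn_gt0.
  (* The second argument of [normal_prob] is a standard deviation, here [1 / (2 f 0)]. *)
  have sE : Num.sqrt (1 / (4 * f 0 ^+ 2)) = (2 * f 0)^-1.
    have -> : 1 / (4 * f 0 ^+ 2) = (2 * f 0)^-1 ^+ 2 by field; rewrite gt_eqF.
    by rewrite sqrtr_sqr ger0_norm// invr_ge0 ltW.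
  have LE : \int[normal_prob 0 (Num.sqrt (1 / (4 * f 0 ^+ 2)))]_z g (id z) =
      \int[normal_prob 0 1]_z g (z / (2 * f 0)).
    rewrite (Rintegral_normal_scale bg s0); apply: eq_Rintegral => z _.
    by rewrite sE mulrC.
  apply: filterS2 H1 H2 => n h1 h2; rewrite LE.
  by rewrite [e]splitr (le_trans (ler_distD _ _ _) (lerD h1 h2)).
Qed.
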